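(* Let $q>0$ and let $Q$ be the external field on $\mathbb S^2$ generated by a positive point charge of magnitude $q$ placed at the North Pole: $$Q(x)=\frac{q}{|x-p|},\qquad p=(0,0,1),\quad x\in\mathbb S^2.$$ Then the support $S_Q$ of the extremal measure $\mu_Q$ is a spherical cap $C_{S,\alpha}$ centered at the South Pole, with $\alpha=\alpha_0\in(0,\pi)$. The angle $\alpha_0$ is defined as a unique solution of the transcendental equation $$\pi\sec\alpha=\pi+q(\pi-\alpha)+q\tan\alpha.$$ The equilibrium density $f$ (that is, $d\mu_Q=f(\varphi)\sin\varphi\,d\theta\,d\varphi$) is given by $$f(\varphi)=\frac{\pi+q(\pi-\alpha_0)}{4\pi(\sin\alpha_0+\pi-\alpha_0)}\left\{1+\frac{2}{\pi}\left[\sqrt{\frac{1-\cos\alpha_0}{\cos\alpha_0-\cos\varphi}}-\tan^{-1}\sqrt{\frac{1-\cos\alpha_0}{\cos\alpha_0-\cos\varphi}}\,\right]\right\}-\frac{q}{2\pi^2}\,\frac{1}{1-\cos\varphi}\sqrt{\frac{1-\cos\alpha_0}{\cos\alpha_0-\cos\varphi}},\qquad\alpha_0\le\varphi\le\pi.$$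
   Context: $\mathbb S^2=\{x\in\mathbb R^3:|x|=1\}$, with $|\cdot|$ the Euclidean norm. Spherical coordinates are $(r,\theta,\varphi)$ with $0\le\varphi\le\pi$ the polar angle measured from the positive $x_3$-axis and $0\le\theta\le2\pi$ the azimuthal angle. For $0<\alpha\le\pi$, $C_{S,\alpha}=\{(r,\theta,\varphi): r=1,\ \alpha\le\varphi\le\pi,\ 0\le\theta\le2\pi\}$. For a unit positive Borel measure $\mu$ on $\mathbb S^2$ put $I(\mu)=\iint\frac{1}{|x-y|}\,d\mu(x)\,d\mu(y)$ and $I_Q(\mu)=I(\mu)+2\int Q\,d\mu$. Let $V_Q$ be the infimum of $I_Q(\mu)$ over all unit positive Borel measures $\mu$ on $\mathbb S^2$. The extremal (equilibrium) measure $\mu_Q$ is the unit positive Borel measure on $\mathbb S^2$ with $I_Q(\mu_Q)=V_Q$, and $S_Q=\operatorname{supp}\mu_Q$.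
   Formalization: At α = π/2, where sec and tan have poles, the equation for α₀ is read after multiplying both sides by cos α; this matters only for q = π, where the equation as printed has no solution in (0, π) and α₀ = π/2. *)

(* Defs.v *)
From mathcomp Require Import all_boot all_order all_algebra.
From mathcomp Require Import all_classical all_reals all_analysis.

Set Implicit Arguments.
Unset Strict Implicit.
Unset Printing Implicit Defensive.

Import Order.TTheory GRing.Theory Num.Theory.
Import numFieldNormedType.Exports.

Local Open Scope classical_set_scope.
Local Open Scope ring_scope.

(* Points of R^3 are triples ((x1, x2), x3). The product topology is the usual
   one, and the product sigma-algebra is the Borel sigma-algebra of R^3. *)
Notation R3 R := (R * R * R)%type.

(* The norm of the product [R * R * R] in the library is the sup norm, hence
   this explicit Euclidean distance. *)
Definition dist3 {R : realType} (x y : R3 R) : R :=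
  Num.sqrt ((x.1.1 - y.1.1) ^+ 2 + (x.1.2 - y.1.2) ^+ 2 + (x.2 - y.2) ^+ 2).

Definition S2 {R : realType} : set (R3 R) := [set x | dist3 x (0, 0, 0) = 1].

Definition north_pole {R : realType} : R3 R := (0, 0, 1).

(* theta is the azimuthal angle, phi the polar angle from the x3-axis. *)
Definition spherical {R : realType} (theta phi : R) : R3 R :=
  (sin phi * cos theta, sin phi * sin theta, cos phi).

Definition cap {R : realType} (alpha : R) : set (R3 R) :=
  [set x | exists theta phi : R,
     [/\ 0 <= theta <= 2 * pi, alpha <= phi <= pi & x = spherical theta phi]].

(* Unit positive Borel measures on S2, as Borel probability measures on R^3
   carried by S2. *)
Definition on_sphere {R : realType} (mu : probability (R3 R) R) : Prop :=
  mu S2 = 1%E.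

Section energy.
Local Open Scope ereal_scope.

(* The inverse is that of \bar R, with 0^-1 = +oo: the kernel 1 / |x - y| is
   +oo on the diagonal. *)
Definition energy {R : realType} (mu : probability (R3 R) R) : \bar R :=
  \int[mu]_(x in S2) \int[mu]_(y in S2) ((dist3 x y)%:E)^-1.

Definition weighted_energy {R : realType} (Q : R3 R -> \bar R)
    (mu : probability (R3 R) R) : \bar R :=
  energy mu + 2%:E * \int[mu]_(x in S2) Q x.

Definition min_energy {R : realType} (Q : R3 R -> \bar R) : \bar R :=
  ereal_inf [set weighted_energy Q mu | mu in on_sphere].

Definition extremal {R : realType} (Q : R3 R -> \bar R)
    (mu : probability (R3 R) R) : Prop :=
  on_sphere mu /\ weighted_energy Q mu = min_energy Q.

Definition msupport {R : realType} (mu : probability (R3 R) R) : set (R3 R) :=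
  [set x | forall U : set (R3 R), open U -> U x -> 0 < mu U].

(* Equal to +oo at the North Pole. *)
Definition point_charge_field {R : realType} (q : R) (x : R3 R) : \bar R :=
  q%:E / (dist3 x north_pole)%:E.

(* d mu = f(phi) sin(phi) dtheta dphi on the cap alpha <= phi <= pi, and mu
   vanishes off the cap. *)
Definition has_density_on_cap {R : realType} (mu : probability (R3 R) R)
    (alpha : R) (f : R -> R) : Prop :=
  forall A : set (R3 R), measurable A ->
    mu A =
    \int[lebesgue_measure]_(phi in `[alpha, pi])
      \int[lebesgue_measure]_(theta in `[0%R, (2 * pi)%R])
        (f phi * sin phi * \1_A (spherical theta phi))%:E.

End energy.

Definition sec {R : realType} (x : R) : R := (cos x)^-1.

(* Where cos alpha = 0, sec and tan have a pole; there the equation is read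
   after multiplying both sides by cos alpha. On (0, pi) this only matters for
   q = pi, whose solution is alpha = pi / 2. *)
Definition cap_angle_equation {R : realType} (q alpha : R) : Prop :=
  if cos alpha == 0
  then pi = (pi + q * (pi - alpha)) * cos alpha + q * sin alpha
  else pi * sec alpha = pi + q * (pi - alpha) + q * tan alpha.

(* At phi = alpha the quotient under the square root is 0 by the convention
   x / 0 = 0; this single value of phi does not affect the integrals. *)
Definition cap_density {R : realType} (q alpha phi : R) : R :=
  let s := Num.sqrt ((1 - cos alpha) / (cos alpha - cos phi)) in
  (pi + q * (pi - alpha)) / (4 * pi * (sin alpha + pi - alpha))
    * (1 + 2 / pi * (s - atan s))
  - q / (2 * pi ^+ 2) * (1 / (1 - cos phi)) * s.

(* Main.v *)
From HB Require Import structures.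
Require Import Defs.
From mathcomp Require Import all_boot all_order all_algebra.
From mathcomp Require Import ring lra.
From mathcomp Require Import all_classical all_reals all_analysis.
From mathcomp Require Import measurable_realfun.
Import Order.TTheory GRing.Theory Num.Theory.
Import numFieldNormedType.Exports.
Local Open Scope classical_set_scope.
Local Open Scope ring_scope.
Set Implicit Arguments.
Unset Strict Implicit.
Unset Printing Implicit Defensive.

(** Write c = cos alpha, and let F be the value of the total potential on the
    support.  The equation for alpha says exactly that
      q = F (1 - c)   and   F (sin alpha + c (pi - alpha)) = pi
    for one and the same F ([cap_angle_constants]), and then the density f is
    F / (2 pi^2) times [cap_core alpha] ([cap_density_core]), where at the polar
    angle phi, with a = cos phi,
      cap_core = (1 - a)^-1 int_a^c sqrt ((1 - w) / (w - a)) dw.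
    The proof takes the probability mu0 with this density and shows that it is
    the only minimiser.

    Potential of mu0.  The integral over a circle of latitude of the Newtonian
    kernel is an elliptic integral, but it separates the two heights a and b:
      int_0^(2 pi) dtheta / |x - y|
        = 2 int_-1^min(a,b) dz / sqrt ((1 - z^2) (a - z) (b - z))
    ([azimuth_integral], from Landen's transformation and a formula of Copson).
    Integrating first in a and then in z, the potential of a measure invariant
    by rotation is obtained by two integrals of Abel type, and for [cap_core]
    both reduce to the elementary [integral_chord].  The outcome is the pair of
    Frostman conditions ([frostman]): U + Q = F on the cap and U + Q >= F on the
    rest of the sphere.

    Positivity of the energy.  Since
      1 / d = (2 / pi) int_0^oo dt / (t^2 + d^2),
    and d^2 = 2 - 2 x.y on the sphere, while 1 / (t^2 + 2 - 2 u) is a power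
    series in u with positive coefficients and (x.y)^n is a sum of products
    m(x) m(y) of monomials, the energy of the signed measure mu - nu dominates a
    positive multiple of the square of each moment difference.  This is
    [mutual_energy_gap], stated without subtractions because energies may be
    infinite.

    Minimality and uniqueness.  The Frostman conditions integrated against mu,
    together with [mutual_energy_gap], give
      I_Q(mu) >= I_Q(mu0) + C (moment difference)^2
    for every mu on the sphere ([weighted_energy_gap]).  So mu0 is extremal, and
    an extremal measure has the same moments as mu0, hence is mu0, because
    explicit polynomials converge boundedly on [-1, 1] to indicators of
    half-lines ([moments_eq_measure]).  The support and the density are then
    read off mu0. *)

(** * Improper integrals on open intervals *)

Lemma within_continuous_itvS (R : realType) (f : R -> R) (a b x y : R) :
  {in `]a, b[, continuous f} -> a < x -> y < b ->
  {within `[x, y], continuous f}.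
Proof.
move=> cf ax yb; apply: continuous_in_subspaceT => z /[!inE]/= /[!in_itv]/= /andP[xz zy].
by apply: cf; rewrite in_itv/= (lt_le_trans ax xz) (le_lt_trans zy yb).
Qed.

(** Shared by both ends: [inner_pt a b] decreases to [a] and [inner_pt b a]
    increases to [b].  The shift by 3 keeps the former below the latter from the
    start. *)
Definition inner_pt (R : realType) (a b : R) (n : nat) : R :=
  a + (b - a) / n.+3%:R.

Lemma cvg_inner_pt (R : realType) (a b : R) :
  inner_pt a b n @[n --> \oo] --> a.
Proof.
rewrite /inner_pt -[X in _ --> X]addr0; apply: cvgD; first exact: cvg_cst.
rewrite -[X in _ --> X](mulr0 (b - a)); apply: cvgM; first exact: cvg_cst.
have := @cvg_harmonic R; rewrite -(cvg_shiftn 2)/=.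
by under eq_fun do rewrite addn2.
Qed.

Lemma inner_ptP (R : realType) (a b : R) (n : nat) : a < b ->
  a < inner_pt a b n /\ inner_pt a b n < inner_pt b a n /\
  inner_pt b a n < b.
Proof.
move=> ab; rewrite /inner_pt.
have n0 : 0 < (n.+3%:R)^-1 :> R by rewrite invr_gt0 ltr0n.
have n3 : (n.+3%:R)^-1 <= 3^-1 :> R by rewrite lef_pV2 ?posrE ?ltr0n// ler_nat.
set k := _^-1 in n0 n3 *.
split; [|split]; nra.
Qed.

Lemma inner_pt_nincr (R : realType) (a b : R) : a < b ->
  {homo inner_pt a b : m n / (m <= n)%N >-> (n <= m)}.
Proof.
move=> ab m n mn; rewrite /inner_pt lerD2l ler_wpM2l//; first by rewrite subr_ge0 ltW.
by rewrite lef_pV2 ?posrE ?ltr0n// ler_nat.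
Qed.

Lemma inner_pt_ndecr (R : realType) (a b : R) : a < b ->
  {homo inner_pt b a : m n / (m <= n)%N >-> (m <= n)}.
Proof.
move=> ab m n mn; rewrite /inner_pt lerD2l ler_wnM2l//; first by rewrite subr_le0 ltW.
by rewrite lef_pV2 ?posrE ?ltr0n// ler_nat.
Qed.

Lemma ge0_cvg_integral_itvoo (R : realType) (a b : R) (f : R -> R)
    (u v : nat -> R) :
  {homo u : m n / (m <= n)%N >-> (n <= m)} ->
  {homo v : m n / (m <= n)%N >-> (m <= n)} ->
  (forall n, a < u n) -> (forall n, v n < b) ->
  u n @[n --> \oo] --> a -> v n @[n --> \oo] --> b ->
  {in `]a, b[, continuous f} -> {in `]a, b[, forall x, 0 <= f x} ->
  (\int[lebesgue_measure]_(x in `[u n, v n]) (f x)%:E @[n --> \oo] -->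
   \int[lebesgue_measure]_(x in `]a, b[) (f x)%:E)%E.
Proof.
move=> ud vi au vb ua vb' cf f0.
have -> : `]a, b[%classic = \bigcup_n `[u n, v n]%classic :> set R.
  apply/seteqP; split => [x /=|x [n _]/=]; rewrite !in_itv/=; last first.
    by move=> /andP[ux xv]; rewrite (lt_le_trans (au n) ux) (le_lt_trans xv (vb n)).
  move=> /andP[ax xb].
  have nu : \forall n \near \oo, u n < x by exact: cvgr_lt ua _ ax.
  have nv : \forall n \near \oo, x < v n by exact: cvgr_gt vb' _ xb.
  near \oo => n; exists n => //=; rewrite in_itv/=.
  by apply/andP; split; apply/ltW; near: n.
apply: ge0_nondecreasing_set_cvg_integral => //.
- move=> m n mn; apply/subsetPset; apply: subset_itv; rewrite bnd_simp; [exact: ud|exact: vi].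
- move=> n; apply/measurable_EFinP; apply: subspace_continuous_measurable_fun => //.
  exact: within_continuous_itvS cf (au n) (vb n).
- move=> n x/=; rewrite in_itv/= lee_fin => /andP[ux xv]; apply: f0.
  by rewrite in_itv/= (lt_le_trans (au n) ux) (le_lt_trans xv (vb n)).
Unshelve. all: end_near. Qed.

Lemma is_derive_continuous (R : realType) (F : R -> R) (x d : R) :
  is_derive x 1 F d -> continuous_at x F.
Proof.
by move=> [dF _]; apply/differentiable_continuous/derivable1_diffP.
Qed.

(** The integrands met below blow up at an end point, and their primitives need
    not be differentiable there: one-sided limits suffice, by exhausting the open
    interval with closed ones. *)
Lemma ge0_FTC2_itvoo (R : realType) (a b : R) (f F : R -> R) (A B : R) :
  a < b ->
  {in `]a, b[, continuous f} -> {in `]a, b[, forall x, 0 <= f x} ->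
  {in `]a, b[, forall x : R, is_derive x 1 F (f x)} ->
  F x @[x --> a^'+] --> A -> F x @[x --> b^'-] --> B ->
  (\int[lebesgue_measure]_(x in `]a, b[) (f x)%:E = (B - A)%:E)%E.
Proof.
move=> ab cf f0 dF Fa Fb.
pose u := inner_pt a b; pose v := inner_pt b a.
have au n : a < u n by have [] := inner_ptP n ab.
have uv n : u n < v n by have [_ []] := inner_ptP n ab.
have vb n : v n < b by have [_ []] := inner_ptP n ab.
have ub n : u n < b by exact: lt_trans (uv n) (vb n).
have av n : a < v n by exact: lt_trans (au n) (uv n).
have Fu : F (u n) @[n --> \oo] --> A.
  by apply: ((cvg_at_rightP F a A).1 Fa u); split => //; exact: cvg_inner_pt.
have Fv : F (v n) @[n --> \oo] --> B.
  by apply: ((cvg_at_leftP F b B).1 Fb v); split => //; exact: cvg_inner_pt.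
have := @ge0_cvg_integral_itvoo R a b f u v (inner_pt_nincr ab)
  (inner_pt_ndecr ab) au vb (@cvg_inner_pt R a b) (@cvg_inner_pt R b a) cf f0.
have -> : (fun n => \int[lebesgue_measure]_(x in `[u n, v n]) (f x)%:E)%E =
    (fun n => (F (v n) - F (u n))%:E).
  apply/funext => n; rewrite EFinB; apply: continuous_FTC2 => //.
  - exact: within_continuous_itvS cf (au n) (vb n).
  - split.
    + move=> x /[!in_itv]/= /andP[ux xv]; apply: (ex_derive (is_derive := dF x _)).
      by rewrite in_itv/= (lt_trans (au n) ux) (lt_trans xv (vb n)).
    + apply: cvg_at_right_filter; apply: is_derive_continuous (dF _ _).
      by rewrite in_itv/= au ub.
    + apply: cvg_at_left_filter; apply: is_derive_continuous (dF _ _).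
      by rewrite in_itv/= av vb.
  - move=> x /[!in_itv]/= /andP[ux xv]; rewrite derive1E; apply: derive_val.
    apply: dF; by rewrite in_itv/= (lt_trans (au n) ux) (lt_trans xv (vb n)).
have : (F (v n) - F (u n))%:E @[n --> \oo] --> (B - A)%:E.
  by apply: cvg_EFin; [exact: nearW|exact: cvgB].
by move=> /cvg_unique /[apply] ->.
Qed.

(** Only the behaviour of [G] inside the open interval matters, again by
    exhaustion, so that [G] may be singular at the ends. *)
Lemma ge0_integration_by_substitution_itvoo (R : realType) (a b : R)
    (F F' G : R -> R) :
  a < b ->
  {in `[a, b] &, {homo F : x y / x < y}} ->
  (forall x : R, is_derive x 1 F (F' x)) -> continuous F' ->
  {in `]F a, F b[, continuous G} -> {in `]F a, F b[, forall x, 0 <= G x} ->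
  (\int[lebesgue_measure]_(y in `]F a, F b[) (G y)%:E =
   \int[lebesgue_measure]_(x in `]a, b[) (G (F x) * F' x)%:E)%E.
Proof.
move=> ab incF dF cF' cG G0.
pose u := inner_pt a b; pose v := inner_pt b a.
have au n : a < u n by have [] := inner_ptP n ab.
have uv n : u n < v n by have [_ []] := inner_ptP n ab.
have vb n : v n < b by have [_ []] := inner_ptP n ab.
have ub n : u n < b by exact: lt_trans (uv n) (vb n).
have av n : a < v n by exact: lt_trans (au n) (uv n).
have cF : continuous F by move=> x; exact: is_derive_continuous (dF x).
have F'E : derive1 F = F'.
  by apply/funext => x; rewrite derive1E; exact: derive_val.
have iF x y : a <= x -> x < y -> y <= b -> F x < F y.
  move=> ax xy yb; apply: incF => //; rewrite in_itv/=.
    by rewrite ax (le_trans (ltW xy) yb).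
  by rewrite yb (le_trans ax (ltW xy)).
have iFw x y : a <= x -> x <= y -> y <= b -> F x <= F y.
  move=> ax; rewrite le_eqVlt => /predU1P[->//|xy yb].
  by apply: ltW; exact: iF.
have F'0 x : a < x < b -> 0 <= F' x.
  move=> xab; rewrite -F'E.
  apply: (@incr_derive1_ge0_itv R F true false a b x) => //.
have cGF : {in `]a, b[, continuous (fun x => G (F x) * F' x)}.
  move=> x /[!in_itv]/= /andP[ax xb]; apply: cvgM; last exact: cF'.
  apply: continuous_comp; first exact: cF.
  by apply: cG; rewrite in_itv/= !iF// ltW.
have GF0 : {in `]a, b[, forall x, 0 <= G (F x) * F' x}.
  move=> x /[!in_itv]/= /andP[ax xb]; rewrite mulr_ge0 ?F'0 ?ax//.
  by apply: G0; rewrite in_itv/= !iF// ltW.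
have h1 := @ge0_cvg_integral_itvoo R a b _ u v (inner_pt_nincr ab)
  (inner_pt_ndecr ab) au vb (@cvg_inner_pt R a b) (@cvg_inner_pt R b a) cGF GF0.
have h2 : (\int[lebesgue_measure]_(x in `[F (u n), F (v n)]) (G x)%:E @[n --> \oo] -->
   \int[lebesgue_measure]_(x in `]F a, F b[) (G x)%:E)%E.
  apply: ge0_cvg_integral_itvoo => //.
  - move=> m n mn; apply: iFw; [exact: ltW|exact: inner_pt_nincr|exact: ltW].
  - move=> m n mn; apply: iFw; [exact: ltW|exact: inner_pt_ndecr|exact: ltW].
  - by move=> n; apply: iF => //; exact: ltW.
  - by move=> n; apply: iF => //; exact: ltW.
  - by apply: continuous_cvg; [exact: cF|exact: cvg_inner_pt].
  - by apply: continuous_cvg; [exact: cF|exact: cvg_inner_pt].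
apply: (cvg_unique (@ereal_hausdorff R) h2).
apply: cvg_trans h1; apply: near_eq_cvg; apply: nearW => n /=.
rewrite (@integration_by_substitution_increasing R F G (u n) (v n)) ?F'E//.
- exact: ltW.
- move=> x y /[!in_itv]/= /andP[ux xv] /andP[uy yv] xy; apply: iF => //.
    by rewrite (le_trans _ ux)// ltW.
  exact: le_trans yv (ltW (vb n)).
- by apply: cvgP; apply: cvg_at_right_filter; exact: cF'.
- by apply: cvgP; apply: cvg_at_left_filter; exact: cF'.
- split; [by move=> x _|apply: cvg_at_right_filter; exact: cF
    |apply: cvg_at_left_filter; exact: cF].
- by apply: (@within_continuous_itvS R G (F a) (F b)) => //; apply: iF => //; exact: ltW.
Qed.

(** * Derivatives, continuity and an elementary integral *)

Lemma sqr_inj (R : realType) (x y : R) : 0 <= x -> 0 <= y -> x ^+ 2 = y ^+ 2 -> x = y.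
Proof. by move=> x0 y0 /eqP; rewrite eqrXn2// => /eqP. Qed.

Lemma is_derive_fun_comp (R : realType) (f g : R -> R) (x a b : R) :
  is_derive (g x) 1 f a -> is_derive x 1 g b ->
  is_derive x 1 (fun y => f (g y)) (a * b).
Proof. by move=> fa gb; exact: is_derive1_comp. Qed.

Lemma is_derive_fun_inv (R : realType) (g : R -> R) (x b : R) :
  g x != 0 -> is_derive x 1 g b ->
  is_derive x 1 (fun y => (g y)^-1) (- b / (g x) ^+ 2).
Proof.
move=> gx0 gb; have := @is_deriveV R g x b 1 gx0 gb.
by move=> h; apply: (is_derive_eq (df := _) h); rewrite /GRing.scale/= -exprVn mulNr mulrC mulNr.
Qed.

Lemma is_derive_fun_sqrt (R : realType) (g : R -> R) (x b : R) :
  0 < g x -> is_derive x 1 g b ->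
  is_derive x 1 (fun y => Num.sqrt (g y)) (b / (2 * Num.sqrt (g x))).
Proof.
move=> gx0 gb; rewrite mulrC; apply: is_derive_fun_comp => //.
exact: is_derive1_sqrt.
Qed.

Lemma is_derive_fun_atan (R : realType) (g : R -> R) (x b : R) :
  is_derive x 1 g b ->
  is_derive x 1 (fun y => atan (g y)) (b / (1 + g x ^+ 2)).
Proof.
by move=> gb; rewrite mulrC; exact: is_derive_fun_comp.
Qed.

Lemma is_derive_fun_mul (R : realType) (f g : R -> R) (x a b : R) :
  is_derive x 1 f a -> is_derive x 1 g b ->
  is_derive x 1 (fun y => f y * g y) (a * g x + f x * b).
Proof.
move=> fa gb; have h : is_derive x 1 (f * g) _ := is_deriveM fa gb.
by apply: (is_derive_eq (df := _) h); rewrite /GRing.scale/= addrC [g x * a]mulrC.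
Qed.

Lemma is_derive_fun_div (R : realType) (f g : R -> R) (x a b : R) :
  g x != 0 ->
  is_derive x 1 f a -> is_derive x 1 g b ->
  is_derive x 1 (fun y => f y / g y) ((a * g x - f x * b) / g x ^+ 2).
Proof.
move=> gx0 fa gb.
have h := is_derive_fun_mul fa (is_derive_fun_inv gx0 gb).
by apply: (is_derive_eq (df := _) h); field.
Qed.

Lemma atanV (R : realType) (x : R) : 0 < x -> atan x^-1 = pi / 2 - atan x.
Proof.
move=> x0; have a0 : 0 < atan x by rewrite -(@atan0 R) lt_atan.
have a1 := atan_ltpi2 x.
rewrite -[RHS]tanK ?in_itv/=; last by apply/andP; split; lra.
congr atan; rewrite -[in LHS](atanK x) /tan invf_div.
by rewrite sinB cosB sin_pihalf cos_pihalf !mul0r !mul1r add0r subr0.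
Qed.

Lemma continuous_fun_sqrt (R : realType) (g : R -> R) (x : R) :
  continuous_at x g -> continuous_at x (fun y => Num.sqrt (g y)).
Proof. by move=> cg; apply: continuous_comp => //; exact: sqrt_continuous. Qed.

Lemma continuous_fun_inv (R : realType) (g : R -> R) (x : R) :
  g x != 0 -> continuous_at x g -> continuous_at x (fun y => (g y)^-1).
Proof. by move=> gx cg; exact: cvgV. Qed.

Lemma continuous_fun_mul (R : realType) (f g : R -> R) (x : R) :
  continuous_at x f -> continuous_at x g ->
  continuous_at x (fun y => f y * g y).
Proof. by move=> cf cg; exact: cvgM. Qed.

Lemma continuous_fun_add (R : realType) (f g : R -> R) (x : R) :
  continuous_at x f -> continuous_at x g ->
  continuous_at x (fun y => f y + g y).
Proof. by move=> cf cg; exact: cvgD. Qed.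

Lemma continuous_fun_sub (R : realType) (f g : R -> R) (x : R) :
  continuous_at x f -> continuous_at x g ->
  continuous_at x (fun y => f y - g y).
Proof. by move=> cf cg; exact: cvgB. Qed.

Lemma continuous_fun_comp (R : realType) (f g : R -> R) (x : R) :
  continuous_at x g -> continuous_at (g x) f ->
  continuous_at x (fun y => f (g y)).
Proof. by move=> cf cg; exact: continuous_comp. Qed.

Lemma continuous_affine (R : realType) (l m x : R) :
  continuous_at x (fun y => l - m * y).
Proof.
apply: cvgB; first exact: cvg_cst.
by apply: cvgM; [exact: cvg_cst|exact: cvg_id].
Qed.

Lemma is_derive_affine (R : realType) (l m x : R) :
  is_derive x 1 (fun y => l - m * y) (- m).
Proof.
have h : is_derive x 1 (cst l - cst m * id) _ :=
  is_deriveB (is_derive_cst l x 1) (is_deriveM (is_derive_cst m x 1) (is_derive_id x 1)).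
by apply: (is_derive_eq (df := _) h); rewrite /GRing.scale/= /cst mulr0 addr0 mulr1 sub0r.
Qed.

(** The one elementary integral to which every integral in a polar angle or a
    height reduces.  The substitution h = (lv / lu) (a - u) / (v - a) maps
    ]u, v[ to ]0, +oo[ and turns the integrand into that of
    (2 / C) atan (sqrt h). *)
Lemma integral_chord (R : realType) (u v l m : R) :
  u < v -> 0 < l - m * u -> 0 < l - m * v ->
  (\int[lebesgue_measure]_(a in `]u, v[)
     ((l - m * a) * Num.sqrt ((a - u) * (v - a)))^-1%:E =
   (pi / Num.sqrt ((l - m * u) * (l - m * v)))%:E)%E.
Proof.
move=> uv lu lv.
set lu' := l - m * u in lu *; set lv' := l - m * v in lv *.
have la a : u < a -> a < v -> 0 < l - m * a.
  move=> ua av.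
  have -> : l - m * a = (lu' * (v - a) + lv' * (a - u)) / (v - u).
    by rewrite /lu' /lv'; field; rewrite subr_eq0 gt_eqF.
  apply: divr_gt0; last by rewrite subr_gt0.
  by apply: addr_gt0; apply: mulr_gt0 => //; rewrite subr_gt0.
set C := Num.sqrt (lu' * lv').
have C0 : 0 < C by rewrite sqrtr_gt0 mulr_gt0.
have C2 : C ^+ 2 = lu' * lv' by rewrite sqr_sqrtr// mulr_ge0// ltW.
pose h (a : R) := lv' / lu' * ((a - u) / (v - a)).
pose k (a : R) := lu' / lv' * ((v - a) / (a - u)).
pose F (a : R) := 2 / C * atan (Num.sqrt (h a)).
have h0 a : u < a -> a < v -> 0 < h a.
  by move=> ua av; rewrite mulr_gt0// divr_gt0// subr_gt0.
have ch a : a < v -> continuous_at a h.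
  move=> av; apply: continuous_fun_mul; first exact: cvg_cst.
  apply: continuous_fun_mul; first by apply: cvgB => //; exact: cvg_cst.
  apply: continuous_fun_inv; first by rewrite subr_eq0 gt_eqF.
  by apply: cvgB => //; exact: cvg_cst.
have ck a : u < a -> continuous_at a k.
  move=> av; apply: continuous_fun_mul; first exact: cvg_cst.
  apply: continuous_fun_mul; first by apply: cvgB => //; exact: cvg_cst.
  apply: continuous_fun_inv; first by rewrite subr_eq0 gt_eqF.
  by apply: cvgB => //; exact: cvg_cst.
have -> : pi / C = 2 / C * (pi / 2) - F u.
  rewrite /F /h subrr mul0r mulr0 sqrtr0 atan0 mulr0 subr0.
  by field; rewrite gt_eqF.
apply: (@ge0_FTC2_itvoo R u v
  (fun a : R => ((l - m * a) * Num.sqrt ((a - u) * (v - a)))^-1) F) => //.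
- move=> a /[!in_itv]/= /andP[ua av]; apply: continuous_fun_inv.
    by rewrite gt_eqF// mulr_gt0 ?la// sqrtr_gt0 mulr_gt0 ?subr_gt0.
  apply: continuous_fun_mul; first exact: continuous_affine.
  apply: continuous_fun_sqrt; apply: continuous_fun_mul.
    by apply: cvgB => //; exact: cvg_cst.
  by apply: cvgB => //; exact: cvg_cst.
- move=> a /[!in_itv]/= /andP[ua av].
  by rewrite invr_ge0 mulr_ge0 ?sqrtr_ge0// ltW// la.
- move=> a /[!in_itv]/= /andP[ua av].
  have va0 : v - a != 0 by rewrite subr_eq0 gt_eqF.
  have dh : is_derive a 1 h (lv' / lu' * ((v - u) / (v - a) ^+ 2)).
    have d1 : is_derive a 1 (fun y : R => y - u) 1.
      have := is_derive_affine (- u) (-1) a; rewrite opprK.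
      by under eq_fun do rewrite mulN1r opprK addrC.
    have d2 : is_derive a 1 (fun y : R => v - y) (-1).
      by have := is_derive_affine v 1 a; under eq_fun do rewrite mul1r.
    have d3 := is_derive_fun_mul (is_derive_cst (lv' / lu') a 1)
       (@is_derive_fun_div R _ (fun y : R => v - y) a _ _ va0 d1 d2).
    by apply: (is_derive_eq (df := _) d3); rewrite /cst; field; rewrite ?va0 ?gt_eqF.
  have d4 := is_derive_fun_mul (is_derive_cst (2 / C) a 1)
     (is_derive_fun_atan (is_derive_fun_sqrt (h0 a ua av) dh)).
  apply: (is_derive_eq (df := _) d4).
  have hs : C * (v - a) * Num.sqrt (h a) = lv' * Num.sqrt ((a - u) * (v - a)).
    apply: sqr_inj.
    - by rewrite !mulr_ge0 ?sqrtr_ge0// ?ltW// subr_gt0.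
    - by rewrite mulr_ge0 ?sqrtr_ge0// ltW.
    rewrite !exprMn C2 !sqr_sqrtr ?(ltW (h0 a ua av))// ?mulr_ge0 ?subr_ge0 1?ltW//.
    by rewrite /h; field; rewrite va0 gt_eqF.
  have s0 : Num.sqrt (h a) != 0 by rewrite gt_eqF// sqrtr_gt0 h0.
  have q0 : Num.sqrt ((a - u) * (v - a)) != 0.
    by rewrite gt_eqF// sqrtr_gt0 mulr_gt0 ?subr_gt0.
  have la0 : l - m * a != 0 by rewrite gt_eqF// la.
  have vu0 : v - u != 0 by rewrite subr_eq0 gt_eqF.
  have C0' : C != 0 by rewrite gt_eqF.
  have lv0 : lv' != 0 by rewrite gt_eqF.
  have lu0 : lu' != 0 by rewrite gt_eqF.
  have -> : ((l - m * a) * Num.sqrt ((a - u) * (v - a)))^-1 =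
      lv' / ((l - m * a) * (C * (v - a) * Num.sqrt (h a))).
    by rewrite hs; field; rewrite la0 q0 gt_eqF.
  rewrite sqr_sqrtr ?(ltW (h0 a ua av))//.
  have -> : 1 + h a = (l - m * a) * (v - u) / (lu' * (v - a)).
    by rewrite /h /lu' /lv'; field; rewrite va0 gt_eqF.
  by rewrite /cst; field; rewrite ?(va0, s0, la0, vu0, C0', lv0, lu0).
- apply: cvg_at_right_filter; change (continuous_at u F).
  apply: continuous_fun_mul; first exact: cvg_cst.
  apply: continuous_comp; last exact: continuous_atan.
  by apply: continuous_fun_sqrt; exact: ch.
- have : (fun a => 2 / C * (pi / 2 - atan (Num.sqrt (k a)))) a @[a --> v^'-] -->
      2 / C * (pi / 2 - atan (Num.sqrt (k v))).
    apply: cvg_at_left_filter.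
    change (continuous_at v (fun a => 2 / C * (pi / 2 - atan (Num.sqrt (k a))))).
    apply: continuous_fun_mul; first exact: cvg_cst.
    apply: cvgB; first exact: cvg_cst.
    apply: continuous_comp; last exact: continuous_atan.
    by apply: continuous_fun_sqrt; exact: ck.
  (* F extends to v through k = h^-1, which vanishes there. *)
  rewrite /k subrr mul0r mulr0 sqrtr0 atan0 subr0.
  apply: cvg_trans; apply: near_eq_cvg; near=> a.
  have ua : u < a by [].
  have av : a < v by [].
  rewrite /F; congr (_ * _); rewrite -/(k a).
  have -> : k a = (h a)^-1.
    by rewrite /k /h !invfM !invrK; ring.
  by rewrite sqrtrV ?ltW ?h0// atanV ?sqrtr_gt0 ?h0// opprB addrC subrK.
Unshelve. all: end_near. Qed.

(** * Measurability of explicit functions *)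

Section measurability.
Context d (T : measurableType d) (R : realType).
Implicit Types f g : T -> R.

Lemma mf_cont (h : R -> R) f : continuous h -> measurable_fun setT f ->
  measurable_fun setT (fun x => h (f x)).
Proof.
by move=> ch mf; apply: measurableT_comp => //; exact: continuous_measurable_fun.
Qed.

Lemma mf_sqrt f : measurable_fun setT f ->
  measurable_fun setT (fun x => Num.sqrt (f x)).
Proof. by apply: mf_cont; exact: sqrt_continuous. Qed.

Lemma mf_cos f : measurable_fun setT f -> measurable_fun setT (fun x => cos (f x)).
Proof. by apply: mf_cont; exact: continuous_cos. Qed.

Lemma mf_sin f : measurable_fun setT f -> measurable_fun setT (fun x => sin (f x)).
Proof. by apply: mf_cont; exact: continuous_sin. Qed.

Lemma mf_atan f : measurable_fun setT f -> measurable_fun setT (fun x => atan (f x)).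
Proof. by apply: mf_cont; exact: continuous_atan. Qed.

(** No continuity at 0, where the inverse is 0 by convention: the formula
    x^-1 = x (x^2)^-1 reduces the claim to powers of a nonnegative number. *)
Lemma mf_inv f : measurable_fun setT f -> measurable_fun setT (fun x => (f x)^-1).
Proof.
move=> mf.
have -> : (fun x => (f x)^-1) = (fun x => f x * (f x ^+ 2) `^ (-1)).
  apply/funext => x; rewrite powR_inv1 ?sqr_ge0//.
  have [->|fx0] := eqVneq (f x) 0; first by rewrite invr0 mul0r.
  by rewrite expr2 invfM mulrA mulfV// mul1r.
apply: measurable_funM => //.
exact: (measurableT_comp (measurable_powR (-1)) (measurable_funX 2 mf)).
Qed.

Lemma mf_opp f : measurable_fun setT f -> measurable_fun setT (fun x => - f x).
Proof. exact: measurable_funN. Qed.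

Lemma mf_add f g : measurable_fun setT f -> measurable_fun setT g ->
  measurable_fun setT (fun x => f x + g x).
Proof. exact: measurable_funD. Qed.

Lemma mf_mul f g : measurable_fun setT f -> measurable_fun setT g ->
  measurable_fun setT (fun x => f x * g x).
Proof. exact: measurable_funM. Qed.

Lemma mf_exp f n : measurable_fun setT f -> measurable_fun setT (fun x => f x ^+ n).
Proof. exact: measurable_funX. Qed.

Lemma mf_lt f g : measurable_fun setT f -> measurable_fun setT g ->
  measurable_fun setT (fun x => f x < g x).
Proof. exact: measurable_fun_ltr. Qed.

Lemma mf_le f g : measurable_fun setT f -> measurable_fun setT g ->
  measurable_fun setT (fun x => f x <= g x).
Proof. exact: measurable_fun_ler. Qed.

Lemma mf_and (f g : T -> bool) : measurable_fun setT f -> measurable_fun setT g ->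
  measurable_fun setT (fun x => f x && g x).
Proof. exact: measurable_and. Qed.

Lemma mf_fst d1 d2 (T1 : measurableType d1) (T2 : measurableType d2)
    (f : T -> T1 * T2) : measurable_fun setT f -> measurable_fun setT (fun x => (f x).1).
Proof. by move=> mf; exact: (measurableT_comp measurable_fst mf). Qed.

Lemma mf_snd d1 d2 (T1 : measurableType d1) (T2 : measurableType d2)
    (f : T -> T1 * T2) : measurable_fun setT f -> measurable_fun setT (fun x => (f x).2).
Proof. by move=> mf; exact: (measurableT_comp measurable_snd mf). Qed.

End measurability.

(** Proves measurability by recursion on the syntax of the function. *)
Ltac mfun := intros; cbv beta;
  lazymatch goal with
  | |- measurable_fun _ (fun x => EFin (@?f x)) =>
      apply/(@measurable_EFinP _ _ _ _ f); mfun
  | |- measurable_fun _ (fun x => @?f x && @?g x) => apply: (@mf_and _ _ f g); mfun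
  | |- measurable_fun _ (fun x => @Order.lt _ _ (@?f x) (@?g x)) =>
      apply: (@mf_lt _ _ _ f g); mfun
  | |- measurable_fun _ (fun x => @Order.le _ _ (@?f x) (@?g x)) =>
      apply: (@mf_le _ _ _ f g); mfun
  | |- measurable_fun _ (fun x => Num.sqrt (@?f x)) => apply: (@mf_sqrt _ _ _ f); mfun
  | |- measurable_fun _ (fun x => cos (@?f x)) => apply: (@mf_cos _ _ _ f); mfun
  | |- measurable_fun _ (fun x => sin (@?f x)) => apply: (@mf_sin _ _ _ f); mfun
  | |- measurable_fun _ (fun x => atan (@?f x)) => apply: (@mf_atan _ _ _ f); mfun
  | |- measurable_fun _ (fun x => GRing.inv (@?f x)) => apply: (@mf_inv _ _ _ f); mfun
  | |- measurable_fun _ (fun x => Algebra.opp (@?f x)) => apply: (@mf_opp _ _ _ f); mfun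
  | |- measurable_fun _ (fun x => GRing.mul (@?f x) (@?g x)) =>
      apply: (@mf_mul _ _ _ f g); mfun
  | |- measurable_fun _ (fun x => Algebra.add (@?f x) (@?g x)) =>
      apply: (@mf_add _ _ _ f g); mfun
  | |- measurable_fun _ (fun x => GRing.exp (@?f x) ?n) =>
      apply: (@mf_exp _ _ _ f n); mfun
  | |- measurable_fun _ (fun x => fst x) => exact: measurable_fst
  | |- measurable_fun _ (fun x => snd x) => exact: measurable_snd
  | |- measurable_fun _ (fun x => x) => exact: measurable_id
  | |- measurable_fun _ (fun x => fst (@?f x)) =>
      apply: (@mf_fst _ _ _ _ _ _ f); mfun
  | |- measurable_fun _ (fun x => snd (@?f x)) =>
      apply: (@mf_snd _ _ _ _ _ _ f); mfun
  | |- _ => first [exact: measurable_cst | assumption | apply: measurable_fun_ifT; mfun | idtac]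
  end.

(** * The integrals behind the density *)

Lemma integral_itvoo_if (R : realType) (a b : R) (f : R -> \bar R) :
  (\int[lebesgue_measure]_(x in `]a, b[) f x =
   \int[lebesgue_measure]_x (if ((a < x)%R && (x < b)%R) then f x else 0))%E.
Proof.
rewrite integral_mkcond; apply: eq_integral => x _; rewrite patchE.
by rewrite mem_setE in_itv.
Qed.

(** The integral of sqrt ((1 - z) / (z - a)) for z from a to w, in closed
    form. *)
Definition cap_primitive (R : realType) (a w : R) : R :=
  (1 - a) * atan (Num.sqrt ((w - a) / (1 - w))) + Num.sqrt ((w - a) * (1 - w)).

Lemma continuous_subr (R : realType) (u x : R) : continuous_at x (fun y : R => y - u).
Proof. by apply: cvgB => //; exact: cvg_cst. Qed.

Lemma continuous_rsub (R : realType) (u x : R) : continuous_at x (fun y : R => u - y).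
Proof. by apply: cvgB => //; exact: cvg_cst. Qed.

Lemma is_derive_subr (R : realType) (u x : R) : is_derive x 1 (fun y : R => y - u) 1.
Proof.
have := is_derive_affine (- u) (-1) x; rewrite opprK.
by under eq_fun do rewrite mulN1r opprK addrC.
Qed.

Lemma is_derive_rsub (R : realType) (u x : R) : is_derive x 1 (fun y : R => u - y) (-1).
Proof. by have := is_derive_affine u 1 x; under eq_fun do rewrite mul1r. Qed.

Lemma integral_cap_primitive (R : realType) (a c : R) : a < c -> c < 1 ->
  (\int[lebesgue_measure]_(w in `]a, c[)
     (Num.sqrt (1 - w) / Num.sqrt (w - a))%:E = (cap_primitive a c)%:E)%E.
Proof.
move=> ac c1.
have cF (w : R) : w < 1 -> continuous_at w (cap_primitive a).
  move=> w1; rewrite /cap_primitive; apply: continuous_fun_add.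
    apply: continuous_fun_mul; first exact: cvg_cst.
    apply: continuous_fun_comp; last exact: continuous_atan.
    apply: continuous_fun_sqrt; apply: continuous_fun_mul; first exact: continuous_subr.
    by apply: continuous_fun_inv; [rewrite subr_eq0 gt_eqF|exact: continuous_rsub].
  apply: continuous_fun_sqrt; apply: continuous_fun_mul.
    exact: continuous_subr.
  exact: continuous_rsub.
have Fa : cap_primitive a a = 0.
  by rewrite /cap_primitive subrr !mul0r sqrtr0 atan0 mulr0 addr0.
rewrite -[cap_primitive a c]subr0 -Fa.
apply: (@ge0_FTC2_itvoo R a c (fun w : R => Num.sqrt (1 - w) / Num.sqrt (w - a))
  (cap_primitive a)) => //.
- move=> w /[!in_itv]/= /andP[aw wc]; apply: continuous_fun_mul.
    by apply: continuous_fun_sqrt; exact: continuous_rsub.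
  apply: continuous_fun_inv; first by rewrite gt_eqF// sqrtr_gt0 subr_gt0.
  by apply: continuous_fun_sqrt; exact: continuous_subr.
- move=> w /[!in_itv]/= /andP[aw wc].
  have w1 : w < 1 := lt_trans wc c1.
  have w10 : 1 - w != 0 by rewrite subr_eq0 gt_eqF.
  have wa0 : w - a != 0 by rewrite subr_eq0 gt_eqF.
  have d1 := is_derive_subr a w.
  have d2 := is_derive_rsub 1 w.
  have d3 := @is_derive_fun_div R _ (fun y : R => 1 - y) w _ _ w10 d1 d2.
  have h0 : 0 < (w - a) / (1 - w) by rewrite divr_gt0// subr_gt0.
  have k0 : 0 < (w - a) * (1 - w) by rewrite mulr_gt0// subr_gt0.
  have d4 := is_derive_fun_mul (is_derive_cst (1 - a) w 1)
    (is_derive_fun_atan (@is_derive_fun_sqrt R (fun y : R => (y - a) / (1 - y)) w _ h0 d3)).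
  have d5 := @is_derive_fun_sqrt R (fun y : R => (y - a) * (1 - y)) w _ k0
     (is_derive_fun_mul d1 d2).
  have h : is_derive w 1 (cap_primitive a) _ := is_deriveD d4 d5.
  apply: (is_derive_eq (df := _) h).
  rewrite sqr_sqrtr ?(ltW h0)// /cst.
  rewrite sqrtrM ?subr_ge0 1?ltW// sqrtrM ?subr_ge0 1?ltW// sqrtrV ?subr_ge0 1?ltW//.
  set p := Num.sqrt (w - a); set r := Num.sqrt (1 - w).
  have p2 : w - a = p ^+ 2 by rewrite sqr_sqrtr// subr_ge0 ltW.
  have r2 : 1 - w = r ^+ 2 by rewrite sqr_sqrtr// subr_ge0 ltW.
  have p0 : p != 0 by rewrite gt_eqF// sqrtr_gt0 subr_gt0.
  have r0 : r != 0 by rewrite gt_eqF// sqrtr_gt0 subr_gt0.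
  have -> : 1 - a = p ^+ 2 + r ^+ 2 by rewrite -p2 -r2; ring.
  rewrite p2 r2; field; rewrite ?p0 ?r0//=.
  by rewrite gt_eqF// ltr_wpDl ?sqr_ge0// exprn_even_gt0.
- by apply: cvg_at_right_filter; apply: cF; exact: lt_trans c1.
- by apply: cvg_at_left_filter; exact: cF.
Qed.

Lemma is_derive_oppcos (R : realType) (x : R) : is_derive x 1 (fun y : R => - cos y) (sin x).
Proof.
have h : is_derive x 1 (- @cos R) _ := is_deriveN (is_derive_cos x).
by apply: (is_derive_eq (df := _) h); rewrite opprK.
Qed.

(** [integral_chord] with the height - cos phi as variable, which makes the
    change of variables increasing. *)
Lemma integral_chord_polar (R : realType) (z w : R) : -1 <= z -> z < w -> w < 1 ->
  (\int[lebesgue_measure]_(phi in `]acos w, acos z[)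
     (((1 - cos phi) * Num.sqrt ((cos phi - z) * (w - cos phi)))^-1 * sin phi)%:E =
   (pi / Num.sqrt ((1 - w) * (1 - z)))%:E)%E.
Proof.
move=> z1 zw w1.
have zI : -1 <= z <= 1 by rewrite z1 ltW// (lt_trans zw).
have wI : -1 <= w <= 1 by rewrite (le_trans z1 (ltW zw)) ltW.
have wz : acos w < acos z.
  by rewrite -ltr_cos ?in_itv/= ?acos_ge0 ?acos_lepi// !acosK ?in_itv/=.
have hw : 0 < 1 - -1 * - w by lra.
have hz : 0 < 1 - -1 * - z by lra.
have wz' : - z > - w by rewrite ltrN2.
rewrite (_ : (1 - w) * (1 - z) = (1 - -1 * - w) * (1 - -1 * - z)); last by ring.
rewrite -(integral_chord wz' hw hz).
have cw : cos (acos w) = w by rewrite acosK ?in_itv.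
have cz : cos (acos z) = z by rewrite acosK ?in_itv.
pose G (y : R) := ((1 - -1 * y) * Num.sqrt ((y - - w) * (- z - y)))^-1.
have cosI : {in `[acos w, acos z] &, {homo (fun y : R => - cos y) : x y / x < y}}.
  have I0pi t : t \in `[acos w, acos z] -> t \in `[0, pi].
    rewrite !in_itv/= => /andP[wt tz].
    by rewrite (le_trans (acos_ge0 wI) wt) (le_trans tz (acos_lepi zI)).
  by move=> x y /I0pi xI /I0pi yI xy; rewrite ltrN2 ltr_cos.
have S := @ge0_integration_by_substitution_itvoo R (acos w) (acos z)
  (fun y => - cos y) (@sin R) G wz cosI (@is_derive_oppcos R) (@continuous_sin R).
rewrite cw cz in S; rewrite {}S.
- apply: eq_integral => y _; rewrite /G mulN1r !opprK.
  by congr (((_ * Num.sqrt _)^-1 * _)%:E); ring.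
- move=> y; rewrite in_itv/= => /andP[wy yz].
  apply: continuous_fun_inv.
    rewrite gt_eqF// mulr_gt0//; first by lra.
    by rewrite sqrtr_gt0 mulr_gt0//; lra.
  apply: continuous_fun_mul; first exact: continuous_affine.
  apply: continuous_fun_sqrt; apply: continuous_fun_mul; first exact: continuous_subr.
  exact: continuous_rsub.
- move=> y; rewrite in_itv/= => /andP[wy yz].
  by rewrite invr_ge0 mulr_ge0 ?sqrtr_ge0//; lra.
Qed.

Lemma ge0_integralZ_EFin d (T : measurableType d) (R : realType)
    (mu : {measure set T -> \bar R}) (D : set T) (f : T -> R) (k : R) :
  measurable D -> measurable_fun D f -> (forall x, D x -> 0 <= f x) -> 0 <= k ->
  (\int[mu]_(x in D) (k * f x)%:E = k%:E * \int[mu]_(x in D) (f x)%:E)%E.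
Proof.
move=> mD mf f0 k0; under eq_integral do rewrite EFinM.
rewrite ge0_integralZl_EFin//.
by apply/measurable_EFinP.
Qed.

Lemma tonelli_lebesgue (R : realType) (K : R * R -> \bar R) :
  measurable_fun setT K -> (forall p, 0 <= K p)%E ->
  (\int[lebesgue_measure]_x \int[lebesgue_measure]_y K (x, y) =
   \int[lebesgue_measure]_y \int[lebesgue_measure]_x K (x, y))%E.
Proof.
by move=> mK K0; exact: (@fubini_tonelli _ _ _ _ R lebesgue_measure lebesgue_measure K mK K0).
Qed.

(** With [acos_lt], trades conditions on the height for conditions on the polar
    angle when two integrals are exchanged. *)
Lemma lt_acos (R : realType) (phi z : R) : 0 <= phi <= pi -> -1 <= z <= 1 ->
  (phi < acos z) = (z < cos phi).
Proof.
move=> p z1; rewrite -[in RHS](@acosK R z) ?in_itv//= ltr_cos//.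
by rewrite in_itv/= acos_ge0 ?acos_lepi.
Qed.

Lemma acos_lt (R : realType) (phi z : R) : 0 <= phi <= pi -> -1 <= z <= 1 ->
  (acos z < phi) = (cos phi < z).
Proof.
move=> p z1; rewrite -[in RHS](@acosK R z) ?in_itv//= ltr_cos//.
by rewrite in_itv/= acos_ge0 ?acos_lepi.
Qed.

(** The first Abel integral.  [cap_primitive] is itself an integral over the
    heights w between cos phi and cos alpha; after exchanging the integrals, the
    inner one in phi is [integral_chord_polar], and the factor sqrt (1 - w) that
    it produces cancels the one in the integrand, so that what is left is a
    constant integrated over ]z, cos alpha[. *)
Lemma integral_cap_abel (R : realType) (alpha z : R) :
  0 < alpha -> alpha < pi -> -1 <= z -> z < cos alpha ->
  (\int[lebesgue_measure]_(phi in `]alpha, acos z[)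
     (cap_primitive (cos phi) (cos alpha) *
       (sin phi / ((1 - cos phi) * Num.sqrt (cos phi - z))))%:E =
   (pi / Num.sqrt (1 - z) * (cos alpha - z))%:E)%E.
Proof.
move=> a0 api z1; set c := cos alpha => zc.
have c1 : c < 1.
  by rewrite -(@cos0 R) /c ltr_cos ?in_itv/= ?lexx ?pi_ge0 ?(ltW a0) ?ltW.
have zI : -1 <= z <= 1 by rewrite z1 ltW// (lt_trans zc).
pose K (p : R * R) : \bar R :=
  (if ((alpha < p.1) && (p.1 < acos z)) && ((cos p.1 < p.2) && (p.2 < c))
  then Num.sqrt (1 - p.2) / Num.sqrt (p.2 - cos p.1) *
       (sin p.1 / ((1 - cos p.1) * Num.sqrt (cos p.1 - z))) else 0)%:E.
have mK : measurable_fun setT K by rewrite /K; mfun.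
have pI phi : alpha < phi -> phi < acos z ->
    [/\ 0 < sin phi, cos phi < c, z < cos phi & 0 <= phi <= pi].
  move=> ap pz; have ppi := lt_le_trans pz (acos_lepi zI).
  have p0 := lt_trans a0 ap.
  have pI : 0 <= phi <= pi by rewrite !ltW.
  split => //.
  - by rewrite sin_gt0_pi// p0 ppi.
  - by rewrite ltr_cos// in_itv/= !ltW.
  - by rewrite -lt_acos.
have K0 p : (0 <= K p)%E.
  rewrite /K lee_fin; case: ifPn => // /andP[/andP[h1 h2] /andP[h3 h4]].
  have [s0 _ _ _] := pI _ h1 h2.
  apply: mulr_ge0; first by rewrite divr_ge0 ?sqrtr_ge0.
  apply: divr_ge0; first exact: ltW.
  by rewrite mulr_ge0 ?sqrtr_ge0// subr_ge0 cos_le1.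
transitivity (\int[lebesgue_measure]_phi \int[lebesgue_measure]_w K (phi, w))%E.
  rewrite integral_itvoo_if; apply: eq_integral => phi _.
  case: ifPn => [/andP[h1 h2]|nh]; last first.
    by rewrite integral0_eq// => w _; rewrite /K/= (negbTE nh).
  have [s0 pc zp pp] := pI _ h1 h2.
  transitivity (\int[lebesgue_measure]_(w in `]cos phi, c[)
     ((sin phi / ((1 - cos phi) * Num.sqrt (cos phi - z))) *
      (Num.sqrt (1 - w) / Num.sqrt (w - cos phi)))%:E)%E.
    rewrite ge0_integralZ_EFin//.
    - by rewrite integral_cap_primitive// -EFinM mulrC.
    - by apply: measurable_funTS; mfun.
    - by rewrite divr_ge0 ?(ltW s0)// mulr_ge0 ?sqrtr_ge0// subr_ge0 cos_le1.
  rewrite integral_itvoo_if; apply: eq_integral => w _.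
  by rewrite /K/= h1 h2/=; case: ifPn => // _; rewrite mulrC.
rewrite tonelli_lebesgue//.
transitivity (\int[lebesgue_measure]_(w in `]z, c[) (pi / Num.sqrt (1 - z))%:E)%E; last first.
  by rewrite integral_cst//= lebesgue_measure_itv/= lte_fin zc -EFinB -EFinM.
rewrite integral_itvoo_if; apply: eq_integral => w _.
case: ifPn => [/andP[zw wc]|nh]; last first.
  rewrite integral0_eq// => phi _; rewrite /K/=; case: ifPn => // /andP[/andP[h1 h2] /andP[h3 h4]].
  have [s0 pc zp pp] := pI _ h1 h2.
  by case/negP: nh; rewrite h4 (lt_trans zp h3).
have w1 : w < 1 by exact: lt_trans c1.
have wI : -1 <= w <= 1 by rewrite (le_trans z1 (ltW zw)) ltW.
transitivity (\int[lebesgue_measure]_(phi in `]acos w, acos z[)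
   (Num.sqrt (1 - w) *
    (((1 - cos phi) * Num.sqrt ((cos phi - z) * (w - cos phi)))^-1 * sin phi))%:E)%E.
  rewrite integral_itvoo_if; apply: eq_integral => phi _; rewrite /K/=.
  have [/andP[h1 h2]|nh] := boolP ((acos w < phi) && (phi < acos z)).
    have ap : alpha < phi.
      by apply: lt_trans h1; rewrite lt_acos// !ltW.
    have pp0 : 0 <= phi <= pi by case: (pI _ ap h2).
    have [s0 pc zp pp] := pI _ ap h2.
    have pw : cos phi < w by rewrite -acos_lt.
    rewrite ap h2 pw wc/=; congr EFin.
    by rewrite sqrtrM ?subr_ge0 ?(ltW zp)// !invfM; ring.
  case: ifPn => // /andP[/andP[h1 h2] /andP[h3 h4]].
  have [s0 pc zp pp] := pI _ h1 h2.
  by case/negP: nh; rewrite h2 acos_lt// h3.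
rewrite ge0_integralZ_EFin//.
- rewrite integral_chord_polar// -EFinM; congr EFin.
  rewrite sqrtrM ?subr_ge0 1?ltW//.
  have r0 : Num.sqrt (1 - w) != 0 by rewrite gt_eqF// sqrtr_gt0 subr_gt0.
  have r1 : Num.sqrt (1 - z) != 0 by rewrite gt_eqF// sqrtr_gt0 subr_gt0 (lt_trans zw).
  by field; rewrite r0 r1.
- by apply: measurable_funTS; mfun.
- move=> phi; rewrite /= in_itv/= => /andP[h1 h2].
  rewrite mulr_ge0// ?invr_ge0 ?mulr_ge0 ?sqrtr_ge0 ?subr_ge0 ?cos_le1//.
  rewrite sin_ge0_pi// (le_trans _ (ltW h1)) ?acos_ge0//=.
  by rewrite (le_trans (ltW h2)) ?acos_lepi.
Qed.

(** * Symmetric and periodic integrands *)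

Section periodic.
Context (R : realType).
Local Notation mu := (@lebesgue_measure R).
Implicit Types (g : R -> R).

Lemma measurable_EFin_continuous g (D : set R) : continuous g -> measurable_fun D (EFin \o g).
Proof.
by move=> cg; apply/measurable_EFinP; apply: measurable_funTS; exact: continuous_measurable_fun.
Qed.

Lemma integral_itvoo_split g (a b c : R) : continuous g -> (forall x, 0 <= g x) ->
  a <= b -> b <= c ->
  (\int[mu]_(x in `]a, c[) (g x)%:E =
   \int[mu]_(x in `]a, b[) (g x)%:E + \int[mu]_(x in `]b, c[) (g x)%:E)%E.
Proof.
move=> cg g0 ab bc.
have mg D : measurable_fun D (EFin \o g) by exact: measurable_EFin_continuous.
rewrite -(@integral_itv_bndoo R a c (EFin \o g) true true)//.
rewrite -(@integral_itv_bndoo R a b (EFin \o g) true true)//.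
rewrite -(@integral_itv_bndoo R b c (EFin \o g) true true)//.
rewrite -ge0_integral_setU//=.
- by rewrite -itv_bndbnd_setU ?bnd_simp.
- exact: mg.
- by move=> x _; rewrite lee_fin.
- apply/disj_setPS => x /= [].
  by rewrite !in_itv/= => /andP[_ h] /andP[h' _]; move: (lt_le_trans h h'); rewrite ltxx.
Qed.

Lemma is_derive_addr (s x : R) : is_derive x 1 (fun y : R => y + s) 1.
Proof. by have := is_derive_subr (- s) x; rewrite opprK. Qed.

Lemma integral_itvoo_shift g (a b s : R) : continuous g -> (forall x, 0 <= g x) ->
  a < b ->
  (\int[mu]_(x in `](a + s)%R, (b + s)%R[) (g x)%:E = \int[mu]_(x in `]a, b[) (g (x + s))%:E)%E.
Proof.
move=> cg g0 ab.
have incr : {in `[a, b] &, {homo (fun x : R => x + s) : x y / x < y}}.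
  by move=> x y _ _; rewrite ltrD2r.
rewrite (@ge0_integration_by_substitution_itvoo R a b _ (cst 1) g ab incr
  (is_derive_addr s) (fun x => cvg_cst _))//.
by under eq_integral do rewrite mulr1.
Qed.

Lemma integral_itvoo_opp g (a b : R) : continuous g -> a < b ->
  (\int[mu]_(x in `](- b)%R, (- a)%R[) (g x)%:E = \int[mu]_(x in `]a, b[) (g (- x))%:E)%E.
Proof.
move=> cg ab.
rewrite -(@integral_itv_bndoo R _ _ (EFin \o g) true false)//; last exact: measurable_EFin_continuous.
rewrite integration_by_substitution_oppr ?(ltW ab)//.
- rewrite integral_itv_bndoo//.
  apply: (@measurable_EFin_continuous (g \o -%R)) => x; apply: continuous_comp; last exact: cg.
  exact: continuousN.
- exact: continuous_subspaceT.
Qed.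

Lemma integral_itvoo_reflect g (a b s : R) : continuous g -> (forall x, 0 <= g x) ->
  a < b -> (forall x, g (s - x) = g x) ->
  (\int[mu]_(x in `](s - b)%R, (s - a)%R[) (g x)%:E = \int[mu]_(x in `]a, b[) (g x)%:E)%E.
Proof.
move=> cg g0 ab gs.
rewrite [s - b]addrC [s - a]addrC integral_itvoo_shift// ?ltrN2//.
rewrite (@integral_itvoo_opp (fun x => g (x + s)))//.
- by apply: eq_integral => x _; rewrite addrC gs.
- move=> x; apply: (@continuous_comp _ _ _ (fun x => x + s) g); last exact: cg.
  exact: is_derive_continuous (is_derive_addr s x).
Qed.

Lemma integral_period g (c : R) : continuous g -> (forall x, 0 <= g x) ->
  (forall x, g (x + 2 * pi) = g x) -> 0 <= c <= 2 * pi ->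
  (\int[mu]_(x in `]0%R, (2 * pi)%R[) (g (x - c))%:E = \int[mu]_(x in `]0%R, (2 * pi)%R[) (g x)%:E)%E.
Proof.
move=> cg g0 gp /andP[c0 c2].
have p0 : 0 < 2 * pi :> R by rewrite mulr_gt0// pi_gt0.
rewrite -integral_itvoo_shift// add0r.
rewrite (@integral_itvoo_split g (- c) 0 (2 * pi - c)) ?oppr_le0 ?subr_ge0//.
rewrite (@integral_itvoo_split g 0 (2 * pi - c) (2 * pi)) ?subr_ge0//; last by rewrite gerBl.
rewrite addeC; congr (_ + _)%E.
move: c0; rewrite le_eqVlt => /predU1P[<-|c0].
  by rewrite oppr0 addr0 !set_itvoo0 !integral_set0.
have := @integral_itvoo_shift g (- c) 0 (2 * pi) cg g0.
rewrite oppr_lt0 => /(_ c0); rewrite add0r [- c + _]addrC => ->.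
by apply: eq_integral => x _; rewrite gp.
Qed.

Lemma integral_itvoo_even g (c : R) : continuous g -> (forall x, 0 <= g x) ->
  0 < c -> (forall x, g (2 * c - x) = g x) ->
  (\int[mu]_(x in `]0%R, (2 * c)%R[) (g x)%:E = 2%:E * \int[mu]_(x in `]0%R, c[) (g x)%:E)%E.
Proof.
move=> cg g0 c0 gs.
rewrite (@integral_itvoo_split g 0 c (2 * c)) ?(ltW c0)//; last by lra.
rewrite -(@integral_itvoo_reflect g 0 c (2 * c))// subr0.
rewrite (_ : 2 * c - c = c); last by ring.
by rewrite mule_natl mule2n.
Qed.

End periodic.

(** * The transformations of Landen and Copson *)

Lemma is_derive_fun_add (R : realType) (f g : R -> R) (x a b : R) :
  is_derive x 1 f a -> is_derive x 1 g b ->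
  is_derive x 1 (fun y => f y + g y) (a + b).
Proof. by move=> fa gb; exact: (is_deriveD fa gb). Qed.

Lemma is_derive_fun_sub (R : realType) (f g : R -> R) (x a b : R) :
  is_derive x 1 f a -> is_derive x 1 g b ->
  is_derive x 1 (fun y => f y - g y) (a - b).
Proof. by move=> fa gb; exact: (is_deriveB fa gb). Qed.

Lemma asin0 (R : realType) : asin 0 = 0 :> R.
Proof.
have pi0 := @pi_gt0 R.
rewrite -[X in asin X](@sin0 R) sinK// in_itv/=; lra.
Qed.

Section landen.
Context (R : realType) (p r : R) (r0 : 0 <= r) (rp : r < p).

Let k := r / p.
Let p0 : 0 < p := le_lt_trans r0 rp.
Let k0 : 0 <= k. Proof. by rewrite /k divr_ge0// ltW. Qed.
Let k1 : k < 1. Proof. by rewrite /k ltr_pdivrMr// mul1r. Qed.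
Let k21 : k ^+ 2 < 1.
Proof. by rewrite expr2; have := k0; have := k1; nra. Qed.

Let ksq x : (k * sin x) ^+ 2 < 1.
Proof.
rewrite exprMn; apply: le_lt_trans k21; rewrite ler_piMr ?sqr_ge0//.
Qed.

Let m x := Num.sqrt (1 - (k * sin x) ^+ 2).

Let m0 x : 0 < m x. Proof. by rewrite sqrtr_gt0 subr_gt0. Qed.

Let m2 x : m x ^+ 2 = 1 - (k * sin x) ^+ 2.
Proof. by rewrite sqr_sqrtr// subr_ge0 ltW. Qed.

Let kcos x : k * cos x < m x.
Proof.
have [h|h] := ltP (k * cos x) 0; first exact: lt_trans h (m0 x).
rewrite -(@ltr_pXn2r _ 2)//; last by rewrite nnegrE ltW.
rewrite m2 exprMn [X in _ < _ - X]exprMn sin2cos2.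
have := k21; nra.
Qed.

Let ksin x : -1 < k * sin x < 1.
Proof.
rewrite -ltr_norml -(@ltr_pXn2r _ 2) ?nnegrE//.
by rewrite real_normK ?num_real// expr1n.
Qed.

(** In a triangle with sides p and r, let pi - w be the angle opposite to p.  By
    the law of sines the angle opposite to r is asin (k sin w), k = r / p, and
    [landen_angle w] is the angle between the two sides. *)
Definition landen_angle (w : R) := w - asin (k * sin w).

Let dlanden (w : R) : is_derive w 1 landen_angle (1 - k * cos w / m w).
Proof.
have d1 : is_derive w 1 (fun w => k * sin w) (k * cos w).
  have h := is_derive_fun_mul (is_derive_cst k w 1) (is_derive_sin w).
  by apply: (is_derive_eq (df := _) h); rewrite /cst mul0r add0r.
have d2 := @is_derive_fun_comp R (@asin R) (fun w => k * sin w) w _ _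
  (is_derive1_asin (ksin w)) d1.
have h := is_derive_fun_sub (is_derive_id w 1) d2.
by apply: (is_derive_eq (df := _) h); rewrite mulrC.
Qed.

(** The law of cosines for the third side of that triangle, of length
    p (m w - k cos w). *)
Lemma landen_key w : 0 < p * (m w - k * cos w) /\
  p ^+ 2 + r ^+ 2 - 2 * p * r * cos (landen_angle w) = (p * (m w - k * cos w)) ^+ 2.
Proof.
split; first by rewrite mulr_gt0// subr_gt0 kcos.
have sI := ksin w.
have [sI1 sI2] := andP sI.
rewrite /landen_angle cosB asinK ?in_itv/= ?(ltW sI1) ?(ltW sI2)//.
rewrite cos_asin ?(ltW sI1) ?(ltW sI2)// -/(m w).
have rE : r = k * p by rewrite /k mulfVK// gt_eqF.
have := m2 w; have := cos2Dsin2 w.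
rewrite rE; move: (m w) (cos w) (sin w) (k) => M C S K h1 h2.
have C2 : C ^+ 2 = 1 - S ^+ 2 by rewrite -h1; ring.
have -> : (p * (M - K * C)) ^+ 2 = p ^+ 2 * (M ^+ 2 - 2 * M * K * C + K ^+ 2 * C ^+ 2) by ring.
by rewrite h2 C2; ring.
Qed.

(** By [landen_key] the integrand on the left, taken at [landen_angle w], is the
    inverse of p (m w - k cos w), while the derivative of [landen_angle] is
    (m w - k cos w) / m w: the product is (p m w)^-1. *)
Lemma landen_transform :
  (\int[lebesgue_measure]_(t in `]0%R, pi[)
     (Num.sqrt (p ^+ 2 + r ^+ 2 - 2 * p * r * cos t))^-1%:E =
   \int[lebesgue_measure]_(w in `]0%R, pi[)
     (Num.sqrt (p ^+ 2 - r ^+ 2 * sin w ^+ 2))^-1%:E)%E.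
Proof.
have pi0 := @pi_gt0 R.
have F0 : landen_angle 0 = 0 by rewrite /landen_angle sin0 mulr0 asin0 subrr.
have Fpi : landen_angle pi = pi by rewrite /landen_angle sinpi mulr0 asin0 subr0.
have cm : continuous m.
  move=> w; apply: continuous_fun_sqrt; apply: continuous_fun_sub; first exact: cvg_cst.
  apply: (@continuous_fun_comp R (fun x => x ^+ 2) (fun w => k * sin w)); last exact: exprn_continuous.
  by apply: continuous_fun_mul; [exact: cvg_cst|exact: continuous_sin].
have cF' : continuous (fun w => 1 - k * cos w / m w).
  move=> w; apply: continuous_fun_sub; first exact: cvg_cst.
  apply: continuous_fun_mul.
    by apply: continuous_fun_mul; [exact: cvg_cst|exact: continuous_cos].
  by apply: continuous_fun_inv; [rewrite gt_eqF|exact: cm].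
have cF : continuous landen_angle by move=> w; exact: is_derive_continuous (dlanden w).
have incr : {in `[0, pi] &, {homo landen_angle : x y / x < y}}.
  apply: gtr0_derive1_lt_cc => [x _|x _|].
  - by case: (dlanden x).
  - rewrite derive1E (@derive_val _ _ _ _ _ _ _ (dlanden x)).
    by rewrite subr_gt0 ltr_pdivrMr// mul1r.
  - exact: continuous_subspaceT.
pose G (t : R) := (Num.sqrt (p ^+ 2 + r ^+ 2 - 2 * p * r * cos t))^-1.
have S := @ge0_integration_by_substitution_itvoo R 0 pi landen_angle _ G pi0 incr dlanden cF'.
rewrite F0 Fpi in S; rewrite [LHS]S.
- apply: eq_integral => w _; congr EFin; rewrite /G.
  have [h1 h2] := landen_key w.
  rewrite h2 sqrtr_sqr gtr0_norm//.
  have -> : p ^+ 2 - r ^+ 2 * sin w ^+ 2 = (p * m w) ^+ 2.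
    by rewrite exprMn m2 exprMn /k; field; rewrite gt_eqF.
  rewrite sqrtr_sqr gtr0_norm; last by rewrite mulr_gt0.
  have m_n0 : m w != 0 by rewrite gt_eqF.
  have p_n0 : p != 0 by rewrite gt_eqF.
  have mk : m w - k * cos w != 0 by rewrite subr_eq0 gt_eqF.
  by field; rewrite mk m_n0 p_n0.
- move=> t _; apply: continuous_fun_inv.
    rewrite gt_eqF// sqrtr_gt0.
    rewrite (lt_le_trans (_ : 0 < (p - r) ^+ 2))// ?exprn_even_gt0 ?subr_eq0 ?gt_eqF//.
    rewrite -subr_ge0 (_ : _ - _ = 2 * p * r * (1 - cos t)); last by ring.
    by rewrite !mulr_ge0 ?(ltW p0)// subr_ge0 cos_le1.
  apply: continuous_fun_sqrt; apply: continuous_fun_sub; first exact: cvg_cst.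
  by apply: continuous_fun_mul; [exact: cvg_cst|exact: continuous_cos].
- by move=> t _; rewrite invr_ge0 sqrtr_ge0.
Qed.

End landen.

(** The substitution is z = F w: a homography in sin^2 w which sends w = 0 to
    -1 and w = pi / 2 to a, and which turns the quartic under the root into
    A - B sin^2 w, up to the square of F' w / 2. *)
Section copson.
Context (R : realType) (a b : R) (a1 : -1 < a) (ab : a < b) (b1 : b < 1).

Let A := (1 - a) * (1 + b).
Let B := (1 + a) * (1 - b).
Let D (w : R) := (1 + a) * sin w ^+ 2 + (1 - a).
Let F (w : R) := ((1 + a) * sin w ^+ 2 - (1 - a)) / D w.
Let F' (w : R) := 4 * (1 + a) * (1 - a) * sin w * cos w / D w ^+ 2.

Let D0 w : 0 < D w.
Proof.
by rewrite /D ltr_wpDl// ?subr_gt0 1?(lt_trans ab)// mulr_ge0 ?sqr_ge0//; have := a1; lra.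
Qed.

Let AB s : 0 <= s <= 1 -> 0 < A - B * s.
Proof.
move=> /andP[s0 s1]; rewrite (_ : _ - _ = 2 * (b - a) + B * (1 - s)); last first.
  by rewrite /A /B; ring.
rewrite ltr_wpDr ?mulr_gt0 ?subr_gt0// mulr_ge0 ?subr_ge0// /B.
have := a1; have := b1; nra.
Qed.

Let sin2I (w : R) : 0 <= sin w ^+ 2 <= 1.
Proof. by rewrite sqr_ge0 sin2cos2 gerBl sqr_ge0. Qed.

Let g (w : R) := (Num.sqrt (A - B * sin w ^+ 2))^-1.

Let csin2 (x y : R) : continuous (fun w => x * sin w ^+ 2 + y).
Proof.
move=> w; apply: continuous_fun_add; last exact: cvg_cst.
apply: continuous_fun_mul; first exact: cvg_cst.
apply: (@continuous_fun_comp R (fun x => x ^+ 2) sin); last exact: exprn_continuous.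
exact: continuous_sin.
Qed.

Let cg : continuous g.
Proof.
move=> w; apply: continuous_fun_inv; first by rewrite gt_eqF// sqrtr_gt0 AB.
apply: continuous_fun_sqrt.
rewrite (_ : (fun w => _) = (fun w => - B * sin w ^+ 2 + A)); first exact: csin2.
by apply/funext => x; ring.
Qed.

Let dF (w : R) : is_derive w 1 F (F' w).
Proof.
have ds (x y : R) : is_derive w 1 (fun w => x * sin w ^+ 2 + y) (2 * x * sin w * cos w).
  have d1 := is_derive_fun_mul (is_derive_sin w) (is_derive_sin w).
  have d2 := is_derive_fun_add (is_derive_fun_mul (is_derive_cst x w 1) d1) (is_derive_cst y w 1).
  apply: (is_derive_eq (df := _) d2); rewrite /cst; ring.
have Dw : D w != 0 by rewrite gt_eqF.
have h := @is_derive_fun_div R _ D w _ _ Dw (ds (1 + a) (- (1 - a))) (ds (1 + a) (1 - a)).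
apply: (is_derive_eq (df := _) h); rewrite /F' /D.
by field; exact: Dw.
Qed.

Let cF' : continuous F'.
Proof.
move=> w; apply: continuous_fun_mul.
  apply: continuous_fun_mul; last exact: continuous_cos.
  by apply: continuous_fun_mul; [exact: cvg_cst|exact: continuous_sin].
apply: continuous_fun_inv; first by rewrite expf_neq0// gt_eqF.
apply: (@continuous_fun_comp R (fun x => x ^+ 2) D); first exact: csin2.
exact: exprn_continuous.
Qed.

Let F'0 w : 0 < w < pi / 2 -> 0 < F' w.
Proof.
move=> /andP[w0 w1].
have s0 : 0 < sin w by rewrite sin_gt0_pihalf// w0.
have c0 : 0 < cos w by rewrite cos_gt0_pihalf// w1 andbT (lt_trans _ w0)// oppr_lt0; lra.
have h1 : 0 < 1 + a by have := a1; lra.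
have h2 : 0 < 1 - a by have := ab; have := b1; lra.
by rewrite /F' divr_gt0 ?exprn_gt0// !mulr_gt0.
Qed.

Lemma copson_key w : (1 - F w ^+ 2) * ((a - F w) * (b - F w)) =
  (F' w / 2) ^+ 2 * (A - B * sin w ^+ 2).
Proof.
have Dw : D w != 0 by rewrite gt_eqF.
have -> : (F' w / 2) ^+ 2 =
    (2 * (1 + a) * (1 - a) * sin w / D w ^+ 2) ^+ 2 * cos w ^+ 2.
  by rewrite /F'; field.
rewrite cos2sin2 /F /A /B; move: Dw; rewrite /D.
by move: (sin w) => S D1; field.
Qed.

Lemma copson_transform :
  (\int[lebesgue_measure]_(z in `](-1)%R, a[)
     (Num.sqrt ((1 - z ^+ 2) * ((a - z) * (b - z))))^-1%:E =
   \int[lebesgue_measure]_(w in `]0%R, pi[) (Num.sqrt (A - B * sin w ^+ 2))^-1%:E)%E.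
Proof.
have pi0 := @pi_gt0 R.
have g0 x : 0 <= g x by rewrite invr_ge0 sqrtr_ge0.
have pi2 : 0 < pi / 2 :> R by lra.
have F0 : F 0 = -1.
  by rewrite /F /D sin0; field; rewrite subr_eq0 gt_eqF// (lt_trans ab).
have Fpi : F (pi / 2) = a.
  rewrite /F /D sin_pihalf expr1n mulr1 (_ : 1 + a + (1 - a) = 2); last by ring.
  by field.
have cF : continuous F by move=> w; exact: is_derive_continuous (dF w).
have incr : {in `[0, pi / 2] &, {homo F : x y / x < y}}.
  apply: gtr0_derive1_lt_cc => [x _|x|].
  - by case: (dF x).
  - rewrite in_itv/= => xI; rewrite derive1E (@derive_val _ _ _ _ _ _ _ (dF x)).
    exact: F'0.
  - exact: continuous_subspaceT.
pose G (z : R) := (Num.sqrt ((1 - z ^+ 2) * ((a - z) * (b - z))))^-1.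
have S := @ge0_integration_by_substitution_itvoo R 0 (pi / 2) F F' G pi2 incr dF cF'.
rewrite F0 Fpi in S; rewrite [LHS]S; last 2 first.
- move=> z; rewrite in_itv/= => /andP[z1 za].
  have h : 0 < (1 - z ^+ 2) * ((a - z) * (b - z)).
    rewrite !mulr_gt0 ?subr_gt0//; last exact: lt_trans ab.
    by have := lt_trans za (lt_trans ab b1); nra.
  apply: continuous_fun_inv; first by rewrite gt_eqF// sqrtr_gt0.
  apply: continuous_fun_sqrt; apply: continuous_fun_mul.
    by apply: continuous_fun_sub; [exact: cvg_cst|exact: exprn_continuous].
  by apply: continuous_fun_mul; exact: continuous_rsub.
- by move=> z _; rewrite invr_ge0 sqrtr_ge0.
have pi2E : 2 * (pi / 2) = pi :> R by field.
have gs x : g (2 * (pi / 2) - x) = g x.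
  by rewrite pi2E /g [pi - x]addrC sinDpi sinN opprK.
have E := integral_itvoo_even cg g0 pi2 gs.
rewrite pi2E in E; rewrite [RHS]E.
rewrite -ge0_integralZl_EFin//.
- apply: eq_integral => w; rewrite inE/= in_itv/= => wI.
  have AB0 := AB (sin2I w).
  rewrite -EFinM; congr EFin; rewrite /G copson_key sqrtrM ?sqr_ge0// sqrtr_sqr.
  have F'w := F'0 wI.
  rewrite gtr0_norm; last by apply: divr_gt0.
  have q0 : Num.sqrt (A - B * sin w ^+ 2) != 0 by rewrite gt_eqF// sqrtr_gt0.
  have F'n : F' w != 0 by rewrite gt_eqF.
  by move: F'n; rewrite /g; move: (F' w) => x x0; field; rewrite q0 x0.
- by move=> w _; rewrite lee_fin.
- by apply/measurable_EFinP; apply: measurable_funTS; exact: continuous_measurable_fun.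
Qed.

End copson.

(** * Circles of latitude *)

(** Landen's transformation applies with p^2 = (1 - a) (1 + b) and
    r^2 = (1 + a) (1 - b), since then p r = sqrt (1 - a^2) sqrt (1 - b^2) and
    p^2 + r^2 = 2 - 2 a b. *)
Lemma ring_kernel (R : realType) (a b : R) : -1 < a -> a < b -> b < 1 ->
  (\int[lebesgue_measure]_(t in `]0%R, pi[)
     (Num.sqrt (2 - 2 * a * b - 2 * Num.sqrt (1 - a ^+ 2) * Num.sqrt (1 - b ^+ 2) * cos t))^-1%:E =
   \int[lebesgue_measure]_(z in `](-1)%R, a[)
     (Num.sqrt ((1 - z ^+ 2) * ((a - z) * (b - z))))^-1%:E)%E.
Proof.
move=> a1 ab b1.
have h1a : 0 < 1 - a by lra.
have h2a : 0 < 1 + a by lra.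
have h1b : 0 < 1 - b by lra.
have h2b : 0 < 1 + b by lra.
rewrite (copson_transform a1 ab b1).
pose p := Num.sqrt ((1 - a) * (1 + b)); pose r := Num.sqrt ((1 + a) * (1 - b)).
have p2 : p ^+ 2 = (1 - a) * (1 + b) by rewrite sqr_sqrtr// mulr_ge0 ?ltW.
have r2 : r ^+ 2 = (1 + a) * (1 - b) by rewrite sqr_sqrtr// mulr_ge0 ?ltW.
have rp : r < p by rewrite ltr_sqrt ?mulr_gt0//; nra.
rewrite -p2 -r2 -(landen_transform (sqrtr_ge0 _) rp).
apply: eq_integral => t _; congr ((Num.sqrt (_ - _ * _))^-1%:E).
  by rewrite p2 r2; ring.
rewrite -!mulrA; congr (_ * _); rewrite /p /r.
rewrite -!sqrtrM ?subr_ge0 ?mulr_ge0 1?ltW//; last by nra.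
by congr Num.sqrt; ring.
Qed.

Lemma dist3_spherical (R : realType) (eta psi theta phi : R) :
  dist3 (spherical eta psi) (spherical theta phi) =
  Num.sqrt (2 - 2 * cos phi * cos psi - 2 * sin phi * sin psi * cos (theta - eta)).
Proof.
rewrite /dist3 /spherical/= cosB; congr Num.sqrt.
have h1 := cos2Dsin2 eta; have h2 := cos2Dsin2 theta.
have h3 := cos2Dsin2 phi; have h4 := cos2Dsin2 psi.
transitivity (sin psi ^+ 2 * (cos eta ^+ 2 + sin eta ^+ 2) + cos psi ^+ 2 +
  (sin phi ^+ 2 * (cos theta ^+ 2 + sin theta ^+ 2) + cos phi ^+ 2)
  - 2 * cos phi * cos psi - 2 * sin phi * sin psi *
   (cos theta * cos eta + sin theta * sin eta)); first by ring.
by rewrite h1 h2 !mulr1 ![sin _ ^+ 2 + _]addrC h3 h4.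
Qed.

Lemma sin_sqrt (R : realType) (phi : R) : 0 <= phi <= pi ->
  sin phi = Num.sqrt (1 - cos phi ^+ 2).
Proof.
by move=> h; rewrite -sin2cos2 sqrtr_sqr ger0_norm// sin_ge0_pi.
Qed.

Lemma cos_itvoo (R : realType) (phi : R) : 0 < phi < pi -> -1 < cos phi < 1.
Proof.
move=> /andP[h0 h1]; have pi0 := @pi_gt0 R.
by rewrite -cospi -(@cos0 R) !ltr_cos ?in_itv/= ?lexx ?(ltW h0) ?(ltW h1) ?(ltW pi0) ?h0 ?h1.
Qed.

(** Given z, the integrand on the right is a product of a function of cos phi by a
    function of cos psi; this separation is what makes the potential of a
    measure invariant by rotation computable. *)
Lemma azimuth_integral (R : realType) (eta psi phi : R) :
  0 <= eta <= 2 * pi -> 0 < psi < pi -> 0 < phi < pi -> phi != psi ->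
  (\int[lebesgue_measure]_(theta in `[0%R, (2 * pi)%R])
     ((dist3 (spherical eta psi) (spherical theta phi))%:E)^-1 =
   2%:E * \int[lebesgue_measure]_(z in `](-1)%R, (Num.min (cos phi) (cos psi))[)
     (Num.sqrt ((1 - z ^+ 2) * ((cos phi - z) * (cos psi - z))))^-1%:E)%E.
Proof.
move=> etaI psiI phiI pp.
have [/ltW psi0 /ltW psi1] := andP psiI; have [/ltW phi0 /ltW phi1] := andP phiI.
have psiI' : 0 <= psi <= pi by rewrite psi0.
have phiI' : 0 <= phi <= pi by rewrite phi0.
have [c1 c2] := andP (cos_itvoo phiI); have [c3 c4] := andP (cos_itvoo psiI).
have cpp : cos phi != cos psi.
  by apply: contra pp => /eqP/cos_inj; rewrite !in_itv/= psiI' phiI' => ->.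
pose h (t : R) := 2 - 2 * cos phi * cos psi - 2 * sin phi * sin psi * cos t.
have s0 : 0 <= sin phi * sin psi by rewrite mulr_ge0 ?sin_ge0_pi.
have h0 t : 0 < h t.
  have h3 := cos2Dsin2 phi; have h4 := cos2Dsin2 psi.
  rewrite (_ : h t = (cos phi - cos psi) ^+ 2 + ((sin phi - sin psi) ^+ 2 +
    2 * ((sin phi * sin psi) * (1 - cos t)))); last first.
    transitivity ((cos phi ^+ 2 + sin phi ^+ 2) + (cos psi ^+ 2 + sin psi ^+ 2)
      - 2 * cos phi * cos psi - 2 * sin phi * sin psi * cos t); last by ring.
    by rewrite h3 h4 /h; ring.
  rewrite ltr_pwDl ?exprn_even_gt0//= ?subr_eq0// addr_ge0 ?sqr_ge0//.
  by rewrite !mulr_ge0 ?sin_ge0_pi// subr_ge0 cos_le1.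
pose g (t : R) := (Num.sqrt (h t))^-1.
have cg : continuous g.
  move=> t; apply: continuous_fun_inv; first by rewrite gt_eqF// sqrtr_gt0.
  apply: continuous_fun_sqrt; apply: continuous_fun_sub; first exact: cvg_cst.
  by apply: continuous_fun_mul; [exact: cvg_cst|exact: continuous_cos].
have g0 t : 0 <= g t by rewrite invr_ge0 sqrtr_ge0.
have pi0 := @pi_gt0 R.
transitivity (\int[lebesgue_measure]_(theta in `[0%R, (2 * pi)%R]) (g (theta - eta))%:E)%E.
  apply: eq_integral => theta _; rewrite dist3_spherical /g /h.
  by rewrite inver gt_eqF// sqrtr_gt0; exact: h0.
have cge : continuous (fun t => g (t - eta)).
  move=> t; apply: (@continuous_fun_comp R g (fun t => t - eta)); last exact: cg.
  exact: continuous_subr.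
rewrite (@integral_itv_bndoo R 0 (2 * pi) (fun t => (g (t - eta))%:E)); last first.
  exact: (@measurable_EFin_continuous R (fun t => g (t - eta)) _ cge).
have cos2 x : cos (2 * pi + x) = cos x :> R.
  by rewrite addrC mulr_natl cosD2pi.
rewrite integral_period//; last by move=> x; rewrite /g /h [x + _]addrC cos2.
rewrite integral_itvoo_even//; last by move=> x; rewrite /g /h cos2 cosN.
congr (_ * _)%E.
have [cc|cc|cc] := ltgtP (cos phi) (cos psi); last by rewrite cc eqxx in cpp.
- by rewrite -ring_kernel//; apply: eq_integral => t _; rewrite /g /h !sin_sqrt.
- transitivity (\int[lebesgue_measure]_(z in `](-1)%R, (cos psi)[)
     (Num.sqrt ((1 - z ^+ 2) * ((cos psi - z) * (cos phi - z))))^-1%:E)%E; last first.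
    by apply: eq_integral => z _; rewrite [(cos psi - z) * _]mulrC.
  rewrite -ring_kernel//; apply: eq_integral => t _; rewrite /g /h !sin_sqrt//.
  by congr ((Num.sqrt _)^-1%:E); ring.
Qed.

(** * The potential of the cap density *)

(** The equilibrium density at the polar angle [phi], up to a constant factor. *)
Definition cap_core (R : realType) (alpha phi : R) : R :=
  cap_primitive (cos phi) (cos alpha) / (1 - cos phi).

Lemma atan_ge0 (R : realType) (x : R) : 0 <= x -> 0 <= atan x.
Proof. by move=> x0; rewrite -(@atan0 R) le_atan. Qed.

Lemma cap_primitive_ge0 (R : realType) (a w : R) : a <= 1 -> 0 <= cap_primitive a w.
Proof.
move=> a1; rewrite /cap_primitive.
by rewrite addr_ge0 ?sqrtr_ge0// mulr_ge0 ?subr_ge0// atan_ge0 ?sqrtr_ge0.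
Qed.

Lemma cap_core_ge0 (R : realType) (alpha phi : R) : 0 <= cap_core alpha phi.
Proof. by rewrite /cap_core divr_ge0 ?subr_ge0 ?cap_primitive_ge0 ?cos_le1. Qed.

(** After [azimuth_integral], exchanging the integrals in phi and z leaves
    [integral_cap_abel] in phi. *)
Lemma cap_potential_ring (R : realType) (alpha eta psi : R) :
  0 < alpha < pi -> 0 <= eta <= 2 * pi -> 0 < psi < pi ->
  (\int[lebesgue_measure]_(phi in `]alpha, pi[)
     ((cap_core alpha phi * sin phi)%:E *
      \int[lebesgue_measure]_(theta in `[0%R, (2 * pi)%R])
         ((dist3 (spherical eta psi) (spherical theta phi))%:E)^-1) =
   (2 * pi)%:E *
   \int[lebesgue_measure]_(z in `](-1)%R, (Num.min (cos psi) (cos alpha))[)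
     ((cos alpha - z) / ((1 - z) * Num.sqrt ((1 + z) * (cos psi - z))))%:E)%E.
Proof.
move=> /andP[a0 api] etaI psiI.
set b := cos psi; set c := cos alpha.
have pi0 := @pi_gt0 R.
pose K (p : R * R) : \bar R :=
  (if ((alpha < p.1) && (p.1 < pi)) && ((-1 < p.2) && ((p.2 < cos p.1) && (p.2 < b)))
  then 2 * (cap_primitive (cos p.1) c / (1 - cos p.1)) * sin p.1 *
    (Num.sqrt ((1 - p.2 ^+ 2) * ((cos p.1 - p.2) * (b - p.2))))^-1 else 0)%:E.
have mK : measurable_fun setT K by rewrite /K /cap_primitive; mfun.
have K0 p : (0 <= K p)%E.
  rewrite /K lee_fin; case: ifPn => // /andP[/andP[h1 h2] _].
  have s0 : 0 <= sin p.1 by rewrite sin_ge0_pi// !ltW// (lt_trans a0).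
  apply: mulr_ge0; last by rewrite invr_ge0 sqrtr_ge0.
  by apply: mulr_ge0 => //; apply: mulr_ge0 => //; exact: cap_core_ge0.
have mFK := @measurable_fun_fubini_tonelli_F _ _ _ _ R lebesgue_measure K mK K0.
transitivity (\int[lebesgue_measure]_phi \int[lebesgue_measure]_z K (phi, z))%E.
  transitivity (\int[lebesgue_measure]_(phi in `]alpha, pi[) \int[lebesgue_measure]_z K (phi, z))%E; last first.
    rewrite integral_itvoo_if; apply: eq_integral => phi _.
    case: ifPn => // nh; rewrite integral0_eq// => z _.
    by rewrite /K/= (negbTE nh).
  have ring_eq phi : phi \in `]alpha, pi[ -> phi != psi ->
      ((cap_core alpha phi * sin phi)%:E *
      \int[lebesgue_measure]_(theta in `[0%R, (2 * pi)%R])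
         ((dist3 (spherical eta psi) (spherical theta phi))%:E)^-1 =
      \int[lebesgue_measure]_z K (phi, z))%E.
    rewrite in_itv/= => /andP[ap phipi] pp.
    have p0 : 0 < phi by exact: lt_trans ap.
    have s0 : 0 <= sin phi by rewrite sin_ge0_pi// !ltW.
    rewrite azimuth_integral ?p0// muleA -EFinM -ge0_integralZ_EFin//; last 2 first.
    - by apply: measurable_funTS; mfun.
    - by apply: mulr_ge0 => //; apply: mulr_ge0 => //; exact: cap_core_ge0.
    rewrite integral_itvoo_if; apply: eq_integral => z _.
    rewrite /K/= ap phipi/= lt_min.
    by case: ifPn => // _; congr EFin; rewrite /cap_core -/c; ring.
  (* On the circle through x itself the kernel integral diverges; one value of
     phi is negligible. *)
  have mD : measurable (`]alpha, pi[ `\ psi : set R) by exact: measurableD.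
  have mI : measurable_fun (`]alpha, pi[ `\ psi) (fun phi => \int[lebesgue_measure]_z K (phi, z))%E.
    exact: measurable_funTS.
  rewrite -(@integral_setD1 _ _ psi)//; last first.
    apply: eq_measurable_fun mI => phi; rewrite inE/= => -[h1 /eqP h2].
    by rewrite -ring_eq.
  rewrite -[RHS](@integral_setD1 _ _ psi)//.
  by apply: eq_integral => phi; rewrite inE/= => -[h1 /eqP h2]; exact: ring_eq.
rewrite tonelli_lebesgue//.
have c1 : c <= 1 by exact: cos_le1.
rewrite -ge0_integralZ_EFin//; last 3 first.
- by apply: measurable_funTS; mfun.
- move=> z; rewrite /= in_itv/= lt_min => /and3P[_ _ zc].
  by rewrite divr_ge0 ?mulr_ge0 ?sqrtr_ge0 ?subr_ge0 ?(ltW zc)// ltW// (lt_le_trans zc).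
- by rewrite mulr_ge0// ltW.
rewrite integral_itvoo_if; apply: eq_integral => z _.
rewrite lt_min.
case: ifPn => [/andP[z1 /andP[zb zc]]|nh]; last first.
  rewrite integral0_eq// => phi _; rewrite /K/=; case: ifPn => // /andP[/andP[h1 h2] /and3P[h3 h4 h5]].
  case/negP: nh; rewrite h3 h5/= (lt_trans h4)// ltr_cos// in_itv/= !ltW//.
  exact: lt_trans h1.
have zI : -1 <= z <= 1 by rewrite ltW//= ltW// (lt_le_trans zc).
have z0 : 0 < 1 - z by rewrite subr_gt0 (lt_le_trans zc).
have z0' : 0 < 1 + z by lra.
have bz : 0 < b - z by rewrite subr_gt0.
transitivity (\int[lebesgue_measure]_(phi in `]alpha, acos z[)
   (2 / Num.sqrt ((1 - z ^+ 2) * (b - z)) *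
    (cap_primitive (cos phi) c *
       (sin phi / ((1 - cos phi) * Num.sqrt (cos phi - z)))))%:E)%E.
  rewrite integral_itvoo_if; apply: eq_integral => phi _; rewrite /K/= z1 zb/= andbT.
  have [ap|] := ltP alpha phi => //=.
  have p0 : 0 < phi by exact: lt_trans ap.
  have [pp|pp] := ltP phi pi => /=; last first.
    by rewrite ltNge (le_trans (acos_lepi zI))//.
  rewrite -lt_acos//; last by rewrite !ltW.
  case: ifPn => // phz; congr EFin.
  rewrite (_ : (1 - z ^+ 2) * ((cos phi - z) * (b - z)) =
    (1 - z ^+ 2) * (b - z) * (cos phi - z)); last by ring.
  rewrite [in LHS]sqrtrM ?mulr_ge0 ?(ltW bz)//; last by nra.
  by rewrite !invfM; ring.
rewrite ge0_integralZ_EFin//; last 2 first.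
- by apply: measurable_funTS; rewrite /cap_primitive; mfun.
- move=> phi; rewrite /= in_itv/= => /andP[ap pz].
  have s0 : 0 <= sin phi.
    by rewrite sin_ge0_pi// (ltW (lt_trans a0 ap)) (le_trans (ltW pz)) ?acos_lepi.
  apply: mulr_ge0; first exact/cap_primitive_ge0/cos_le1.
  by rewrite divr_ge0// mulr_ge0 ?sqrtr_ge0// subr_ge0 cos_le1.
rewrite integral_cap_abel//; last exact: ltW.
rewrite -EFinM -/c; congr EFin.
rewrite (_ : (1 - z ^+ 2) * (b - z) = (1 - z) * ((1 + z) * (b - z))); last by ring.
rewrite sqrtrM ?(ltW z0)//.
have q0 : Num.sqrt (1 - z) != 0 by rewrite gt_eqF// sqrtr_gt0.
have q1 : Num.sqrt ((1 + z) * (b - z)) != 0 by rewrite gt_eqF// sqrtr_gt0 mulr_gt0.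
have -> : ((1 - z) * Num.sqrt ((1 + z) * (b - z))) = Num.sqrt (1 - z) ^+ 2 * Num.sqrt ((1 + z) * (b - z)).
  by rewrite sqr_sqrtr// ltW.
by field; rewrite q0 q1.
Qed.

(** By [integral_chord], the value pi and the field term Y are also integrals
    over ]-1, b[, with integrands 1 / s z and (1 - c) / ((1 - z) s z), where
    s z = sqrt ((1 + z) (b - z)).  Since (c - z) + (1 - c) = 1 - z, the integrands
    of X and Y add up to that of pi where z < c; beyond c only Y contributes, and
    there (1 - c) / (1 - z) >= 1. *)
Lemma frostman_integral (R : realType) (b c : R) : -1 < b -> b < 1 -> -1 < c -> c < 1 ->
  let X := (\int[lebesgue_measure]_(z in `](-1)%R, (Num.min b c)[)
     ((c - z) / ((1 - z) * Num.sqrt ((1 + z) * (b - z))))%:E)%E in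
  let Y := (((1 - c) * pi / Num.sqrt (2 * (1 - b)))%:E) in
  (pi%:E <= X + Y)%E /\ ((b <= c)%R -> X + Y = pi%:E)%E.
Proof.
move=> b1 b1' c1 c1' X Y.
pose s (z : R) := Num.sqrt ((1 + z) * (b - z)).
pose h (z : R) := if z < c then (c - z) / ((1 - z) * s z) else 0.
pose k (z : R) := (1 - c) * ((1 - z) * s z)^-1.
have mh D : measurable_fun D (EFin \o h).
  by apply/measurable_EFinP; apply: measurable_funTS; rewrite /h /s; mfun.
have mk D : measurable_fun D (EFin \o k).
  by apply/measurable_EFinP; apply: measurable_funTS; rewrite /k /s; mfun.
have h0 z : z < b -> 0 <= h z.
  move=> zb; rewrite /h; case: ifPn => // zc.
  rewrite divr_ge0 ?mulr_ge0 ?sqrtr_ge0 ?subr_ge0 ?(ltW zc)//.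
  by rewrite ltW// (lt_trans zb).
have k0 z : z < b -> 0 <= k z.
  move=> zb; rewrite /k mulr_ge0 ?invr_ge0 ?mulr_ge0 ?sqrtr_ge0 ?subr_ge0 ?(ltW c1')//.
  by rewrite ltW// (lt_trans zb).
have XE : X = (\int[lebesgue_measure]_(z in `](-1)%R, b[) (h z)%:E)%E.
  rewrite /X !integral_itvoo_if; apply: eq_integral => z _.
  rewrite lt_min /h andbA.
  by case: ((-1 < z) && (z < b)) => //=; case: ifP.
have YE : Y = (\int[lebesgue_measure]_(z in `](-1)%R, b[) (k z)%:E)%E.
  rewrite /k ge0_integralZ_EFin//.
  - have hu : 0 < 1 - 1 * (-1) :> R by lra.
    have hv : 0 < 1 - 1 * b by lra.
    have e : 2 * (1 - b) = (1 - 1 * (-1)) * (1 - 1 * b) by ring.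
    rewrite /Y e -mulrA EFinM -(integral_chord b1 hu hv); congr (_ * _)%E.
    by apply: eq_integral => z _; rewrite /s mul1r opprK [z + 1]addrC.
  - by apply: measurable_funTS; rewrite /s; mfun.
  - move=> z; rewrite /= in_itv/= => /andP[_ zb].
    rewrite invr_ge0 mulr_ge0 ?sqrtr_ge0// subr_ge0.
    by rewrite ltW// (lt_trans zb).
  - by rewrite subr_ge0 ltW.
have PE : pi%:E = (\int[lebesgue_measure]_(z in `](-1)%R, b[) ((s z)^-1)%:E)%E.
  have hu : 0 < 1 - 0 * (-1) :> R by lra.
  have hv : 0 < 1 - 0 * b by lra.
  have := integral_chord b1 hu hv.
  rewrite !mul0r subr0 mulr1 sqrtr1 divr1 => <-.
  by apply: eq_integral => z _; rewrite /s mul0r subr0 mul1r opprK [z + 1]addrC.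
have XYE : (X + Y = \int[lebesgue_measure]_(z in `](-1)%R, b[) (h z + k z)%:E)%E.
  have h0' z : `](-1), b[%classic z -> (0 <= (h z)%:E)%E.
    by rewrite /= in_itv/= lee_fin => /andP[_ /h0].
  have k0' z : `](-1), b[%classic z -> (0 <= (k z)%:E)%E.
    by rewrite /= in_itv/= lee_fin => /andP[_ /k0].
  rewrite XE YE; apply/esym; under eq_integral do rewrite EFinD.
  by apply: ge0_integralD => //; [exact: mh|exact: mk].
have key z : -1 < z -> z < b -> z < c -> h z + k z = (s z)^-1.
  move=> z1 zb zc; rewrite /h /k zc.
  have s0 : s z != 0 by rewrite gt_eqF// sqrtr_gt0 mulr_gt0 ?subr_gt0//; lra.
  have z0 : 1 - z != 0 by rewrite subr_eq0 gt_eqF// (lt_trans zc).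
  by field; rewrite s0 z0.
split.
  rewrite PE XYE; apply: ge0_le_integral => //.
  - by move=> z _; rewrite lee_fin invr_ge0 sqrtr_ge0.
  - by apply/measurable_EFinP; apply: measurable_funTS; rewrite /s; mfun.
  - by apply/measurable_EFinP; apply: measurable_funTS; rewrite /h /k /s; mfun.
  - move=> z; rewrite /= in_itv/= lee_fin => /andP[z1 zb].
    have [zc|cz] := ltP z c; first by rewrite key.
    rewrite (le_trans _ (_ : k z <= _))// ?lerDr ?h0//.
    rewrite /k invfM mulrA ler_peMl ?invr_ge0 ?sqrtr_ge0//.
    by rewrite ler_pdivlMr ?subr_gt0 ?(lt_trans zb)// mul1r lerD2l lerN2.
move=> bc; rewrite PE XYE; apply: eq_integral => z; rewrite inE/= in_itv/= => /andP[z1 zb].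
by rewrite key// (lt_le_trans zb).
Qed.

(** * Measures given by a density *)

Import HBNNSimple.

Section density.
Context d (T : measurableType d) (R : realType) (m : {measure set T -> \bar R}).
Context (D : T -> R) (D0 : forall x, 0 <= D x) (mD : measurable_fun setT D).
Local Open Scope ereal_scope.

(** The two unnamed proofs are arguments because the measure structure attached
    to this constant must be found from the term itself. *)
Definition density_measure (_ : forall x, (0 <= D x)%R) (_ : measurable_fun setT D)
  (A : set T) : \bar R := \int[m]_(x in A) (D x)%:E.

Local Notation nu := (density_measure D0 mD).

Let nu0 : nu set0 = 0. Proof. by rewrite /density_measure integral_set0. Qed.

Let nu_ge0 A : 0 <= nu A.
Proof. by apply: integral_ge0 => x _; rewrite lee_fin. Qed.

Let nu_sigma_additive : semi_sigma_additive nu.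
Proof.
move=> A mA tA mUA; rewrite /density_measure ge0_integral_bigcup//.
- by apply: is_cvg_ereal_nneg_natsum_cond => n _ _; exact: nu_ge0.
- by apply/measurable_EFinP; exact: measurable_funTS.
- by move=> x _; rewrite lee_fin.
Qed.

HB.instance Definition _ := isMeasure.Build _ _ _ nu nu0 nu_ge0 nu_sigma_additive.

(** The formula is clear for indicators, passes to nonnegative simple functions by
    linearity, and to all nonnegative functions by monotone convergence. *)
Lemma ge0_integral_density (f : T -> \bar R) : measurable_fun setT f ->
  (forall x, 0 <= f x) ->
  \int[nu]_x f x = \int[m]_x (f x * (D x)%:E).
Proof.
move=> mf f0.
have mD' : measurable_fun setT (EFin \o D) by exact/measurable_EFinP.
pose h := nnsfun_approx measurableT mf.
have cvgh x : (EFin \o h n) x @[n --> \oo] --> f x.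
  by apply: (cvg_nnsfun_approx measurableT mf (fun x _ => f0 x)).
have -> : \int[nu]_x f x = limn (fun n => \int[nu]_x (EFin \o h n) x).
  rewrite -monotone_convergence//.
  - by apply: eq_integral => x _; apply/esym/cvg_lim => //; exact: cvgh.
  - by move=> n; apply/measurable_EFinP; exact: measurable_funP.
  - by move=> n x _; rewrite lee_fin.
  - by move=> x _ a b ab; rewrite lee_fin; exact/lefP/nd_nnsfun_approx.
have -> : \int[m]_x (f x * (D x)%:E) = limn (fun n => \int[m]_x ((EFin \o h n) x * (D x)%:E)).
  rewrite -monotone_convergence//.
  - apply: eq_integral => x _; apply/esym/cvg_lim => //.
    by apply: cvgeZr => //; exact: cvgh.
  - move=> n; apply: emeasurable_funM => //.
    by apply/measurable_EFinP; exact: measurable_funP.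
  - by move=> n x _; rewrite mule_ge0// lee_fin.
  - move=> x _ a b ab; rewrite lee_wpmul2r ?lee_fin//.
    exact/lefP/nd_nnsfun_approx.
congr (limn _); apply/funext => n.
transitivity (\int[nu]_x (\sum_(y \in range (h n)) (y * \1_(h n @^-1` [set y]) x)%:E)).
  by apply: eq_integral => t tE; rewrite /= fimfunE -fsumEFin.
rewrite ge0_integral_fsum//; last 2 first.
- by move=> y; exact/measurable_EFinP/measurable_funM.
- by move=> y x _; exact: nnfun_muleindic_ge0.
transitivity (\int[m]_x (\sum_(y \in range (h n)) ((y * \1_(h n @^-1` [set y]) x)%:E * (D x)%:E))); last first.
  apply: eq_integral => x _.
  rewrite -ge0_mule_fsuml => [|y]; last exact: nnfun_muleindic_ge0.
  by rewrite fsumEFin// -(fimfunE _ x).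
rewrite ge0_integral_fsum//; last 2 first.
- by move=> y; apply: emeasurable_funM => //; exact/measurable_EFinP/measurable_funM.
- by move=> y x _; apply: mule_ge0; [exact: nnfun_muleindic_ge0|rewrite lee_fin].
apply: eq_fsbigr => r _.
rewrite integralZl_indic_nnsfun// integral_indic// setIT.
rewrite -[X in _ * X]/(\int[m]_(x in h n @^-1` [set r]) (D x)%:E).
rewrite [X in _ * X]integral_mkcond.
have [r0|r0] := leP 0%R r.
  rewrite -ge0_integralZl_EFin//.
  - apply: eq_integral => x _; rewrite patchE indicE.
    by case: ifPn => _; rewrite ?mulr1 ?mulr0 ?mule0 ?mul0e.
  - by move=> x _; rewrite patchE; case: ifPn => _ //; rewrite lee_fin.
  - apply/(@measurable_restrictT _ _ _ _ (h n @^-1` [set r]) (EFin \o D)) => //; exact: measurable_funTS.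
rewrite preimage_nnfun0// [X in r%:E * X]integral0_eq => [|x _]; last by rewrite patchE in_set0.
rewrite mule0; apply/esym/integral0_eq => x _.
by rewrite indicE in_set0 mulr0 mul0e.
Qed.

End density.

Section density_probability.
Context d (T : measurableType d) (R : realType) (m : {measure set T -> \bar R}).
Context (D : T -> R) (D0 : forall x, 0 <= D x) (mD : measurable_fun setT D).
Context (D1 : (\int[m]_x (D x)%:E = 1)%E).

Definition density_probability (_ : (\int[m]_x (D x)%:E = 1)%E) : set T -> \bar R :=
  density_measure m D0 mD.

HB.instance Definition _ := Measure.on (density_probability D1).

HB.instance Definition _ :=
  Measure_isProbability.Build _ _ _ (density_probability D1) D1.

End density_probability.

(** * The candidate measure *)

(** Half-angle formulas: both sides are expressed by the angle alpha / 2. *)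
Lemma atan_half (R : realType) (alpha : R) : 0 < alpha < pi ->
  Num.sqrt ((1 + cos alpha) / (1 - cos alpha)) = sin alpha / (1 - cos alpha) /\
  atan (sin alpha / (1 - cos alpha)) = (pi - alpha) / 2.
Proof.
move=> /andP[a0 api]; have pi0 := @pi_gt0 R.
pose h := alpha / 2.
have C0 : 0 < cos h by rewrite cos_gt0_pihalf// /h; apply/andP; split; lra.
have S0 : 0 < sin h by rewrite sin_gt0_pihalf// /h; apply/andP; split; lra.
have aE : alpha = h *+ 2 by rewrite /h -mulr_natr; field.
have CS := cos2Dsin2 h.
have e1 : 1 + cos alpha = 2 * cos h ^+ 2 by rewrite aE cos_mulr2n; ring.
have e2 : 1 - cos alpha = 2 * sin h ^+ 2.
  by rewrite aE cos_mulr2n sin2cos2; ring.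
have e3 : sin alpha = 2 * sin h * cos h by rewrite aE sin_mulr2n; ring.
have e4 : sin alpha / (1 - cos alpha) = cos h / sin h.
  by rewrite e3 e2; field; rewrite gt_eqF.
split.
  rewrite e4 e1 e2 (_ : 2 * _ / _ = (cos h / sin h) ^+ 2); last first.
    by field; rewrite gt_eqF.
  by rewrite sqrtr_sqr ger0_norm// divr_ge0// ltW.
rewrite e4 (_ : cos h / sin h = tan ((pi - alpha) / 2)).
  by rewrite tanK// in_itv/=; apply/andP; split; lra.
have -> : (pi - alpha) / 2 = pi / 2 - h by rewrite /h; field.
by rewrite /tan sinB cosB sin_pihalf cos_pihalf !mul0r !mul1r add0r subr0.
Qed.

(** In the variable x = (cos alpha - cos phi) / (1 - cos alpha), the integrand is
    atan (sqrt x) + sqrt x / (1 + x), whose primitive is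
    (x - 1) atan (sqrt x) + sqrt x; at phi = pi it is evaluated by
    [atan_half]. *)
Lemma integral_cap_core (R : realType) (alpha : R) : 0 < alpha < pi ->
  (\int[lebesgue_measure]_(phi in `]alpha, pi[) (cap_core alpha phi * sin phi)%:E =
   (sin alpha + cos alpha * (pi - alpha))%:E)%E.
Proof.
move=> aI; have /andP[a0 api] := aI.
have /andP[c1 c1'] := cos_itvoo aI.
set c := cos alpha in c1 c1' *.
have c0 : 1 - c != 0 by rewrite subr_eq0 gt_eqF.
pose x (phi : R) := (c - cos phi) / (1 - c).
pose P (phi : R) := (1 - c) * ((x phi - 1) * atan (Num.sqrt (x phi)) + Num.sqrt (x phi)).
have x0 phi : alpha < phi -> phi < pi -> 0 < x phi.
  move=> ap phipi; rewrite divr_gt0 ?subr_gt0// ltr_cos// in_itv/= !ltW//.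
  exact: lt_trans ap.
have dx (phi : R) : is_derive phi 1 x (sin phi / (1 - c)).
  have d := is_derive_fun_mul (is_derive_fun_sub (is_derive_cst c phi 1) (is_derive_cos phi))
    (is_derive_cst (1 - c)^-1 phi 1).
  by apply: (is_derive_eq (df := _) d); rewrite /cst mulr0 addr0 sub0r opprK.
have cx : continuous x by move=> phi; exact: is_derive_continuous (dx phi).
have cP : continuous P.
  move=> phi; apply: continuous_fun_mul; first exact: cvg_cst.
  have cs : continuous_at phi (fun phi => Num.sqrt (x phi)) by exact: continuous_fun_sqrt.
  apply: continuous_fun_add => //; apply: continuous_fun_mul.
    by apply: continuous_fun_sub => //; exact: cvg_cst.
  by apply: (@continuous_fun_comp R (@atan R)) => //; exact: continuous_atan.
have Pa : P alpha = 0.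
  by rewrite /P /x subrr mul0r sqrtr0 atan0 mulr0 addr0 mulr0.
have Ppi : P pi = sin alpha + c * (pi - alpha).
  have [e1 e2] := atan_half aI.
  rewrite /P /x cospi opprK [c + 1]addrC e1 e2 -/c.
  by field.
have coreE phi : alpha < phi -> phi < pi -> cap_core alpha phi =
    atan (Num.sqrt (x phi)) + Num.sqrt (x phi) / (1 + x phi).
  move=> ap phipi; have xp := x0 _ ap phipi.
  rewrite /cap_core /cap_primitive -/c -/(x phi).
  have p1 : 0 < 1 - cos phi.
    have /andP[_] : -1 < cos phi < 1 by apply: cos_itvoo; rewrite phipi (lt_trans a0).
    by rewrite subr_gt0.
  have -> : (c - cos phi) * (1 - c) = x phi * (1 - c) ^+ 2 by rewrite /x; field.
  rewrite (@sqrtrM _ (x phi) ((1 - c) ^+ 2) (ltW xp)) sqrtr_sqr gtr0_norm ?subr_gt0//.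
  have -> : 1 + x phi = (1 - cos phi) / (1 - c) by rewrite /x; field.
  by field; rewrite c0 gt_eqF.
rewrite -Ppi -[P pi]subr0 -Pa.
pose f phi := (atan (Num.sqrt (x phi)) + Num.sqrt (x phi) / (1 + x phi)) * sin phi.
transitivity (\int[lebesgue_measure]_(phi in `]alpha, pi[) (f phi)%:E)%E.
  apply: eq_integral => phi; rewrite inE/= in_itv/= => /andP[ap phipi].
  by rewrite /f coreE.
apply: (@ge0_FTC2_itvoo R alpha pi f P (P alpha) (P pi) api).
- move=> phi; rewrite in_itv/= => /andP[ap phipi].
  have xp := x0 _ ap phipi.
  have cs : continuous_at phi (fun phi => Num.sqrt (x phi)) by exact: continuous_fun_sqrt.
  apply: continuous_fun_mul; last exact: continuous_sin.
  apply: continuous_fun_add.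
    by apply: (@continuous_fun_comp R (@atan R)) => //; exact: continuous_atan.
  apply: continuous_fun_mul => //; apply: continuous_fun_inv.
    by rewrite gt_eqF// addr_gt0.
  by apply: continuous_fun_add => //; exact: cvg_cst.
- move=> phi; rewrite in_itv/= => /andP[ap phipi].
  rewrite /f -coreE// mulr_ge0 ?cap_core_ge0// sin_ge0_pi// !ltW//.
  exact: lt_trans ap.
- move=> phi; rewrite in_itv/= => /andP[ap phipi].
  have xp := x0 _ ap phipi.
  have ds := @is_derive_fun_sqrt R x phi _ xp (dx phi).
  have d1 := @is_derive_fun_atan R (fun y => Num.sqrt (x y)) phi _ ds.
  have d2 := @is_derive_fun_sub R x (fun=> 1) phi _ _ (dx phi) (is_derive_cst (1 : R) phi 1).
  have d3 := @is_derive_fun_mul R (fun y => x y - 1) _ phi _ _ d2 d1.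
  have d4 := @is_derive_fun_add R _ _ phi _ _ d3 ds.
  have d := @is_derive_fun_mul R (cst (1 - c)) _ phi _ _ (is_derive_cst (1 - c) phi 1) d4.
  apply: (is_derive_eq (df := _) d).
  rewrite /cst /f sqr_sqrtr ?(ltW xp)//.
  have sx : x phi = Num.sqrt (x phi) ^+ 2 by rewrite sqr_sqrtr// ltW.
  have s0 : Num.sqrt (x phi) != 0 by rewrite gt_eqF// sqrtr_gt0.
  have x1 : 1 + x phi != 0 by rewrite gt_eqF// addr_gt0.
  move: sx s0 x1; move: (x phi) (Num.sqrt (x phi)) => X y -> y0 x1.
  by field; rewrite y0 c0 x1.
- by apply: cvg_at_right_filter; exact: cP.
- by apply: cvg_at_left_filter; exact: cP.
Qed.

Lemma measurable_spherical (R : realType) :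
  measurable_fun setT (fun p : R * R => spherical p.2 p.1).
Proof.
by apply: measurable_fun_pair; [apply: measurable_fun_pair|]; mfun.
Qed.

Lemma measurable_dist3 (R : realType) (x : R3 R) : measurable_fun setT (dist3 x).
Proof. by rewrite /dist3; mfun. Qed.

Lemma measurable_dist3_pair (R : realType) :
  measurable_fun setT (fun p : R3 R * R3 R => dist3 p.1 p.2).
Proof. by rewrite /dist3; mfun. Qed.

(** The inverse in the extended reals takes 0 to +oo, not to 0. *)
Lemma measurable_inve (R : realType) d (T : measurableType d) (f : T -> R) :
  measurable_fun setT f -> measurable_fun setT (fun y => ((f y)%:E)^-1%E).
Proof.
move=> mf; rewrite (_ : (fun _ => _) = (fun y => if f y == 0 then +oo%E else ((f y)^-1)%:E)).
  apply: measurable_fun_ifT => //; last by mfun.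
  exact: measurable_fun_eqr.
by apply/funext => y; rewrite inver.
Qed.

Lemma inve_fin_ge0 (R : realType) (x : R) : 0 <= x -> (0 <= (x%:E)^-1)%E.
Proof. by move=> x0; rewrite inver; case: ifP => // _; rewrite lee_fin invr_ge0. Qed.

Lemma dist3_ge0 (R : realType) (x y : R3 R) : 0 <= dist3 x y.
Proof. exact: sqrtr_ge0. Qed.

Section cap_measure.
Context (R : realType) (alpha kappa : R).
Context (aI : 0 < alpha < pi) (k0 : 0 <= kappa).
Local Notation leb := (@lebesgue_measure R).

(** The density of the pair (phi, theta) of spherical coordinates. *)
Definition cap_weight (p : R * R) : R :=
  if ((alpha < p.1) && (p.1 < pi)) && ((0 <= p.2) && (p.2 <= 2 * pi))
  then kappa * (cap_core alpha p.1 * sin p.1) else 0.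

Lemma cap_weight_ge0 p : 0 <= cap_weight p.
Proof.
rewrite /cap_weight; case: ifPn => // /andP[/andP[h1 h2] _].
have /andP[a0 api] := aI.
apply: mulr_ge0 => //; apply: mulr_ge0; first exact: cap_core_ge0.
by rewrite sin_ge0_pi// !ltW// (lt_trans a0).
Qed.

Lemma measurable_cap_weight : measurable_fun setT cap_weight.
Proof. by rewrite /cap_weight /cap_core /cap_primitive; mfun. Qed.

Lemma integral_cap_weight (g : R * R -> \bar R) :
  measurable_fun setT g -> (forall p, 0 <= g p)%E ->
  (\int[leb \x leb]_p (g p * (cap_weight p)%:E) =
   \int[leb]_(phi in `]alpha, pi[) ((kappa * (cap_core alpha phi * sin phi))%:E *
     \int[leb]_(theta in `[0%R, (2 * pi)%R]) g (phi, theta)))%E.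
Proof.
move=> mg g0.
have mW : measurable_fun setT (fun p => g p * (cap_weight p)%:E)%E.
  by apply: emeasurable_funM => //; apply/measurable_EFinP; exact: measurable_cap_weight.
rewrite (@fubini_tonelli1 _ _ _ _ R leb leb)//; last first.
  by move=> p; rewrite mule_ge0// lee_fin cap_weight_ge0.
rewrite integral_itvoo_if; apply: eq_integral => phi _; rewrite /fubini_F/=.
case: ifPn => [ap|nh]; last first.
  by rewrite integral0_eq// => theta _; rewrite /cap_weight/= (negbTE nh) mule0.
have k1 : 0 <= kappa * (cap_core alpha phi * sin phi).
  have := cap_weight_ge0 (phi, 0); rewrite /cap_weight/= ap lexx/=.
  by rewrite mulr_ge0 ?pi_ge0.
have mgphi : measurable_fun setT (fun theta => g (phi, theta)).
  exact: (measurableT_comp mg (measurable_pair1 phi)).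
rewrite -ge0_integralZl_EFin//; last exact: measurable_funTS.
rewrite [RHS]integral_mkcond; apply: eq_integral => theta _.
rewrite patchE mem_setE in_itv/= /cap_weight/= ap/=.
by case: ifPn => _; [rewrite muleC|rewrite mule0].
Qed.

Context (mass : kappa * (sin alpha + cos alpha * (pi - alpha)) * (2 * pi) = 1).

Lemma integral_cap_weight1 : (\int[leb \x leb]_p (cap_weight p)%:E = 1)%E.
Proof.
transitivity (\int[leb \x leb]_p (1 * (cap_weight p)%:E))%E.
  by apply: eq_integral => p _; rewrite mul1e.
rewrite (@integral_cap_weight (cst 1%E))//.
have pi0 := @pi_gt0 R.
transitivity (\int[leb]_(phi in `]alpha, pi[)
   ((kappa * (2 * pi)) * (cap_core alpha phi * sin phi))%:E)%E.
  apply: eq_integral => phi _; rewrite integral_cst//= mul1e.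
  rewrite lebesgue_measure_itv/= lte_fin mulr_gt0// -EFinD subr0 -EFinM.
  by congr EFin; ring.
rewrite ge0_integralZ_EFin//.
- by rewrite integral_cap_core// -EFinM; congr EFin; rewrite -[RHS]mass; ring.
- by apply: measurable_funTS; rewrite /cap_core /cap_primitive; mfun.
- move=> phi; rewrite /= in_itv/= => /andP[h1 h2]; have /andP[a0 api] := aI.
  by apply: mulr_ge0; [exact: cap_core_ge0|rewrite sin_ge0_pi// !ltW// (lt_trans a0)].
- by rewrite mulr_ge0// mulr_ge0// ltW.
Qed.

End cap_measure.

Section cap_probability.
Context (R : realType) (alpha kappa : R).
Context (aI : 0 < alpha < pi) (k0 : 0 <= kappa)
  (mass : kappa * (sin alpha + cos alpha * (pi - alpha)) * (2 * pi) = 1).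
Local Notation leb := (@lebesgue_measure R).

(** The law of the pair (phi, theta); its image under the spherical coordinates
    is the candidate [cap_probability]. *)
Definition cap_angles := [the probability _ R of
  density_probability (m := (leb \x leb)%E) (cap_weight_ge0 aI k0)
    (measurable_cap_weight alpha kappa) (integral_cap_weight1 aI k0 mass)].

Local Notation LR := (g_sigma_algebraType R.-ocitv.-measurable).

Definition spherical_pair (p : LR * LR) : R3 R := spherical p.2 p.1.

Lemma measurable_spherical_pair : measurable_fun setT spherical_pair.
Proof. exact: measurable_spherical. Qed.

HB.instance Definition _ :=
  isMeasurableFun.Build _ _ _ _ spherical_pair measurable_spherical_pair.

Definition cap_probability : probability (R3 R) R :=
  distribution cap_angles spherical_pair.

Lemma integral_cap_probability (g : R3 R -> \bar R) :
  measurable_fun setT g -> (forall p, 0 <= g p)%E ->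
  (\int[cap_probability]_x g x =
   \int[leb]_(phi in `]alpha, pi[) ((kappa * (cap_core alpha phi * sin phi))%:E *
     \int[leb]_(theta in `[0%R, (2 * pi)%R]) g (spherical theta phi)))%E.
Proof.
move=> mg g0.
have mgs : measurable_fun setT (g \o (fun p : R * R => spherical p.2 p.1)).
  exact: (measurableT_comp mg (@measurable_spherical R)).
rewrite ge0_integral_distribution//.
rewrite [LHS]ge0_integral_density//; first exact: (@integral_cap_weight _ _ _ aI k0 _ mgs (fun p => g0 _)).
by move=> p; exact: g0.
Qed.

End cap_probability.

(** * The Frostman conditions *)

Lemma unit_circle_angle (R : realType) (u v : R) : u ^+ 2 + v ^+ 2 = 1 ->
  exists2 t : R, 0 <= t <= 2 * pi & u = cos t /\ v = sin t.
Proof.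
move=> uv; have pi0 := @pi_gt0 R.
have uI : -1 <= u <= 1 by rewrite -ler_norml -(@expr_le1 _ 2)// real_normK ?num_real// -uv lerDl sqr_ge0.
have vE : v ^+ 2 = 1 - u ^+ 2 by rewrite -uv; ring.
have sE : sin (acos u) = `|v| by rewrite sin_acos// -vE sqrtr_sqr.
have a0 := acos_ge0 uI; have a1 := acos_lepi uI.
have [v0|v0] := leP 0 v.
  exists (acos u); first by apply/andP; split; lra.
  by rewrite acosK ?in_itv// sE ger0_norm.
exists (2 * pi - acos u); first by apply/andP; split; lra.
have -> : 2 * pi - acos u = - acos u + pi *+ 2 by ring.
by rewrite cosD2pi sinD2pi cosN sinN acosK ?in_itv// sE ltr0_norm// opprK.
Qed.

Lemma S2E (R : realType) (x : R3 R) :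
  S2 x <-> x.1.1 ^+ 2 + x.1.2 ^+ 2 + x.2 ^+ 2 = 1.
Proof.
rewrite /S2/= /dist3/= !subr0; split => [h|->]; last by rewrite sqrtr1.
by rewrite -[LHS]sqr_sqrtr ?h ?expr1n// !addr_ge0 ?sqr_ge0.
Qed.

Lemma spherical_S2 (R : realType) (theta phi : R) : S2 (spherical theta phi).
Proof.
apply/S2E; rewrite /spherical/= !exprMn -mulrDr cos2Dsin2 mulr1 addrC.
exact: cos2Dsin2.
Qed.

Lemma S2_spherical (R : realType) (x : R3 R) : S2 x ->
  exists eta psi : R, [/\ 0 <= eta <= 2 * pi, 0 <= psi <= pi & x = spherical eta psi].
Proof.
move/S2E; case: x => -[x1 x2] x3 /= h; have pi0 := @pi_gt0 R.
have zI : -1 <= x3 <= 1.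
  rewrite -ler_norml -(@expr_le1 _ 2)// real_normK ?num_real// -h.
  by rewrite lerDr addr_ge0 ?sqr_ge0.
have sE := sin_acos zI.
have s2 : 1 - x3 ^+ 2 = x1 ^+ 2 + x2 ^+ 2 by rewrite -h; ring.
have [s0|s0] := eqVneq (sin (acos x3)) 0.
  exists 0, (acos x3); split; [by apply/andP; split; lra|by rewrite acos_ge0 ?acos_lepi|].
  have := s0; rewrite sE => /eqP; rewrite sqrtr_eq0 s2 => le0.
  have := sqr_ge0 x1; have := sqr_ge0 x2 => a b.
  have /eqP : x1 ^+ 2 = 0 by lra.
  have /eqP : x2 ^+ 2 = 0 by lra.
  rewrite !sqrf_eq0 => /eqP-> /eqP->.
  by rewrite /spherical s0 !mul0r acosK ?in_itv.
set s := sin (acos x3) in s0 sE *.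
have ss : s ^+ 2 = x1 ^+ 2 + x2 ^+ 2.
  by rewrite sE sqr_sqrtr s2// addr_ge0 ?sqr_ge0.
have [|t tI [c1 c2]] := @unit_circle_angle R (x1 / s) (x2 / s).
  by rewrite !expr_div_n -mulrDl ss divff// -ss expf_neq0.
exists t, (acos x3); split => //; first by rewrite acos_ge0 ?acos_lepi.
by rewrite /spherical -c1 -c2 -/s acosK ?in_itv// ![s * _]mulrC !divfK.
Qed.

Lemma dist3_north (R : realType) (eta psi : R) :
  dist3 (spherical eta psi) north_pole = Num.sqrt (2 * (1 - cos psi)).
Proof.
rewrite /dist3 /north_pole /spherical/= !subr0; congr Num.sqrt.
transitivity (sin psi ^+ 2 * (cos eta ^+ 2 + sin eta ^+ 2) + (cos psi - 1) ^+ 2); first by ring.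
by rewrite cos2Dsin2 mulr1 sin2cos2; ring.
Qed.

Lemma measurable_integral_itv (R : realType) (g : R * R -> \bar R) (a b : R) :
  measurable_fun setT g -> (forall p, 0 <= g p)%E ->
  measurable_fun setT (fun x => \int[lebesgue_measure]_(y in `[a, b]) g (x, y))%E.
Proof.
move=> mg g0.
pose h (p : R * R) := if (a <= p.2) && (p.2 <= b) then g p else 0%E.
have mh : measurable_fun setT h by rewrite /h; mfun.
have h0 p : (0 <= h p)%E by rewrite /h; case: ifP.
have := @measurable_fun_fubini_tonelli_F _ _ _ _ R (@lebesgue_measure R) h mh h0.
apply: eq_measurable_fun => x _; rewrite /fubini_F [RHS]integral_mkcond.
by apply: eq_integral => y _; rewrite patchE mem_setE in_itv.
Qed.

Section frostman.
Context (R : realType) (alpha kappa : R).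
Context (aI : 0 < alpha < pi) (k0 : 0 < kappa)
  (mass : kappa * (sin alpha + cos alpha * (pi - alpha)) * (2 * pi) = 1).
Local Notation leb := (@lebesgue_measure R).
Local Notation mu0 := (cap_probability aI (ltW k0) mass).
Let F := 2 * pi ^+ 2 * kappa.
Let q := F * (1 - cos alpha).

Let U (x : R3 R) : \bar R := (\int[mu0]_y ((dist3 x y)%:E)^-1)%E.

Let mk x : measurable_fun setT (fun y : R3 R => ((dist3 x y)%:E)^-1)%E.
Proof. by apply: measurable_inve; apply: measurable_dist3. Qed.

Let UE x : U x = (\int[leb]_(phi in `]alpha, pi[) ((kappa * (cap_core alpha phi * sin phi))%:E *
     \int[leb]_(theta in `[0%R, (2 * pi)%R]) ((dist3 x (spherical theta phi))%:E)^-1))%E.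
Proof.
by rewrite /U integral_cap_probability// => y; exact/inve_fin_ge0/dist3_ge0.
Qed.

Let pi0 := @pi_gt0 R.
Let pin0 : pi != 0 :> R. Proof. exact: lt0r_neq0. Qed.
Let F0 : 0 < F. Proof. by rewrite /F !mulr_gt0. Qed.
Let c1 : -1 < cos alpha < 1. Proof. exact: cos_itvoo. Qed.
Let q0 : 0 < q. Proof. by rewrite /q mulr_gt0// subr_gt0; case/andP: c1. Qed.

Let ring_case eta psi : 0 <= eta <= 2 * pi -> 0 < psi < pi ->
  let x := spherical eta psi in
  (F%:E <= U x + point_charge_field q x)%E /\
  ((cos psi <= cos alpha)%R -> U x + point_charge_field q x = F%:E)%E.
Proof.
move=> etaI psiI x.
have /andP[b1 b1'] := cos_itvoo psiI; have /andP[ca1 ca1'] := c1.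
have [h1 h2] := frostman_integral b1 b1' ca1 ca1'.
set X := (X in (X + _)%E) in h1 h2; set Y := (X in (_ + X%:E)%E) in h1 h2.
have -> : U x = ((F / pi)%:E * X)%E.
  rewrite UE.
  transitivity (kappa%:E * \int[leb]_(phi in `]alpha, pi[) ((cap_core alpha phi * sin phi)%:E *
     \int[leb]_(theta in `[0%R, (2 * pi)%R]) ((dist3 x (spherical theta phi))%:E)^-1))%E.
    rewrite -ge0_integralZl_EFin//.
    - by apply: eq_integral => phi _; rewrite EFinM muleA.
    - move=> phi; rewrite /= in_itv/= => /andP[ap phipi]; apply: mule_ge0.
        have /andP[a0 api] := aI.
        by rewrite lee_fin mulr_ge0 ?cap_core_ge0// sin_ge0_pi// !ltW// (lt_trans a0).
      by apply: integral_ge0 => theta _; exact/inve_fin_ge0/dist3_ge0.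
    - apply: measurable_funTS; apply: emeasurable_funM.
        by rewrite /cap_core /cap_primitive; mfun.
      apply: (@measurable_integral_itv R (fun p => ((dist3 x (spherical p.2 p.1))%:E)^-1)%E).
        exact: (measurableT_comp (mk x) (@measurable_spherical R)).
      by move=> p; exact/inve_fin_ge0/dist3_ge0.
    - exact: ltW.
  rewrite cap_potential_ring// muleA -EFinM -/X; congr (_%:E * _)%E.
  by rewrite /F; move: pin0; move: (@pi R) => P P0; field; exact: P0.
have d0 : Num.sqrt (2 * (1 - cos psi)) != 0 by rewrite gt_eqF// sqrtr_gt0 mulr_gt0// subr_gt0.
have -> : point_charge_field q x = ((F / pi)%:E * Y%:E)%E.
  rewrite /point_charge_field dist3_north inver (negbTE d0) -!EFinM; congr EFin.
  by rewrite /q /Y; move: pin0 F; move: (@pi R) => P P0 F'; field; rewrite d0 P0.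
have Fpi : 0 < F / pi by rewrite divr_gt0.
have FE : F%:E = ((F / pi)%:E * pi%:E)%E by rewrite -EFinM divfK.
rewrite -ge0_muleDr; last 2 first.
- apply: integral_ge0 => z; rewrite /= in_itv/= lt_min => /andP[z1 /andP[zb zc]].
  rewrite lee_fin divr_ge0 ?mulr_ge0 ?sqrtr_ge0 ?subr_ge0 ?(ltW zc)//.
  by rewrite ltW// (lt_trans zb).
- by rewrite lee_fin /Y divr_ge0 ?sqrtr_ge0// mulr_ge0 ?subr_ge0 ?ltW.
split; first by rewrite FE lee_pmul2l.
by move=> bc; rewrite h2// FE.
Qed.

Let south_case : let x := spherical 0 pi in
  (U x + point_charge_field q x = F%:E)%E.
Proof.
move=> x; have /andP[ca1 ca1'] := c1; have /andP[a0 api] := aI.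
have dS theta phi : dist3 x (spherical theta phi) = Num.sqrt (2 * (1 + cos phi)).
  rewrite dist3_spherical sinpi cospi; congr Num.sqrt; ring.
have -> : U x = (F * (1 + cos alpha) / 2)%:E.
  rewrite UE.
  transitivity (\int[leb]_(phi in `]alpha, (acos (-1))%R[) ((kappa * (2 * pi) / Num.sqrt 2) *
     (cap_primitive (cos phi) (cos alpha) *
       (sin phi / ((1 - cos phi) * Num.sqrt (cos phi - -1)))))%:E)%E.
    rewrite acosN1; apply: eq_integral => phi; rewrite inE/= in_itv/= => /andP[ap phipi].
    under eq_integral do rewrite dS.
    have /andP[p1 p1'] : -1 < cos phi < 1 by apply: cos_itvoo; rewrite phipi (lt_trans a0).
    rewrite integral_cst//= lebesgue_measure_itv/= lte_fin mulr_gt0// -EFinD subr0.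
    rewrite inver ifF; last by rewrite gt_eqF// sqrtr_gt0 mulr_gt0//; lra.
    rewrite -!EFinM; congr EFin; rewrite /cap_core opprK [cos phi + 1]addrC.
    by rewrite sqrtrM// !invfM; ring.
  rewrite ge0_integralZ_EFin//; last 3 first.
  - by apply: measurable_funTS; rewrite /cap_primitive; mfun.
  - move=> phi; rewrite acosN1 /= in_itv/= => /andP[ap phipi].
    have s0 : 0 <= sin phi by rewrite sin_ge0_pi// !ltW// (lt_trans a0).
    apply: mulr_ge0; first exact/cap_primitive_ge0/cos_le1.
    by rewrite divr_ge0// mulr_ge0 ?sqrtr_ge0// subr_ge0 cos_le1.
  - apply: divr_ge0; last exact: sqrtr_ge0.
    by apply: mulr_ge0; [exact: ltW|rewrite mulr_ge0// ltW].
  rewrite integral_cap_abel// -EFinM; congr EFin.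
  rewrite !opprK /F; have s2 : Num.sqrt 2 ^+ 2 = 2 :> R by rewrite sqr_sqrtr.
  have s20 : Num.sqrt 2 != 0 :> R by rewrite gt_eqF// sqrtr_gt0.
  rewrite (_ : 1 + 1 = 2 :> R)//.
  have -> : kappa * (2 * pi) / Num.sqrt 2 * (pi / Num.sqrt 2 * (cos alpha + 1)) =
    kappa * (2 * pi) * pi * (cos alpha + 1) / Num.sqrt 2 ^+ 2 :> R by field.
  by rewrite s2; field.
rewrite /point_charge_field dist3_north cospi opprK.
have -> : Num.sqrt (2 * (1 + 1)) = 2 :> R.
  by rewrite (_ : 2 * (1 + 1) = 2 ^+ 2) ?sqrtr_sqr ?ger0_norm//; ring.
rewrite inver ifF; last by apply/negbTE.
by rewrite -EFinM -EFinD; congr EFin; rewrite /q; field.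
Qed.

(** Outside the poles this is [frostman_integral].  At the North Pole the field is
    infinite.  At the South Pole the distance depends on phi alone, and the
    potential is [integral_cap_abel] at z = -1. *)
Lemma frostman x : S2 x ->
  (F%:E <= U x + point_charge_field q x)%E /\
  ((x.2 <= cos alpha)%R -> U x + point_charge_field q x = F%:E)%E.
Proof.
move=> /S2_spherical[eta [psi [etaI /andP[psi0 psi1] ->]]].
rewrite [(spherical eta psi).2]/=.
have /andP[ca1 ca1'] := c1.
have [p0|p0] := eqVneq psi 0.
  rewrite p0 cos0; split; last by rewrite leNgt ca1'.
  rewrite /point_charge_field dist3_north cos0 subrr mulr0 sqrtr0 inve0.
  rewrite gt0_muley ?lte_fin// addey ?leey//.
  by rewrite gt_eqF// (lt_le_trans (ltNyr 0))//; apply: integral_ge0 => y _; exact/inve_fin_ge0/dist3_ge0.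
have [ppi|ppi] := eqVneq psi pi.
  have -> : spherical eta psi = spherical 0 pi.
    by rewrite /spherical ppi sinpi !mul0r.
  by rewrite south_case; split.
by apply: ring_case => //; rewrite !lt_neqAle psi0 psi1 eq_sym p0 ppi.
Qed.

End frostman.

(** * Monomials on the sphere *)

Section bounded.
Context d (T : measurableType d) (R : realType) (P : probability T R).

Lemma bounded_integrable (f : T -> R) (M : R) : measurable_fun setT f ->
  (forall x, `|f x| <= M) -> P.-integrable setT (EFin \o f).
Proof.
move=> mf fM; apply: measurable_bounded_integrable => //.
  by rewrite [X in (X < _)%E](@probability_setT _ _ _ P) ltry.
by exists M; split; [exact: num_real|move=> x Mx y _; exact: le_trans (fM y) (ltW Mx)].
Qed.

Lemma bounded_Rintegral_le (f : T -> R) (M : R) : measurable_fun setT f ->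
  (forall x, `|f x| <= M) -> `|\int[P]_x f x| <= M.
Proof.
move=> mf fM; have fi := bounded_integrable mf fM.
apply: le_trans (le_normr_Rintegral _ fi) _ => //.
have P1 : fine (P setT) = 1 by rewrite [X in fine X](@probability_setT _ _ _ P).
have -> : M = \int[P]_x M by rewrite Rintegral_cst// [X in _ * X]P1 mulr1.
apply: le_Rintegral => //.
  by apply: (@bounded_integrable _ M) => [|x]; [exact: measurableT_comp|rewrite /= normr_id].
by apply: (@bounded_integrable _ `|M|).
Qed.
End bounded.

Definition mon (R : realType) (e : nat * nat * nat) (x : R3 R) : R :=
  x.1.1 ^+ e.1.1 * x.1.2 ^+ e.1.2 * x.2 ^+ e.2.

Definition dot3 (R : realType) (x y : R3 R) : R :=
  x.1.1 * y.1.1 + x.1.2 * y.1.2 + x.2 * y.2.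

(** The exponents of the 3^n words of length n in three letters.  Listing words
    instead of monomials keeps multinomial coefficients out of [dot3X]. *)
Fixpoint mons (n : nat) : seq (nat * nat * nat) :=
  if n is n'.+1 then
    [seq (e.1.1.+1, e.1.2, e.2) | e <- mons n'] ++
    [seq (e.1.1, e.1.2.+1, e.2) | e <- mons n'] ++
    [seq (e.1.1, e.1.2, e.2.+1) | e <- mons n']
  else [:: (0%N, 0%N, 0%N)].

Lemma dot3X (R : realType) (x y : R3 R) n :
  dot3 x y ^+ n = \sum_(e <- mons n) mon e x * mon e y.
Proof.
elim: n => [|n IH] /=; first by rewrite big_seq1 /mon/= !expr0 !mulr1.
rewrite exprS IH !big_cat/= !big_map /= /dot3 !mulrDl !mulr_sumr -addrA.
by congr (_ + (_ + _)); apply: eq_bigr => e _; rewrite /mon/= !exprS; ring.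
Qed.

Lemma mem_mons a b c : (a, b, c) \in mons (a + b + c).
Proof.
elim: c => [|c IH]; last first.
  rewrite addnS/= !mem_cat; apply/orP; right; apply/orP; right.
  by apply/mapP; exists (a, b, c).
rewrite addn0; elim: b => [|b IH]; last first.
  rewrite addnS/= !mem_cat; apply/orP; right; apply/orP; left.
  by apply/mapP; exists (a, b, 0%N).
rewrite addn0; elim: a => [//|a IH].
by rewrite /= mem_cat; apply/orP; left; apply/mapP; exists (a, 0%N, 0%N).
Qed.

Lemma measurable_S2 (R : realType) : measurable (@S2 R).
Proof.
rewrite /S2; have := @measurable_dist3 R (0, 0, 0) => md.
rewrite (_ : [set x | _] = (fun x : R3 R => dist3 x (0,0,0)) @^-1` [set 1]); last by [].
rewrite -[X in measurable X]setTI.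
have mf : measurable_fun setT (fun x : R3 R => dist3 x (0, 0, 0)) by rewrite /dist3; mfun.
by apply: mf => //; exact: measurable_set1.
Qed.

Section monS.
Context (R : realType).
(** Cutting the monomials off outside the sphere makes them bounded on the whole
    space. *)
Definition monS (e : nat * nat * nat) (x : R3 R) : R := mon e x * \1_S2 x.

Lemma measurable_mon e : measurable_fun setT (@mon R e).
Proof. by rewrite /mon; mfun. Qed.

Lemma measurable_monS e : measurable_fun setT (monS e).
Proof. by apply: measurable_funM; [exact: measurable_mon|apply: measurable_indic; exact: measurable_S2]. Qed.

Lemma S2_coord (x : R3 R) : S2 x -> [/\ `|x.1.1| <= 1, `|x.1.2| <= 1 & `|x.2| <= 1].
Proof.
move/S2E => h; have h1 := sqr_ge0 x.1.1; have h2 := sqr_ge0 x.1.2; have h3 := sqr_ge0 x.2.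
by split; rewrite -(@expr_le1 _ 2)// real_normK ?num_real//; lra.
Qed.

Lemma monS_le1 e x : `|monS e x| <= 1.
Proof.
rewrite /monS indicE; have [|] := boolP (x \in S2); last by rewrite mulr0 normr0.
rewrite inE mulr1 /mon => /S2_coord[h1 h2 h3].
by rewrite !normrM !normrX !mulr_ile1 ?mulr_ge0 ?exprn_ge0 ?exprn_ile1.
Qed.

Lemma dot3_le1 (x y : R3 R) : S2 x -> S2 y -> `|dot3 x y| <= 1.
Proof.
move=> /S2E hx /S2E hy; rewrite ler_norml /dot3; apply/andP; split.
- have h1 := sqr_ge0 (x.1.1 + y.1.1); have h2 := sqr_ge0 (x.1.2 + y.1.2).
  have h3 := sqr_ge0 (x.2 + y.2); rewrite !sqrrD in h1 h2 h3.
  lra.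
- have h1 := sqr_ge0 (x.1.1 - y.1.1); have h2 := sqr_ge0 (x.1.2 - y.1.2).
  have h3 := sqr_ge0 (x.2 - y.2); rewrite !sqrrB in h1 h2 h3.
  lra.
Qed.

Lemma dist3_sqr (x y : R3 R) : S2 x -> S2 y -> dist3 x y ^+ 2 = 2 - 2 * dot3 x y.
Proof.
move=> /S2E hx /S2E hy; rewrite /dist3 sqr_sqrtr ?addr_ge0 ?sqr_ge0// /dot3.
transitivity ((x.1.1 ^+ 2 + x.1.2 ^+ 2 + x.2 ^+ 2) + (y.1.1 ^+ 2 + y.1.2 ^+ 2 + y.2 ^+ 2)
  - 2 * (x.1.1 * y.1.1 + x.1.2 * y.1.2 + x.2 * y.2)); first by ring.
by rewrite hx hy.
Qed.

(** A truncated geometric series in 2 u / (t^2 + 2), with its remainder. *)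
Lemma cauchy_kernel_expansion (t u : R) (N : nat) : 0 < t -> `|u| <= 1 ->
  `|(t ^+ 2 + 2 - 2 * u)^-1 - \sum_(n < N) 2 ^+ n / (t ^+ 2 + 2) ^+ n.+1 * u ^+ n|
  <= (2 / (t ^+ 2 + 2)) ^+ N / t ^+ 2.
Proof.
move=> t0 u1; have t20 : 0 < t ^+ 2 by rewrite exprn_gt0.
set T := t ^+ 2 + 2; have T0 : 0 < T by rewrite addr_gt0.
have [u1' u1''] : -1 <= u /\ u <= 1 by apply/andP; rewrite -ler_norml.
have Tu : 0 < T - 2 * u by rewrite /T; lra.
have -> : (T - 2 * u)^-1 - \sum_(n < N) 2 ^+ n / T ^+ n.+1 * u ^+ n =
   (2 / T) ^+ N * (u ^+ N / (T - 2 * u)).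
  elim: N => [|N IH].
    by rewrite big_ord0 subr0 !expr0 !mul1r.
  rewrite big_ord_recr/= opprD addrA IH !expr_div_n !exprS.
  have TN : T ^+ N != 0 by rewrite expf_neq0// gt_eqF.
  have Tn : T != 0 by rewrite gt_eqF.
  have Tu' : T - 2 * u != 0 by rewrite gt_eqF.
  move: TN Tn Tu'; move: (T ^+ N) (u ^+ N) (2 ^+ N) => TN uN pN TN0 X0 Xu.
  by field; rewrite TN0 X0 Xu.
have K0 : 0 <= (2 / T) ^+ N by apply: exprn_ge0; apply: divr_ge0 => //; exact: ltW.
rewrite normrM (ger0_norm K0); apply: ler_wpM2l => //.
rewrite normrM normrX normfV (gtr0_norm Tu) ler_pdivrMr//.
rewrite mulrC -ler_pdivrMr ?invr_gt0// invrK.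
apply: le_trans (_ : 1 * t ^+ 2 <= _).
  by apply: ler_wpM2r; [exact: ltW|exact: exprn_ile1].
by rewrite mul1r /T; lra.
Qed.

End monS.

(** * Positivity for the Cauchy kernels *)

Lemma Rintegral_tensor d1 d2 (T1 : measurableType d1) (T2 : measurableType d2)
    (R : realType) (P : probability T1 R) (Q : probability T2 R)
    (f : T1 -> R) (g : T2 -> R) :
  measurable_fun setT f -> measurable_fun setT g ->
  (forall x, `|f x| <= 1) -> (forall x, `|g x| <= 1) ->
  \int[(P \x Q)%E]_p (f p.1 * g p.2) = \int[P]_x f x * \int[Q]_y g y.
Proof.
move=> mf mg f1 g1.
have mh : measurable_fun setT (fun p : T1 * T2 => f p.1 * g p.2).
  apply: measurable_funM.
    exact: (measurableT_comp mf measurable_fst).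
  exact: (measurableT_comp mg measurable_snd).
have hi : (P \x Q)%E.-integrable setT (EFin \o (fun p : T1 * T2 => f p.1 * g p.2)).
  apply: (@bounded_integrable _ _ _ (P \x Q)%E _ 1) => //.
  by move=> p; rewrite normrM mulr_ile1.
have gi := @bounded_integrable _ _ _ Q g 1 mg g1.
have fi := @bounded_integrable _ _ _ P f 1 mf f1.
rewrite /Rintegral -integral12_prod_meas1//.
rewrite -[in RHS]/(Rintegral _ _ _) -[X in _ * X]/(Rintegral _ _ _).
rewrite [RHS]mulrC -RintegralZl// /Rintegral; congr fine.
apply: eq_integral => x _; rewrite /fubini_F/=.
rewrite mulrC EFinM /Rintegral fineK; last exact: integrable_fin_num.
by rewrite -integralZl//; apply: eq_integral => y _; rewrite EFinM.
Qed.

Section signed_energy.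
Context (R : realType) (mu nu : probability (R3 R) R).

Let I (P Q : probability (R3 R) R) (f : R3 R * R3 R -> R) : R :=
  \int[(P \x Q)%E]_p f p.

(** The energy of the signed measure mu - nu for the kernel [f], expanded by
    bilinearity.  It is only used for bounded kernels, so that the four terms are
    finite. *)
Definition signed_energy (f : R3 R * R3 R -> R) : R :=
  I mu mu f + I nu nu f - (I mu nu f + I nu mu f).

Definition moment_gap (e : nat * nat * nat) : R :=
  \int[mu]_x monS e x - \int[nu]_x monS e x.

Let I_le (P Q : probability (R3 R) R) (f : R3 R * R3 R -> R) (M : R) : measurable_fun setT f -> (forall p, `|f p| <= M) -> `|I P Q f| <= M.
Proof. exact: bounded_Rintegral_le. Qed.

Lemma signed_energy_ge (f : R3 R * R3 R -> R) (M : R) : measurable_fun setT f -> (forall p, `|f p| <= M) ->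
  - (4 * M) <= signed_energy f.
Proof.
move=> mf fM; rewrite /signed_energy.
have h P Q : - M <= I P Q f <= M by rewrite -ler_norml; exact: I_le.
have /andP[? ?] := h mu mu; have /andP[? ?] := h nu nu.
have /andP[? ?] := h mu nu; have /andP[? ?] := h nu mu.
lra.
Qed.

Let I_add (P Q : probability (R3 R) R) (f g : R3 R * R3 R -> R) (M N : R) : measurable_fun setT f -> (forall p, `|f p| <= M) ->
  measurable_fun setT g -> (forall p, `|g p| <= N) ->
  I P Q (fun p => f p + g p) = I P Q f + I P Q g.
Proof.
move=> mf fM mg gN; apply: RintegralD => //.
- exact: (@bounded_integrable _ _ _ (P \x Q)%E f M mf fM).
- exact: (@bounded_integrable _ _ _ (P \x Q)%E g N mg gN).
Qed.

Lemma signed_energyD (f g : R3 R * R3 R -> R) (M N : R) : measurable_fun setT f -> (forall p, `|f p| <= M) ->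
  measurable_fun setT g -> (forall p, `|g p| <= N) ->
  signed_energy (fun p => f p + g p) = signed_energy f + signed_energy g.
Proof.
by move=> mf fM mg gN; rewrite /signed_energy !(I_add _ _ mf fM mg gN); ring.
Qed.

Lemma signed_energyZ (c : R) (f : R3 R * R3 R -> R) (M : R) : measurable_fun setT f -> (forall p, `|f p| <= M) ->
  signed_energy (fun p => c * f p) = c * signed_energy f.
Proof.
move=> mf fM; have h P Q : I P Q (fun p => c * f p) = c * I P Q f.
  by apply: RintegralZl => //; exact: (@bounded_integrable _ _ _ (P \x Q)%E f M mf fM).
by rewrite /signed_energy !h; ring.
Qed.

Lemma signed_energy0 : signed_energy (fun=> 0) = 0.
Proof.
have h P Q : I P Q (fun=> 0) = 0 by rewrite /I Rintegral_cst// mul0r.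
by rewrite /signed_energy !h; ring.
Qed.

Definition monS2 e (p : R3 R * R3 R) : R := monS e p.1 * monS e p.2.

Lemma measurable_monS2 e : measurable_fun setT (monS2 e).
Proof.
apply: measurable_funM.
  exact: (measurableT_comp (@measurable_monS R e) measurable_fst).
exact: (measurableT_comp (@measurable_monS R e) measurable_snd).
Qed.

Lemma monS2_le1 e p : `|monS2 e p| <= 1.
Proof. by rewrite normrM mulr_ile1 ?monS_le1. Qed.

(** A kernel of the form m(x) m(y) has the square of a moment as energy: this is
    where positivity comes from. *)
Lemma signed_energy_monS2 e : signed_energy (monS2 e) = moment_gap e ^+ 2.
Proof.
have h P Q : I P Q (monS2 e) = \int[P]_x monS e x * \int[Q]_y monS e y.
  by apply: Rintegral_tensor; [exact: measurable_monS|exact: measurable_monS|exact: monS_le1|exact: monS_le1].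
by rewrite /signed_energy !h /moment_gap; ring.
Qed.

Lemma signed_energy_seq (s : seq (nat * nat * nat)) :
  exists M, [/\ measurable_fun setT (fun p => \sum_(e <- s) monS2 e p),
    forall p, `|\sum_(e <- s) monS2 e p| <= M &
    signed_energy (fun p => \sum_(e <- s) monS2 e p) = \sum_(e <- s) moment_gap e ^+ 2].
Proof.
elim: s => [|e s [M [ms bs es]]].
  exists 0; split => [|p|].
  - by under eq_fun do rewrite big_nil; exact: measurable_cst.
  - by rewrite big_nil normr0.
  - by under eq_fun do rewrite big_nil; rewrite signed_energy0 big_nil.
exists (1 + M).
have E : (fun p => \sum_(e <- e :: s) monS2 e p) = (fun p => monS2 e p + \sum_(e <- s) monS2 e p).
  by apply/funext => p; rewrite big_cons.
split.
- by rewrite E; apply: measurable_funD => //; exact: measurable_monS2.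
- move=> p; rewrite big_cons; apply: le_trans (ler_normD _ _) _.
  by rewrite lerD ?monS2_le1.
- rewrite E (signed_energyD (measurable_monS2 e) (monS2_le1 e) ms bs).
  by rewrite es signed_energy_monS2 big_cons.
Qed.

Lemma signed_energy_poly (c : nat -> R) (N : nat) : exists M,
  [/\ measurable_fun setT (fun p => \sum_(n < N) c n * \sum_(e <- mons n) monS2 e p),
    forall p, `|\sum_(n < N) c n * \sum_(e <- mons n) monS2 e p| <= M &
    signed_energy (fun p => \sum_(n < N) c n * \sum_(e <- mons n) monS2 e p) =
    \sum_(n < N) c n * \sum_(e <- mons n) moment_gap e ^+ 2].
Proof.
elim: N => [|N [M [ms bs es]]].
  exists 0; split => [|p|].
  - by under eq_fun do rewrite big_ord0; exact: measurable_cst.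
  - by rewrite big_ord0 normr0.
  - by under eq_fun do rewrite big_ord0; rewrite signed_energy0 big_ord0.
have [K [m1 b1 e1]] := signed_energy_seq (mons N).
have m2 : measurable_fun setT (fun p => c N * \sum_(e <- mons N) monS2 e p) by exact: measurable_funM.
have b2 p : `|c N * \sum_(e <- mons N) monS2 e p| <= `|c N| * K.
  by rewrite normrM ler_wpM2l.
exists (M + `|c N| * K).
have E : (fun p => \sum_(n < N.+1) c n * \sum_(e <- mons n) monS2 e p) =
   (fun p => \sum_(n < N) c n * \sum_(e <- mons n) monS2 e p + c N * \sum_(e <- mons N) monS2 e p).
  by apply/funext => p; rewrite big_ord_recr.
split.
- by rewrite E; exact: measurable_funD.
- by move=> p; rewrite big_ord_recr/=; apply: le_trans (ler_normD _ _) _; rewrite lerD.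
- by rewrite E (signed_energyD ms bs m2 b2) es (signed_energyZ _ m1 b1) e1 big_ord_recr.
Qed.

Definition S2xS2 (p : R3 R * R3 R) : R := \1_S2 p.1 * \1_S2 p.2.

Definition cauchy_kernel (t : R) (p : R3 R * R3 R) : R :=
  (t ^+ 2 + dist3 p.1 p.2 ^+ 2)^-1 * S2xS2 p.

Lemma measurable_S2xS2 : measurable_fun setT S2xS2.
Proof.
have m1 : measurable_fun setT (\1_S2 : R3 R -> R).
  by apply: measurable_indic; exact: measurable_S2.
apply: measurable_funM.
  exact: (measurableT_comp m1 measurable_fst).
exact: (measurableT_comp m1 measurable_snd).
Qed.

Lemma measurable_cauchy_kernel t : measurable_fun setT (cauchy_kernel t).
Proof.
apply: measurable_funM; last exact: measurable_S2xS2.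
by have := @measurable_dist3_pair R; rewrite /dist3 => _; mfun.
Qed.

Lemma monS2E e p : monS2 e p = mon e p.1 * mon e p.2 * S2xS2 p.
Proof. by rewrite /monS2 /monS /S2xS2; ring. Qed.

Lemma cauchy_kernel_approx t N p : 0 < t ->
  `|cauchy_kernel t p - \sum_(n < N) (2 ^+ n / (t ^+ 2 + 2) ^+ n.+1) *
      \sum_(e <- mons n) monS2 e p| <= (2 / (t ^+ 2 + 2)) ^+ N / t ^+ 2.
Proof.
move=> t0.
have -> : cauchy_kernel t p - \sum_(n < N) (2 ^+ n / (t ^+ 2 + 2) ^+ n.+1) *
      \sum_(e <- mons n) monS2 e p =
   ((t ^+ 2 + dist3 p.1 p.2 ^+ 2)^-1 -
    \sum_(n < N) (2 ^+ n / (t ^+ 2 + 2) ^+ n.+1) * dot3 p.1 p.2 ^+ n) * S2xS2 p.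
  rewrite mulrBl mulr_suml; congr (_ - _); apply: eq_bigr => n _.
  rewrite dot3X -[RHS]mulrA mulr_suml; congr (_ * _); apply: eq_bigr => e _.
  exact: monS2E.
have [h|] := boolP ((p.1 \in S2) && (p.2 \in S2)).
  have /andP[h1 h2] := h; rewrite /S2xS2 !indicE h1 h2 !mulr1.
  have {}h1 : S2 p.1 by rewrite inE in h1.
  have {}h2 : S2 p.2 by rewrite inE in h2.
  rewrite dist3_sqr// addrA; apply: cauchy_kernel_expansion => //.
  exact: dot3_le1.
have K0 : 0 <= (2 / (t ^+ 2 + 2)) ^+ N / t ^+ 2.
  by rewrite divr_ge0 ?exprn_ge0 ?divr_ge0 ?addr_ge0 ?sqr_ge0// ltW.
by rewrite negb_and /S2xS2 !indicE => /orP[/negbTE ->|/negbTE ->]; rewrite ?mul0r !mulr0 normr0.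
Qed.

Lemma cauchy_kernel_le t p : 0 < t -> `|cauchy_kernel t p| <= (t ^+ 2)^-1.
Proof.
move=> t0; have := cauchy_kernel_approx 0 p t0.
by rewrite big_ord0 subr0 expr0 mul1r.
Qed.

(** The kernel is the uniform limit of nonnegative combinations of products
    m(x) m(y), each with nonnegative energy; keeping a single term gives the
    bound. *)
Lemma signed_energy_cauchy t n e : 0 < t -> e \in mons n ->
  2 ^+ n / (t ^+ 2 + 2) ^+ n.+1 * moment_gap e ^+ 2 <= signed_energy (cauchy_kernel t).
Proof.
move=> t0 emn; have t20 : 0 < t ^+ 2 by rewrite exprn_gt0.
pose c n : R := 2 ^+ n / (t ^+ 2 + 2) ^+ n.+1.
have c0 m : 0 <= c m.
  by rewrite /c divr_ge0 ?exprn_ge0// addr_ge0// ltW.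
pose r : R := 2 / (t ^+ 2 + 2).
have r0 : 0 <= r by rewrite /r divr_ge0// addr_ge0// ltW.
have r1 : r < 1 by rewrite /r ltr_pdivrMr ?addr_gt0// mul1r ltrDr.
have key N : (n < N)%N -> c n * moment_gap e ^+ 2 - 4 * (r ^+ N / t ^+ 2) <= signed_energy (cauchy_kernel t).
  move=> nN; have [M [m1 b1 e1]] := signed_energy_poly c N.
  pose S p := \sum_(n < N) c n * \sum_(e <- mons n) monS2 e p.
  pose D p := cauchy_kernel t p - S p.
  have mD : measurable_fun setT D.
    by apply: measurable_funB => //; exact: measurable_cauchy_kernel.
  have bD p : `|D p| <= r ^+ N / t ^+ 2 by exact: cauchy_kernel_approx.
  have -> : cauchy_kernel t = (fun p => S p + D p).
    by apply/funext => p; rewrite /D addrC subrK.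
  rewrite (signed_energyD m1 b1 mD bD) e1 lerD ?signed_energy_ge//.
  rewrite (bigD1 (Ordinal nN))//= -[leLHS]addr0 lerD//.
    apply: ler_wpM2l; first exact: c0.
    rewrite (big_rem e)//= lerDl sumr_ge0// => i _; exact: sqr_ge0.
  by apply: sumr_ge0 => i _; rewrite mulr_ge0// sumr_ge0// => j _; exact: sqr_ge0.
have cv : (fun N => c n * moment_gap e ^+ 2 - 4 * (r ^+ N / t ^+ 2)) @ \oo -->
    c n * moment_gap e ^+ 2.
  rewrite -[X in _ --> X]subr0; apply: cvgB; first exact: cvg_cst.
  rewrite -[X in _ --> X](mulr0 4); apply: cvgM; first exact: cvg_cst.
  rewrite -[X in _ --> X](mul0r (t ^+ 2)^-1); apply: cvgM; last exact: cvg_cst.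
  by apply: cvg_expr; rewrite ger0_norm.
rewrite -(cvg_lim _ cv)//; apply: limr_le; first by apply/cvg_ex; eexists; exact: cv.
by exists n.+1 => // N /= nN; exact: key.
Qed.

End signed_energy.

(** * Positivity of the Newtonian energy *)

(** For d > 0 the primitive is atan (t / d) / d.  For d = 0 both sides are +oo:
    the left one exceeds pi / (2 b) for every b > 0, by comparison with
    t^2 + b^2. *)
Lemma integral_inv_sqrDsqr (R : realType) (d : R) : 0 <= d ->
  (\int[lebesgue_measure]_(t in `]0%R, +oo[) ((t ^+ 2 + d ^+ 2)^-1)%:E =
   (pi / 2)%:E * (d%:E)^-1)%E.
Proof.
have pos (b : R) : 0 < b -> (\int[lebesgue_measure]_(t in `]0%R, +oo[) ((t ^+ 2 + b ^+ 2)^-1)%:E =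
    (pi / 2 / b)%:E)%E.
  move=> b0; have bn : b != 0 by rewrite gt_eqF.
  have tb0 t : 0 < t ^+ 2 + b ^+ 2 by rewrite ltr_wpDl ?sqr_ge0// exprn_gt0.
  have cf : continuous (fun t : R => (t ^+ 2 + b ^+ 2)^-1).
    move=> t; apply: cvgV; first by rewrite gt_eqF.
    by apply: cvgD; [apply: exprn_continuous|exact: cvg_cst].
  have dF (t : R) : is_derive t 1 (fun t : R => atan (t * b^-1) * b^-1) ((t ^+ 2 + b ^+ 2)^-1).
    apply: is_derive_eq.
    rewrite /GRing.scale/= !mulr0 !add0r mulr1.
    have -> : 1 + (t / b) ^+ 2 = (t ^+ 2 + b ^+ 2) / b ^+ 2 by field.
    have := tb0 t; move: (t ^+ 2 + b ^+ 2) => X X0; rewrite invf_div.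
    by field; rewrite bn gt_eqF.
  rewrite integral_itv_obnd_cbnd; last first.
    by apply: measurable_funTS; apply/measurable_EFinP; exact: continuous_measurable_fun.
  rewrite (@ge0_continuous_FTC2y R _ (fun t : R => atan (t * b^-1) * b^-1) 0 (pi / 2 / b)).
  - by rewrite mul0r atan0 mul0r sube0.
  - by move=> t _; rewrite invr_ge0 ltW.
  - exact: continuous_subspaceT.
  - apply: cvgM; last exact: cvg_cst.
    apply: (@cvg_comp _ _ _ (fun t : R => t * b^-1) atan); last exact: cvgy_atan.
    by apply: gt0_cvgMly => //; rewrite invr_gt0.
  - by move=> t _; have [] := dF t.
  - by apply: cvg_at_right_filter; apply: is_derive_continuous (dF 0).
  - by move=> t _; rewrite derive1E; have [_ ->] := dF t.
rewrite le_eqVlt => /predU1P[<-|d0]; last first.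
  by rewrite pos// inver gt_eqF.
rewrite inve0 gt0_muley ?lte_fin ?divr_gt0 ?pi_gt0//.
apply/eqyP => A A0.
have Ab : 0 < pi / 2 / A :> R by rewrite !divr_gt0 ?pi_gt0.
have -> : A = pi / 2 / (pi / 2 / A).
  by rewrite invf_div mulrC divfK// gt_eqF// divr_gt0 ?pi_gt0.
rewrite -pos//; apply: ge0_le_integral => //=.
- by move=> t _; rewrite lee_fin invr_ge0 addr_ge0 ?sqr_ge0.
- by apply: measurable_funTS; mfun.
- by apply: measurable_funTS; mfun.
- move=> t; rewrite in_itv/= andbT => t0; rewrite lee_fin.
  by rewrite expr0n addr0 lef_pV2 ?posrE ?exprn_gt0 ?ltr_wpDl ?sqr_ge0 ?exprn_gt0// lerDl sqr_ge0.
Qed.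

(** An inequality between sums of integrals rather than between integrals of
    differences, as the integrals may be infinite. *)
Lemma le_ge0_integral3 d (T : measurableType d) (R : realType)
    (m : {measure set T -> \bar R}) (D : set T) (f1 f2 f3 g1 g2 : T -> \bar R) :
  measurable D -> measurable_fun D f1 -> measurable_fun D f2 -> measurable_fun D f3 ->
  measurable_fun D g1 -> measurable_fun D g2 ->
  (forall x, 0 <= f1 x)%E -> (forall x, 0 <= f2 x)%E -> (forall x, 0 <= f3 x)%E ->
  (forall x, 0 <= g1 x)%E -> (forall x, 0 <= g2 x)%E ->
  (forall x, D x -> f1 x + f2 x + f3 x <= g1 x + g2 x)%E ->
  (\int[m]_(x in D) f1 x + \int[m]_(x in D) f2 x + \int[m]_(x in D) f3 x <=
   \int[m]_(x in D) g1 x + \int[m]_(x in D) g2 x)%E.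
Proof.
move=> mD mf1 mf2 mf3 mg1 mg2 f10 f20 f30 g10 g20 h.
have m12 : measurable_fun D (fun x => f1 x + f2 x)%E by exact: emeasurable_funD.
rewrite -(ge0_integralD _ mD _ mf1 _ mf2)// -(ge0_integralD _ mD _ m12 _ mf3)//; last first.
  by move=> x _; rewrite adde_ge0.
rewrite -(ge0_integralD _ mD _ mg1 _ mg2)//.
apply: ge0_le_integral => //.
- by move=> x _; rewrite !adde_ge0.
- exact: emeasurable_funD.
- exact: emeasurable_funD.
Qed.

Section mutual_energy.
Context (R : realType).
Local Notation leb := (@lebesgue_measure R).

Definition mutual_energy (P Q : probability (R3 R) R) : \bar R :=
  (\int[P]_(x in S2) \int[Q]_(y in S2) ((dist3 x y)%:E)^-1)%E.

Let K (z : (R3 R * R3 R) * R) : \bar R :=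
  (if 0 < z.2 then cauchy_kernel z.2 z.1 else 0)%:E.

Let mK : measurable_fun setT K.
Proof.
rewrite /K /cauchy_kernel.
have mS : measurable_fun setT (fun z : (R3 R * R3 R) * R => S2xS2 z.1).
  exact: (measurableT_comp (@measurable_S2xS2 R) measurable_fst).
have := @measurable_dist3_pair R; rewrite /dist3 => _; mfun.
Qed.

Let S2xS2_ge0 (p : R3 R * R3 R) : 0 <= S2xS2 p.
Proof. by rewrite /S2xS2 !indicE mulr_ge0. Qed.

Lemma cauchy_kernel_ge0 (t : R) p : 0 <= cauchy_kernel t p.
Proof. by rewrite /cauchy_kernel mulr_ge0// invr_ge0 addr_ge0 ?sqr_ge0. Qed.

Let K0 z : (0 <= K z)%E.
Proof. by rewrite /K lee_fin; case: ifP => // _; exact: cauchy_kernel_ge0. Qed.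

Let kernelE (p : R3 R * R3 R) : (((dist3 p.1 p.2)%:E)^-1 * (S2xS2 p)%:E =
  (2 / pi)%:E * \int[leb]_t K (p, t))%E.
Proof.
have -> : (\int[leb]_t K (p, t) = \int[leb]_(t in `]0%R, +oo[) (cauchy_kernel t p)%:E)%E.
  rewrite [RHS]integral_mkcond; apply: eq_integral => t _.
  by rewrite patchE mem_setE in_itv/= andbT /K/=; case: ifP.
under eq_integral do rewrite /cauchy_kernel mulrC.
rewrite ge0_integralZ_EFin//; last 2 first.
- by apply: measurable_funTS; mfun.
- by move=> t _; rewrite invr_ge0 addr_ge0 ?sqr_ge0.
rewrite integral_inv_sqrDsqr ?dist3_ge0// [RHS]muleA -EFinM [RHS]muleA -EFinM.
have -> : 2 / pi * S2xS2 p * (pi / 2) = S2xS2 p.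
  by have := lt0r_neq0 (@pi_gt0 R); move: (@pi R) => P P0; field.
by rewrite muleC.
Qed.

Lemma mutual_energy_indic P Q : mutual_energy P Q =
  (\int[P]_x \int[Q]_y (((dist3 x y)%:E)^-1 * (S2xS2 (x, y))%:E))%E.
Proof.
rewrite /mutual_energy integral_mkcond; apply: eq_integral => x _; rewrite patchE.
under [in RHS]eq_integral do rewrite /S2xS2/= !indicE.
case: ifPn => xS; last first.
  by rewrite integral0_eq// => y _; rewrite mul0r mule0.
rewrite [LHS]integral_mkcond; apply: eq_integral => y _; rewrite patchE mul1r.
by case: ifPn => yS; rewrite ?mule1 ?mule0.
Qed.

Lemma mutual_energyC P Q : mutual_energy P Q = mutual_energy Q P.
Proof.
rewrite !mutual_energy_indic.
rewrite (@fubini_tonelli _ _ _ _ R P Q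
  (fun p => ((dist3 p.1 p.2)%:E)^-1 * (S2xS2 p)%:E)%E).
- apply: eq_integral => y _; apply: eq_integral => x _ /=.
  rewrite /S2xS2/= mulrC; congr (_ * _)%E; congr ((_%:E)^-1)%E.
  by rewrite /dist3 -(sqrrN (x.1.1 - _)) -(sqrrN (x.1.2 - _)) -(sqrrN (x.2 - _)) !opprB.
- apply: emeasurable_funM.
    by apply: measurable_inve; exact: measurable_dist3_pair.
  by apply/measurable_EFinP; exact: measurable_S2xS2.
- by move=> p; rewrite mule_ge0 ?lee_fin//; exact/inve_fin_ge0/dist3_ge0.
Qed.

Implicit Types (P Q : probability (R3 R) R) (t : R).

Let integral_cauchyE P Q t : 0 < t ->
  (\int[(P \x Q)%E]_p K (p, t) = (\int[(P \x Q)%E]_p cauchy_kernel t p)%:E)%E.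
Proof.
move=> t0; rewrite /K/= t0 /Rintegral fineK//; apply: integrable_fin_num => //.
apply: (@bounded_integrable _ _ _ (P \x Q)%E _ (t ^+ 2)^-1).
  exact: measurable_cauchy_kernel.
by move=> p; exact: cauchy_kernel_le.
Qed.

(** The Newtonian energy as a superposition of the energies of the bounded
    Cauchy kernels, by Tonelli. *)
Lemma mutual_energyE P Q : mutual_energy P Q =
  ((2 / pi)%:E * \int[leb]_(t in `]0%R, +oo[) (\int[(P \x Q)%E]_p cauchy_kernel t p)%:E)%E.
Proof.
rewrite mutual_energy_indic.
transitivity (\int[P]_x \int[Q]_y ((2 / pi)%:E * \int[leb]_t K ((x, y), t)))%E.
  by apply: eq_integral => x _; apply: eq_integral => y _; rewrite -kernelE.
have mG := @measurable_fun_fubini_tonelli_F _ _ _ _ R leb K mK K0.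
have G0 p : (0 <= \int[leb]_t K (p, t))%E by exact: integral_ge0.
pose G p := ((2 / pi)%:E * \int[leb]_t K (p, t))%E.
have c0 : 0 <= 2 / pi :> R by rewrite divr_ge0 ?pi_ge0.
have := @fubini_tonelli1 _ _ _ _ R P Q G.
rewrite /fubini_F => <-; last 2 first.
- by apply: emeasurable_funM.
- by move=> p; rewrite mule_ge0.
rewrite ge0_integralZl_EFin//; congr (_ * _)%E.
have -> := @fubini_tonelli _ _ _ _ R [the probability _ R of (P \x Q)%E] leb K mK K0.
rewrite [RHS]integral_mkcond; apply: eq_integral => t _.
rewrite patchE mem_setE in_itv/= andbT; case: ifPn => t0.
  by rewrite -integral_cauchyE.
by rewrite /K/= (negbTE t0) integral0.
Qed.

Let mI P Q : measurable_fun (`]0%R, +oo[ : set R)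
  (fun t => (\int[(P \x Q)%E]_p cauchy_kernel t p)%:E).
Proof.
have mG := @measurable_fun_fubini_tonelli_G _ _ _ _ R [the probability _ R of (P \x Q)%E] K mK K0.
apply: (eq_measurable_fun (fubini_G [the probability _ R of (P \x Q)%E] K)).
  by move=> t; rewrite inE/= in_itv/= andbT => t0; rewrite -integral_cauchyE.
exact: measurable_funTS.
Qed.

Let I0 P Q t : (0 <= (\int[(P \x Q)%E]_p cauchy_kernel t p)%:E)%E.
Proof. by rewrite lee_fin; apply: Rintegral_ge0 => p _; exact: cauchy_kernel_ge0. Qed.

(** Integrate [signed_energy_cauchy] in t.  The coefficient of the squared moment
    is at least 2^n / 3^(n+1) for t < 1, and is bounded below by 0
    elsewhere. *)
Lemma mutual_energy_gap P Q n e : e \in mons n ->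
  (mutual_energy P Q + mutual_energy P Q +
    (2 / pi * (2 ^+ n / 3 ^+ n.+1 * moment_gap P Q e ^+ 2))%:E <=
  mutual_energy P P + mutual_energy Q Q)%E.
Proof.
move=> en; rewrite [X in (_ + X + _)%E]mutual_energyC; set k := 2 / pi.
pose J P' Q' := (\int[leb]_(t in `]0%R, +oo[) (\int[(P' \x Q')%E]_p cauchy_kernel t p)%:E)%E.
have ME P' Q' : mutual_energy P' Q' = (k%:E * J P' Q')%E by exact: mutual_energyE.
have J0 P' Q' : (0 <= J P' Q')%E by apply: integral_ge0 => t _; exact: I0.
have c0 : 0 <= k by rewrite divr_ge0 ?pi_ge0.
set c := _ / _ * _ ^+ 2; rewrite EFinM; have cg0 : 0 <= c.
  by rewrite /c mulr_ge0 ?sqr_ge0// divr_ge0 ?exprn_ge0.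
pose low (t : R) := (c * \1_(`]0%R, 1%R[%classic) t)%:E.
have lowE : c%:E = (\int[leb]_(t in `]0%R, +oo[) low t)%E.
  rewrite /low; under eq_integral do rewrite EFinM.
  rewrite ge0_integralZl_EFin//; last by apply/measurable_EFinP; exact: measurable_indic.
  rewrite integral_indic// setIidl; last first.
    by move=> t /=; rewrite !in_itv/= andbT => /andP[].
  have L1 : leb `]0%R, 1%R[ = 1%E by rewrite lebesgue_measure_itv/= lte01 sube0.
  by rewrite [X in (_ * X)%E]L1 mule1.
have mlow : measurable_fun (`]0%R, +oo[ : set R) low.
  by apply: measurable_funTS; apply/measurable_EFinP; apply: measurable_funM => //; exact: measurable_indic.
have low0 t : (0 <= low t)%E by rewrite lee_fin mulr_ge0.
have scale (a b l x y : \bar R) : (0 <= a -> 0 <= b -> 0 <= l -> 0 <= x -> 0 <= y ->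
    a + b + l <= x + y ->
    k%:E * a + k%:E * b + k%:E * l <= k%:E * x + k%:E * y)%E.
  move=> a0 b0 l0 x0 y0 h.
  rewrite -[X in (X + _ <= _)%E]ge0_muleDr// -[leLHS]ge0_muleDr ?adde_ge0// -[leRHS]ge0_muleDr//.
  by apply: lee_wpmul2l; rewrite ?lee_fin.
rewrite !ME lowE; apply: scale => //; first exact: integral_ge0.
rewrite /J; apply: le_ge0_integral3; [exact: measurable_itv|exact: mI|exact: mI|exact: mlow|exact: mI|exact: mI|by []|by []|by []|by []|by []|].
move=> t; rewrite /= in_itv/= andbT => t0.
  rewrite -!EFinD lee_fin.
  have := signed_energy_cauchy P Q t0 en; rewrite /signed_energy => h.
  rewrite -lerBrDl; apply: le_trans h.
  rewrite indicE; have [|_] := boolP (t \in _); last first.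
    by rewrite mulr0 mulr_ge0 ?sqr_ge0// divr_ge0 ?exprn_ge0// addr_ge0 ?sqr_ge0.
  rewrite inE/= in_itv/= => /andP[_ t1]; rewrite mulr1 /c ler_wpM2r ?sqr_ge0//.
  apply: ler_pM; rewrite ?invr_ge0 ?exprn_ge0//.
  have t2 : 0 < t ^+ 2 + 2 by rewrite ltr_wpDl ?sqr_ge0.
  have t3 : t ^+ 2 + 2 <= 3.
    have : t ^+ 2 <= 1 by apply: exprn_ile1; exact: ltW.
    move: (t ^+ 2) => T; lra.
  rewrite lef_pV2 ?posrE ?exprn_gt0//.
  by rewrite lerXn2r// nnegrE ltW.
Qed.

End mutual_energy.

(** * Octants determine a measure *)

Section octants.
Context (R : realType).

Definition octant (c : R3 R) : set (R3 R) :=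
  [set x | [/\ x.1.1 < c.1.1, x.1.2 < c.1.2 & x.2 < c.2]].

Let octants : set (set (R3 R)) := range octant.

Let octantI (c d : R3 R) : octant c `&` octant d =
  octant (Num.min c.1.1 d.1.1, Num.min c.1.2 d.1.2, Num.min c.2 d.2).
Proof.
apply/seteqP; split => x /=.
  by move=> [[h1 h2 h3] [k1 k2 k3]]; split; rewrite lt_min; apply/andP.
by move=> [] /=; rewrite !lt_min => /andP[? ?] /andP[? ?] /andP[? ?].
Qed.

Let bigcup_octant (x : R3 R) : exists n : nat, octant (n%:R, n%:R, n%:R) x.
Proof.
pose M := `|x.1.1| + `|x.1.2| + `|x.2|.
exists (Num.trunc M).+1; have M0 : 0 <= M by rewrite !addr_ge0.
have hM : M < (Num.trunc M).+1%:R by exact: truncnS_gt.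
have h1 := ler_norm x.1.1; have h2 := ler_norm x.1.2; have h3 := ler_norm x.2.
have g1 := normr_ge0 x.1.1; have g2 := normr_ge0 x.1.2; have g3 := normr_ge0 x.2.
by split => /=; apply: le_lt_trans hM; rewrite /M; lra.
Qed.

(** The identity from the sigma-algebra of the octants to R^3 has measurable
    coordinates, because a half-space x_i < c is the union of the octants whose
    other two bounds are equal to an integer. *)
Lemma measurable_octants : (measurable : set (set (R3 R))) = <<s octants >>.
Proof.
apply/seteqP; split; last first.
  apply: smallest_sub; first exact: sigma_algebra_measurable.
  move=> _ [c _ <-].
  rewrite (_ : octant c = (`]-oo, c.1.1[ `*` `]-oo, c.1.2[) `*` `]-oo, c.2[).
    by apply: measurableX; [apply: measurableX|].
  by apply/seteqP; split => x /=; rewrite !in_itv/=; [move=> []|move=> [[]]].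
pose T := g_sigma_algebraType octants.
have mc (f : T -> R) (o : R -> nat -> R3 R) :
    (forall c x, f x < c <-> exists n, octant (o c n) x) -> measurable_fun setT f.
  move=> fo; apply: (measurability _ (RGenInftyO.measurableE R)).
  move=> _ [_ [c ->] <-]; rewrite setTI.
  have -> : f @^-1` `]-oo, c[%classic = \bigcup_n (octant (o c n) : set T).
    apply/seteqP; split => x /=; rewrite in_itv/=.
      by move/fo => [n ?]; exists n.
    by move=> [n _ ?]; apply/fo; exists n.
  by apply: bigcup_measurable => n _; apply: sub_sigma_algebra; exists (o c n).
have m1 : measurable_fun setT (fun x : T => x.1.1 : R).
  apply: (mc _ (fun c n => (c, n%:R, n%:R))) => c x; split => [xc|[n []]//].
  by have [n [_ ? ?]] := bigcup_octant x; exists n.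
have m2 : measurable_fun setT (fun x : T => x.1.2 : R).
  apply: (mc _ (fun c n => (n%:R, c, n%:R))) => c x; split => [xc|[n []]//].
  by have [n [? _ ?]] := bigcup_octant x; exists n.
have m3 : measurable_fun setT (fun x : T => x.2 : R).
  apply: (mc _ (fun c n => (n%:R, n%:R, c))) => c x; split => [xc|[n []]//].
  by have [n [? ? _]] := bigcup_octant x; exists n.
have mid : measurable_fun setT (fun x : T => (x.1.1, x.1.2, x.2) : R3 R).
  by apply: measurable_fun_pair => //; apply: measurable_fun_pair.
move=> A mA; have := mid measurableT A mA.
rewrite setTI (_ : _ @^-1` A = A)//.
by apply/seteqP; split => -[[? ?] ?].
Qed.

Lemma eq_measure_octants (m1 m2 : probability (R3 R) R) :
  (forall c, m1 (octant c) = m2 (octant c)) ->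
  forall A, measurable A -> m1 A = m2 A.
Proof.
move=> m12; apply: (measure_unique octants (fun n => octant (n%:R, n%:R, n%:R)) measurable_octants).
- by move=> _ _ [c _ <-] [d _ <-]; rewrite octantI; eexists.
- by move=> n; eexists.
- apply/seteqP; split => // x _; have [n ?] := bigcup_octant x; by exists n.
- by move=> _ [c _ <-]; exact: m12.
- move=> n; apply: le_lt_trans (_ : m1 setT < +oo)%E; last first.
    by rewrite [X in (X < _)%E]probability_setT ltry.
  apply: le_measure; rewrite ?inE//.
  by rewrite measurable_octants; apply: sub_sigma_algebra; eexists.
Qed.
End octants.

(** * Polynomial approximation of a step *)

Section step.
Context (R : realType).

Lemma bernoulli (y : R) k : -1 <= y -> 1 + k%:R * y <= (1 + y) ^+ k.
Proof.
move=> y1; elim: k => [|k IH]; first by rewrite mul0r addr0 expr0.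
rewrite exprS; apply: le_trans (_ : (1 + y) * (1 + k%:R * y) <= _); last first.
  by rewrite ler_wpM2l//; lra.
have := sqr_ge0 y; have k0 : 0 <= k%:R :> R by [].
move=> yy; have := mulr_ge0 k0 yy.
by rewrite -natr1; lra.
Qed.

(** From (1 - y)^k (1 + y)^k <= 1 and Bernoulli's inequality. *)
Lemma bernoulliV (y : R) k : 0 <= y -> y <= 1 -> (1 - y) ^+ k <= (1 + k%:R * y)^-1.
Proof.
move=> y0 y1; have h : 0 < 1 + k%:R * y by rewrite ltr_wpDr// mulr_ge0.
rewrite -[leRHS]mul1r ler_pdivlMr//.
apply: le_trans (_ : (1 - y) ^+ k * (1 + y) ^+ k <= _).
  by rewrite ler_wpM2l ?exprn_ge0 ?subr_ge0// bernoulli//; lra.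
rewrite -exprMn exprn_ile1//; first by rewrite mulr_ge0; lra.
have := sqr_ge0 y; lra.
Qed.

(** With s = sqrt r, [bernoulliV] bounds n s^n by 1 / (1 - s), and the remaining
    factor s^n tends to 0. *)
Lemma cvg_natmul_expr (r : R) : 0 <= r -> r < 1 -> (fun n => n%:R * r ^+ n) @ \oo --> (0 : R).
Proof.
move=> r0 r1; set s := Num.sqrt r.
have s0 : 0 <= s by exact: sqrtr_ge0.
have s1 : s < 1 by rewrite -sqrtr1 ltr_sqrt.
have rs : r = s * s by rewrite -expr2 sqr_sqrtr.
have d0 : 0 < 1 - s by rewrite subr_gt0.
apply: (@squeeze_cvgr _ _ _ _ (fun=> 0) (fun n => s ^+ n * (1 - s)^-1)).
- apply: nearW => n; rewrite mulr_ge0 ?exprn_ge0//=.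
  rewrite rs exprMn mulrA [n%:R * _]mulrC -mulrA; apply: ler_wpM2l; first exact: exprn_ge0.
  have := @bernoulliV (1 - s) n (ltW d0); rewrite subKr gerBl s0 => /(_ isT) h.
  have n0 : 0 <= n%:R :> R by [].
  apply: le_trans (ler_wpM2l n0 h) _.
  have h' : 0 < 1 + n%:R * (1 - s) by rewrite ltr_wpDr// mulr_ge0// ltW.
  by rewrite ler_pdivrMr// mulrC ler_pdivlMr// lerDr.
- exact: cvg_cst.
- rewrite -[X in _ --> X](mul0r (1 - s)^-1); apply: cvgM; last exact: cvg_cst.
  by apply: cvg_expr; rewrite ger0_norm.
Qed.

(** The exponent is chosen so that its product with t^n is n (2 t)^n, which tends
    to 0 or to +oo according as t < 1/2 or not; the value n at t = 1/2 is
    covered by the second case. *)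
Definition step_fun (n : nat) (t : R) : R := (1 - t ^+ n) ^+ (n * 2 ^ n).

Lemma step_fun_cvg t : 0 <= t -> t <= 1 ->
  (fun n => step_fun n t) @ \oo --> (((t < 2^-1)%R : nat)%:R : R).
Proof.
move=> t0 t1; have tn n : 0 <= t ^+ n <= 1 by rewrite exprn_ge0 ?exprn_ile1.
have kE n : (n * 2 ^ n)%:R * t ^+ n = n%:R * (2 * t) ^+ n.
  by rewrite natrM natrX exprMn; ring.
have [th|th] := ltP t 2^-1.
  apply: (@squeeze_cvgr _ _ _ _ (fun n => 1 - n%:R * (2 * t) ^+ n) (fun=> 1)).
  - apply: nearW => n; have /andP[a b] := tn n; apply/andP; split; last first.
      by rewrite exprn_ile1 ?subr_ge0// lerBlDr lerDl.
    have := @bernoulli (- t ^+ n) (n * 2 ^ n).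
    by rewrite mulrN kE lerN2; apply.
  - rewrite -[X in _ --> X]subr0; apply: cvgB; first exact: cvg_cst.
    by apply: cvg_natmul_expr; [rewrite mulr_ge0|lra].
  - exact: cvg_cst.
apply: (@squeeze_cvgr _ _ _ _ (fun=> 0) (fun n => (n.+1)%:R^-1)).
- apply: nearW => n; have /andP[a b] := tn n; apply/andP; split.
    by rewrite exprn_ge0// subr_ge0.
  apply: le_trans (bernoulliV _ a b) _.
  have h : 1 <= (2 * t) ^+ n by rewrite exprn_ege1//; lra.
  have n0 : 0 <= n%:R :> R by [].
  have p0 : 0 < 1 + n%:R * (2 * t) ^+ n.
    by rewrite ltr_wpDr// mulr_ge0// (le_trans _ h).
  by rewrite kE lef_pV2 ?posrE// -natr1 addrC lerD2l ler_peMr.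
- exact: cvg_cst.
- exact: cvg_harmonic.
Qed.
End step.

(** * Moments determine a measure on the sphere *)

Section moments.
Context (R : realType).

Lemma on_sphere_setC (mu : probability (R3 R) R) : on_sphere mu -> mu (~` S2) = 0%E.
Proof.
move=> h; rewrite probability_setC ?h ?subee//; exact: measurable_S2.
Qed.

Lemma on_sphere_setI (mu : probability (R3 R) R) A : on_sphere mu -> measurable A ->
  mu A = mu (A `&` S2).
Proof.
move=> h mA; have mS := @measurable_S2 R.
rewrite (measureDI mu mA mS) addeC -[RHS]adde0; congr (_ + _)%E.
apply/eqP; rewrite eq_le measure_ge0 andbT -(on_sphere_setC h).
apply: le_measure; rewrite ?inE; [exact: measurableD|exact: measurableC|by move=> x []].
Qed.

(** [step_fun] after the affine map that sends [c] to 1/2 and [-1, 1] into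
    [0, 1]. *)
Definition step_poly (c : R) (n : nat) : {poly R} :=
  let L := `|c| + 1 in
  (1 - ((2 * L)^-1 *: ('X - (c - L)%:P)) ^+ n) ^+ (n * 2 ^ n).

Lemma step_poly_range (c x : R) : `|x| <= 1 ->
  let t := (2 * (`|c| + 1))^-1 * (x - (c - (`|c| + 1))) in
  [/\ 0 <= t, t <= 1, (t < 2^-1) = (x < c) & forall n, (step_poly c n).[x] = step_fun n t].
Proof.
move=> x1 t; have L0 : 0 < `|c| + 1 by rewrite ltr_wpDl.
have := ler_norm c; have := lerNnormlW (lexx `|c|) => c1 c2.
have /andP[x2 x3] : -1 <= x <= 1 by rewrite -ler_norml.
have tE : t = (x - (c - (`|c| + 1))) / (2 * (`|c| + 1)) by rewrite mulrC.
split.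
- by rewrite tE divr_ge0//; lra.
- by rewrite tE ler_pdivrMr ?mulr_gt0//; lra.
- rewrite tE ltr_pdivrMr ?mulr_gt0// mulrA mulVf// mul1r.
  by rewrite opprB addrA [x + _]addrC -addrA gtrDl subr_lt0.
- by move=> n; rewrite /step_poly /step_fun !hornerE.
Qed.

Context (mu nu : probability (R3 R) R).
Context (muS : on_sphere mu) (nuS : on_sphere nu)
  (mom : forall e, moment_gap mu nu e = 0).

Let good (f : R3 R -> R) := [/\ measurable_fun setT f, exists M, forall x, `|f x| <= M &
  \int[mu]_x f x = \int[nu]_x f x].

Let good_mon e : good (monS e).
Proof.
split; first exact: measurable_monS.
  by exists 1; exact: monS_le1.
by apply/eqP; rewrite -subr_eq0; apply/eqP; exact: (mom e).
Qed.

Let goodD f g : good f -> good g -> good (fun x => f x + g x).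
Proof.
move=> [mf [M fM] If] [mg [N gN] Ig]; split; first exact: measurable_funD.
  by exists (M + N) => x; apply: le_trans (ler_normD _ _) _; rewrite lerD.
by rewrite !RintegralD// ?If ?Ig//; [exact: (bounded_integrable nu mf fM)|
  exact: (bounded_integrable nu mg gN)|exact: (bounded_integrable mu mf fM)|
  exact: (bounded_integrable mu mg gN)].
Qed.

Let goodZ k f : good f -> good (fun x => k * f x).
Proof.
move=> [mf [M fM] If]; split; first exact: measurable_funM.
  by exists (`|k| * M) => x; rewrite normrM ler_wpM2l.
by rewrite !RintegralZl// ?If//; [exact: (bounded_integrable nu mf fM)|
  exact: (bounded_integrable mu mf fM)].
Qed.

Let good_sum n (f : nat -> R3 R -> R) : (forall i, good (f i)) -> good (fun x => \sum_(i < n) f i x).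
Proof.
move=> gf; elim: n => [|n IH].
  under [X in good X]eq_fun do rewrite big_ord0.
  have := goodZ 0 (good_mon (0%N, 0%N, 0%N)).
  by under [X in good X]eq_fun do rewrite mul0r.
under [X in good X]eq_fun do rewrite big_ord_recr.
exact: goodD.
Qed.

Let good_poly (p q r : {poly R}) :
  good (fun x => p.[x.1.1] * q.[x.1.2] * r.[x.2] * \1_S2 x).
Proof.
have -> : (fun x : R3 R => p.[x.1.1] * q.[x.1.2] * r.[x.2] * \1_S2 x) =
  (fun x => \sum_(i < size p) \sum_(j < size q) \sum_(k < size r)
    p`_i * (q`_j * (r`_k * monS (val i, val j, val k) x))).
  apply/funext => x; rewrite !horner_coef !mulr_suml; apply: eq_bigr => i _.
  rewrite [_ * \sum_(j < size q) _]mulr_sumr !mulr_suml; apply: eq_bigr => j _.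
  rewrite [_ * \sum_(k < size r) _]mulr_sumr mulr_suml; apply: eq_bigr => k _.
  by rewrite /monS /mon/=; ring.
apply: (@good_sum _ (fun i x => \sum_(j < size q) \sum_(k < size r)
    p`_i * (q`_j * (r`_k * monS (i, val j, val k) x)))) => i.
apply: (@good_sum _ (fun j x => \sum_(k < size r)
    p`_i * (q`_j * (r`_k * monS (i, j, val k) x)))) => j.
apply: (@good_sum _ (fun k x => 
    p`_i * (q`_j * (r`_k * monS (i, j, k) x)))) => k.
by apply: goodZ; apply: goodZ; apply: goodZ; exact: good_mon.
Qed.

(** Products of step polynomials in the three coordinates converge to the
    indicator of an octant while staying bounded by 1 on the sphere; their
    integrals are combinations of moments, so dominated convergence shows that
    the two measures agree on octants. *)
Lemma moments_eq_measure A : measurable A -> mu A = nu A.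
Proof.
apply: eq_measure_octants => c.
have mO : measurable (octant c) by rewrite measurable_octants; apply: sub_sigma_algebra; exists c.
have mS := @measurable_S2 R.
rewrite (on_sphere_setI muS mO) (on_sphere_setI nuS mO).
have mOS : measurable (octant c `&` S2) by exact: measurableI.
pose f n (x : R3 R) := (step_poly c.1.1 n).[x.1.1] * (step_poly c.1.2 n).[x.1.2] *
  (step_poly c.2 n).[x.2] * \1_S2 x.
have gf n : good (f n) by exact: good_poly.
have f1 n x : `|f n x| <= 1.
  rewrite /f indicE; have [|] := boolP (x \in S2); last by rewrite mulr0 normr0.
  rewrite inE mulr1 => /S2_coord[/(step_poly_range c.1.1)[a1 a2 _ ->]].
  move=> /(step_poly_range c.1.2)[b1 b2 _ ->] /(step_poly_range c.2)[d1 d2 _ ->].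
  have st t : 0 <= t -> t <= 1 -> `|step_fun n t| <= 1 :> R.
    move=> t0 t1; have tn : 0 <= 1 - t ^+ n by rewrite subr_ge0 exprn_ile1.
    rewrite /step_fun ger0_norm ?exprn_ge0// exprn_ile1// lerBlDr lerDl exprn_ge0//.
  by rewrite !normrM !mulr_ile1 ?mulr_ge0 ?st.
have fc x : (fun n => f n x) @ \oo --> (\1_(octant c `&` S2) x : R).
  rewrite /f indicI/= !indicE.
  have [|] := boolP (x \in S2); last first.
    by move=> _; rewrite mulr0; under eq_fun do rewrite mulr0; exact: cvg_cst.
  rewrite inE [X in _ --> X]mulr1 => /S2_coord[/(step_poly_range c.1.1)[a1 a2 a3 a4]].
  move=> /(step_poly_range c.1.2)[b1 b2 b3 b4] /(step_poly_range c.2)[d1 d2 d3 d4].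
  under eq_fun do rewrite a4 b4 d4 mulr1.
  have -> : (x \in octant c)%:R = ((x.1.1 < c.1.1)%R : nat)%:R *
    ((x.1.2 < c.1.2)%R : nat)%:R * ((x.2 < c.2)%R : nat)%:R :> R.
    rewrite -!natrM !mulnb; congr (_%:R); congr (nat_of_bool _).
    by apply/idP/idP; rewrite inE /octant/=; [move=> [-> -> ->]|move=> /andP[/andP[]]].
  rewrite -a3 -b3 -d3.
  by apply: cvgM; [apply: cvgM|]; exact: step_fun_cvg.
have lim (P : probability (R3 R) R) :
    (fun n => \int[P]_x (f n x)%:E)%E @ \oo --> P (octant c `&` S2).
  have -> : P (octant c `&` S2) = (\int[P]_x (\1_(octant c `&` S2) x)%:E)%E.
    by rewrite integral_indic// setIT.
  apply: (@dominated_cvg _ _ _ P setT _ _ _ (cst 1%E)) => //.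
  - by move=> n; apply/measurable_EFinP; have [] := gf n.
  - by move=> x _; apply/fine_cvgP; split; [exact: nearW|exact: fc].
  - by apply: (@bounded_integrable _ _ _ P (cst 1) 1) => // x; rewrite normr1.
  - by move=> n x _; rewrite lee_fin.
have E n : (\int[mu]_x (f n x)%:E = \int[nu]_x (f n x)%:E)%E.
  have [mf [M fM]] := gf n; rewrite /Rintegral => h.
  have fin (P : probability (R3 R) R) : (\int[P]_x (f n x)%:E)%E \is a fin_num.
    apply: integrable_fin_num => //; exact: (bounded_integrable P mf fM).
  by rewrite -(fineK (fin mu)) -(fineK (fin nu)); congr EFin.
have Lm := lim mu; have Ln := lim nu.
rewrite (_ : (fun n => _) = (fun n => \int[nu]_x (f n x)%:E)%E) in Lm; last exact/funext.
exact: cvg_unique Lm Ln.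
Qed.

End moments.

(** * Minimality and uniqueness *)

(** Here [m] is the mutual energy of mu and mu0, [e] and [e0] are their own
    energies, and [w] and [w0] the integrals of the field.  As e0 + w0 is finite,
    an infinite value can only occur in the right-hand side. *)
Lemma energy_convexity (R : realType) (F g : R) (m w w0 e e0 : \bar R) :
  (F%:E <= m + w -> m + m + g%:E <= e + e0 -> e0 + w0 = F%:E ->
   0 <= e0 -> 0 <= w0 -> 0 <= m -> 0 <= w -> 0 <= e ->
   e0 + 2%:E * w0 + g%:E <= e + 2%:E * w)%E.
Proof.
case: e0 => [e0| |]; case: w0 => [w0| |] //.
case: w => [w| |] //; last first.
  by case: e => [e| |] // *; rewrite gt0_muley ?lte_fin// addey ?leey.
case: e => [e| |] //; last by move=> *; rewrite -EFinM addye ?leey.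
case: m => [m| |] //; rewrite -!EFinD -?EFinM -?EFinD !lee_fin => h1 h2 [h3] *.
lra.
Qed.

Section variational.
Context (R : realType) (alpha kappa : R).
Context (aI : 0 < alpha < pi) (k0 : 0 < kappa)
  (mass : kappa * (sin alpha + cos alpha * (pi - alpha)) * (2 * pi) = 1).
Local Notation leb := (@lebesgue_measure R).
Local Notation mu0 := (cap_probability aI (ltW k0) mass).
Let F : R := 2 * pi ^+ 2 * kappa.
Let q : R := F * (1 - cos alpha).
Local Notation Q := (point_charge_field q).
Implicit Types mu : probability (R3 R) R.

Let q0 : 0 <= q.
Proof.
have /andP[_ c1] := cos_itvoo aI.
by rewrite /q /F !mulr_ge0 ?exprn_ge0 ?pi_ge0 ?subr_ge0 ?ltW.
Qed.

Lemma eq_integral_cap_probability (g h : R3 R -> \bar R) :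
  measurable_fun setT g -> measurable_fun setT h ->
  (forall x, 0 <= g x)%E -> (forall x, 0 <= h x)%E ->
  (forall theta phi, alpha < phi < pi -> g (spherical theta phi) = h (spherical theta phi)) ->
  (\int[mu0]_x g x = \int[mu0]_x h x)%E.
Proof.
move=> mg mh g0 h0 gh; rewrite !integral_cap_probability//.
apply: eq_integral => phi; rewrite inE/= in_itv/= => pI; congr (_ * _)%E.
by apply: eq_integral => theta _; exact: gh.
Qed.

Lemma on_sphere_cap_probability : on_sphere mu0.
Proof.
have mS := @measurable_S2 R; rewrite /on_sphere.
have -> : mu0 S2 = (\int[mu0]_x (\1_S2 x)%:E)%E by rewrite integral_indic// setIT.
rewrite (eq_integral_cap_probability _ (h := cst 1%E))//.
- rewrite integral_cst// mul1e; exact: probability_setT.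
- by apply/measurable_EFinP; exact: measurable_indic.
- by move=> theta phi _; rewrite indicE mem_set//; exact: spherical_S2.
Qed.

Lemma integral_on_sphere mu (g : R3 R -> \bar R) : on_sphere mu ->
  measurable_fun setT g -> (forall x, 0 <= g x)%E ->
  (\int[mu]_(x in S2) g x = \int[mu]_x g x)%E.
Proof.
move=> muS mg g0; have mS := @measurable_S2 R.
rewrite [RHS](@ge0_negligible_integral _ _ _ mu setT (~` S2))//.
- by rewrite setTD setCK.
- exact: measurableC.
- exact: on_sphere_setC.
Qed.

Let k2 (p : R3 R * R3 R) : \bar R := (((dist3 p.1 p.2)%:E)^-1)%E.

Let mk2 : measurable_fun setT k2.
Proof. by apply: measurable_inve; exact: measurable_dist3_pair. Qed.

Let k20 p : (0 <= k2 p)%E. Proof. exact/inve_fin_ge0/dist3_ge0. Qed.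

Let mk x : measurable_fun setT (fun y : R3 R => ((dist3 x y)%:E)^-1)%E.
Proof. by apply: measurable_inve; apply: measurable_dist3. Qed.

Let U (x : R3 R) : \bar R := (\int[mu0]_y ((dist3 x y)%:E)^-1)%E.

Let mU : measurable_fun setT U.
Proof. exact: (@measurable_fun_fubini_tonelli_F _ _ _ _ R mu0 k2 mk2 k20). Qed.

Let U0 x : (0 <= U x)%E.
Proof. by apply: integral_ge0 => y _; exact: (k20 (x, y)). Qed.

Let mQ : measurable_fun setT (Q : R3 R -> \bar R).
Proof.
apply: emeasurable_funM => //; apply: measurable_inve.
by have := @measurable_dist3_pair R; rewrite /dist3 => _; mfun.
Qed.

Let Q0 (x : R3 R) : (0 <= Q x)%E.
Proof. by rewrite mule_ge0 ?lee_fin//; exact/inve_fin_ge0/dist3_ge0. Qed.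

Let mutual_cap mu : mutual_energy mu mu0 = (\int[mu]_(x in S2) U x)%E.
Proof.
apply: eq_integral => x _; rewrite integral_on_sphere//; first exact: on_sphere_cap_probability.
by move=> y; exact: (k20 (x, y)).
Qed.

Let W mu : \bar R := (\int[mu]_(x in S2) Q x)%E.

Let W0 mu : (0 <= W mu)%E. Proof. by apply: integral_ge0 => x _; exact: Q0. Qed.

Lemma mutual_energy_ge0 mu nu : (0 <= mutual_energy mu nu)%E.
Proof. by apply: integral_ge0 => x _; apply: integral_ge0 => y _; exact: (k20 (x, y)). Qed.

Let mutual_W mu : (mutual_energy mu mu0 + W mu = \int[mu]_(x in S2) (U x + Q x))%E.
Proof.
rewrite mutual_cap /W [RHS](ge0_integralD _ (@measurable_S2 R))//; exact: measurable_funTS.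
Qed.

Let frostman_ge mu : on_sphere mu -> (F%:E <= mutual_energy mu mu0 + W mu)%E.
Proof.
move=> muS; rewrite mutual_W.
have -> : F%:E = (\int[mu]_(x in S2) (cst F%:E x))%E.
  rewrite (integral_cst _ (@measurable_S2 R)).
  by rewrite [X in (_ * X)%E](muS : mu S2 = 1%E) mule1.
apply: ge0_le_integral => //.
- exact: measurable_S2.
- by move=> x _; rewrite lee_fin /F !mulr_ge0 ?exprn_ge0 ?pi_ge0 ?ltW.
- by apply: measurable_funTS; exact: emeasurable_funD.
- by move=> x xS; have [] := frostman aI k0 mass xS.
Qed.

Let frostman_eq : (energy mu0 + W mu0 = F%:E)%E.
Proof.
rewrite -[energy mu0]/(mutual_energy mu0 mu0) mutual_W.
rewrite integral_on_sphere; [|exact: on_sphere_cap_probability|exact: emeasurable_funD|].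
  rewrite (eq_integral_cap_probability _ (h := cst F%:E))//.
  - rewrite integral_cst// [X in (_ * X)%E](@probability_setT _ _ _ mu0) mule1//.
  - exact: emeasurable_funD.
  - by move=> x; rewrite adde_ge0.
  - by move=> x; rewrite lee_fin /F !mulr_ge0 ?exprn_ge0 ?pi_ge0 ?ltW.
  - move=> theta phi /andP[ap ppi]; have [_] := frostman aI k0 mass (spherical_S2 theta phi).
    apply; rewrite /=; have /andP[a0 api] := aI.
    by rewrite leNgt ltr_cos ?in_itv/= -?leNgt ?ltW// (lt_trans a0).
by move=> x; rewrite adde_ge0.
Qed.

Lemma weighted_energy_cap_fin : weighted_energy Q mu0 \is a fin_num.
Proof.
have E0 := mutual_energy_ge0 mu0 mu0; have := frostman_eq; have := W0 mu0.
rewrite /weighted_energy -/(W mu0) /=; move: (W mu0) E0 => w; rewrite -[mutual_energy _ _]/(energy mu0).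
by case: (energy mu0) => [e| |]; case: w.
Qed.

(** The Frostman inequality integrated against mu gives F <= m + w, its equality
    case integrated against mu0 gives e0 + w0 = F, in the notation of
    [energy_convexity]. *)
Lemma weighted_energy_gap mu n e : on_sphere mu -> e \in mons n ->
  (weighted_energy Q mu0 +
    (2 / pi * (2 ^+ n / 3 ^+ n.+1 * moment_gap mu mu0 e ^+ 2))%R%:E <=
   weighted_energy Q mu)%E.
Proof.
move=> muS en; have h1 := frostman_ge muS; have h2 := mutual_energy_gap mu mu0 en.
have h3 := frostman_eq.
have e0 := mutual_energy_ge0 mu0 mu0; have w0 := W0 mu0.
have m0 := mutual_energy_ge0 mu mu0; have wm := W0 mu; have em := mutual_energy_ge0 mu mu.
rewrite /weighted_energy -/(W mu0) -/(W mu).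
rewrite -![energy _]/(mutual_energy _ _) in h3 *.
move: h1 h2 h3 e0 w0 m0 wm em.
exact: energy_convexity.
Qed.

Lemma min_energy_cap : min_energy Q = weighted_energy Q mu0.
Proof.
apply/eqP; rewrite eq_le; apply/andP; split.
  by apply: ereal_inf_lbound; exists mu0 => //; exact: on_sphere_cap_probability.
apply: le_ereal_inf_tmp => _ [mu muS <-].
apply: le_trans (weighted_energy_gap muS (mem_mons 0 0 0)).
rewrite leeDl// lee_fin mulr_ge0 ?divr_ge0 ?pi_ge0// mulr_ge0 ?sqr_ge0//.
Qed.

Lemma extremal_cap_probability : extremal Q mu0.
Proof. by split; [exact: on_sphere_cap_probability|rewrite min_energy_cap]. Qed.

(** For an extremal measure the gap in [weighted_energy_gap] is zero for every
    exponent, so all moments agree. *)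
Lemma extremal_eq_cap mu A : extremal Q mu -> measurable A -> mu A = mu0 A.
Proof.
move=> [muS muE]; apply: moments_eq_measure => //; first exact: on_sphere_cap_probability.
move=> [[i j] k]; have := weighted_energy_gap muS (mem_mons i j k).
rewrite muE min_energy_cap -[leRHS]adde0 leeD2lE ?weighted_energy_cap_fin// lee_fin => h.
apply/eqP; rewrite -sqrf_eq0 eq_le sqr_ge0 andbT.
have c0 : 0 < 2 / pi * (2 ^+ (i + j + k) / 3 ^+ (i + j + k).+1) :> R.
  by rewrite mulr_gt0 ?divr_gt0 ?pi_gt0 ?exprn_gt0.
by move: h; rewrite mulrA (pmulr_rle0 _ c0).
Qed.

End variational.

(** * The density *)

Section density_support.
Context (R : realType) (alpha kappa q : R).
Context (aI : 0 < alpha < pi) (k0 : 0 < kappa)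
  (mass : kappa * (sin alpha + cos alpha * (pi - alpha)) * (2 * pi) = 1)
  (qE : q = 2 * pi ^+ 2 * kappa * (1 - cos alpha)).
Local Notation leb := (@lebesgue_measure R).
Local Notation mu0 := (cap_probability aI (ltW k0) mass).

(** With s as in [cap_density], the two square roots in [cap_primitive] are
    s^-1 and s (c - a); the relation between atan s and
    atan s^-1 accounts for the constant term of the density. *)
Lemma cap_density_core phi : alpha < phi < pi ->
  cap_density q alpha phi = kappa * cap_core alpha phi.
Proof.
move=> /andP[aphi phipi]; have /andP[a0 api] := aI.
have ca : cos phi < cos alpha.
  by rewrite ltr_cos// in_itv/= ?ltW// (lt_trans a0).
have /andP[_ c1] := cos_itvoo aI.
have sa : 0 < sin alpha by exact: sin_gt0_pi.
set c := cos alpha in ca c1 *; set a := cos phi in ca *.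
have d0 : 0 < c - a by rewrite subr_gt0.
have d1 : 0 < 1 - c by rewrite subr_gt0.
have da : 0 < 1 - a by rewrite subr_gt0 (lt_trans ca).
set s := Num.sqrt ((1 - c) / (c - a)).
have s0 : 0 < s by rewrite sqrtr_gt0 divr_gt0.
have sV : Num.sqrt ((c - a) / (1 - c)) = s^-1.
  by rewrite /s -sqrtrV ?invf_div// divr_ge0 ?ltW.
have sM : Num.sqrt ((c - a) * (1 - c)) = s * (c - a).
  apply: sqr_inj; rewrite ?sqrtr_ge0 ?mulr_ge0 ?ltW//.
  rewrite exprMn /s !sqr_sqrtr ?divr_ge0 ?mulr_ge0 ?ltW//.
  by rewrite expr2 mulrA divfK ?gt_eqF// mulrC.
rewrite /cap_density /cap_core /cap_primitive -/c -/a -/s sV sM atanV//.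
have S0 : sin alpha + pi - alpha != 0.
  by rewrite gt_eqF// -addrA addr_gt0// subr_gt0.
have FE : pi + q * (pi - alpha) = 2 * pi ^+ 2 * kappa * (sin alpha + pi - alpha).
  have piE : pi = 2 * pi ^+ 2 * kappa * (sin alpha + c * (pi - alpha)).
    transitivity (pi * (kappa * (sin alpha + c * (pi - alpha)) * (2 * pi))).
      by rewrite mass mulr1.
    by ring.
  by rewrite qE -/c {1}piE; ring.
rewrite FE qE -/c; move: (gt_eqF da) S0 (lt0r_neq0 (@pi_gt0 R)).
move: (@pi R) (atan s) => P at_s /negbT da0 S0 P0.
by field; rewrite S0 P0 da0.
Qed.

Lemma cap_probabilityE A : measurable A -> mu0 A =
  (\int[leb]_(phi in `]alpha, pi[) ((kappa * (cap_core alpha phi * sin phi))%:E *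
     \int[leb]_(theta in `[0%R, (2 * pi)%R]) (\1_A (spherical theta phi) : R)%:E))%E.
Proof.
move=> mA; rewrite -(integral_cap_probability aI (ltW k0) mass (g := fun x => (\1_A x)%:E))//.
- by rewrite integral_indic// setIT.
- by apply/measurable_EFinP; exact: measurable_indic.
Qed.

Let mind A : measurable A -> measurable_fun setT (fun p : R * R => (\1_A (spherical p.2 p.1) : R)%:E).
Proof.
move=> mA; apply/measurable_EFinP.
apply: (@measurableT_comp _ _ _ _ _ _ (\1_A : R3 R -> R)); last exact: measurable_spherical.
exact: measurable_indic.
Qed.

(** The end points alpha and pi, where [cap_density] and [cap_core] may differ,
    form a null set. *)
Lemma has_density_cap_probability : has_density_on_cap mu0 alpha (cap_density q alpha).
Proof.
move=> A mA; rewrite cap_probabilityE//.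
have /andP[a0 api] := aI.
have inner (phi : R) : phi \in [set` `]alpha, pi[] ->
   (((kappa * (cap_core alpha phi * sin phi))%:E *
     \int[leb]_(theta in `[0%R, (2 * pi)%R]) (\1_A (spherical theta phi) : R)%:E) =
    \int[leb]_(theta in `[0%R, (2 * pi)%R])
      (cap_density q alpha phi * sin phi * \1_A (spherical theta phi))%:E)%E.
  rewrite inE/= in_itv/= => pI; have /andP[ap ppi] := pI.
  rewrite -ge0_integralZ_EFin//.
  - by apply: eq_integral => theta _; rewrite cap_density_core// !mulrA.
  - apply: measurable_funTS; apply/measurable_EFinP.
    exact: (measurableT_comp (mind mA) (measurable_pair1 phi)).
  - apply: mulr_ge0; first exact: ltW.
    by apply: mulr_ge0; [exact: cap_core_ge0|rewrite sin_ge0_pi// !ltW// (lt_trans a0)].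
transitivity (\int[leb]_(phi in `]alpha, pi[) \int[leb]_(theta in `[0%R, (2 * pi)%R])
      (cap_density q alpha phi * sin phi * \1_A (spherical theta phi))%:E)%E.
  by apply: eq_integral => phi pI; exact: inner.
have mo : measurable_fun (`]alpha, pi[%classic : set R) (fun phi =>
   \int[leb]_(theta in `[0%R, (2 * pi)%R])
      (cap_density q alpha phi * sin phi * \1_A (spherical theta phi))%:E)%E.
  apply: (eq_measurable_fun (fun phi => ((kappa * (cap_core alpha phi * sin phi))%:E *
     \int[leb]_(theta in `[0%R, (2 * pi)%R]) (\1_A (spherical theta phi) : R)%:E)%E)) => //.
  apply: measurable_funTS; apply: emeasurable_funM.
    by rewrite /cap_core /cap_primitive; mfun.
  exact: (@measurable_integral_itv R (fun p => (\1_A (spherical p.2 p.1))%:E) 0 (2 * pi) (mind mA)).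
exact: (esym (integral_itv_bndoo true false mo)).
Qed.

End density_support.

(** * The support *)

Section open_R3.
Context (R : realType).

Lemma ball_R3 (x y : R3 R) (e : R) : ball x e y <->
  [/\ `|x.1.1 - y.1.1| < e, `|x.1.2 - y.1.2| < e & `|x.2 - y.2| < e].
Proof. by split => [[[]]|[]]. Qed.

(** An open set is the union of the cubes with rational centre and half-side
    1 / (n + 1) that it contains.  Hence measures that agree on the product
    sigma-algebra have the same support. *)
Lemma open_R3_measurable (U : set (R3 R)) : open U -> measurable U.
Proof.
move=> oU.
pose B (a b c : rat) (n : nat) : set (R3 R) :=
  [set x | [/\ `|x.1.1 - ratr a| < n.+1%:R^-1, `|x.1.2 - ratr b| < n.+1%:R^-1 &
     `|x.2 - ratr c| < n.+1%:R^-1]].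
pose V a b c n := if `[< B a b c n `<=` U >] then B a b c n else set0.
have mB a b c n : measurable (B a b c n).
  rewrite (_ : B a b c n = (ball (ratr a : R) n.+1%:R^-1 `*` ball (ratr b : R) n.+1%:R^-1)
     `*` ball (ratr c : R) n.+1%:R^-1).
    by apply: measurableX; [apply: measurableX|]; exact: measurable_ball.
  by apply/seteqP; split => x /=; rewrite /ball/= ![`|ratr _ - _|]distrC; [move=> []|move=> [[]]].
have mV a b c n : measurable (V a b c n) by rewrite /V; case: ifP.
have -> : U = \bigcup_a \bigcup_b \bigcup_c \bigcup_n V a b c n.
  apply/seteqP; split => x; last first.
    by move=> [a _ [b _ [c _ [n _]]]]; rewrite /V; case: ifPn => // /asboolP; exact.
  move=> Ux; have /nbhs_ballP[e /= e0 eU] : nbhs x U by exact: open_nbhs_nbhs.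
  have [n nE] : exists n : nat, n.+1%:R^-1 < e / 2 :> R.
    have e20 : 0 < e / 2 by rewrite divr_gt0.
    exists (Num.trunc (e / 2)^-1); rewrite -[ltRHS]invrK ltf_pV2 ?posrE ?invr_gt0//.
    exact: truncnS_gt.
  have near (t : R) : exists a : rat, `|t - ratr a| < n.+1%:R^-1.
    have : t - n.+1%:R^-1 < t + n.+1%:R^-1 by rewrite ltrBlDr -addrA ltrDl addr_gt0.
    move/rat_in_itvoo => [a]; rewrite in_itv/= => /andP[h1 h2]; exists a.
    move: (ratr a : R) (n.+1%:R^-1 : R) h1 h2 => z d h1 h2.
    by rewrite ltr_norml; apply/andP; split; lra.
  have [a ha] := near x.1.1; have [b hb] := near x.1.2; have [c hc] := near x.2.
  exists a => //; exists b => //; exists c => //; exists n => //.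
  rewrite /V; case: ifPn => [_|/asboolPn]; first by split.
  case=> y [h1 h2 h3]; apply: eU; apply/ball_R3.
  have tri (s t r : R) : `|s - r| < n.+1%:R^-1 -> `|t - r| < n.+1%:R^-1 -> `|s - t| < e.
    move=> k1 k2; rewrite (_ : s - t = (s - r) - (t - r)); last by ring.
    by apply: le_lt_trans (ler_normB _ _) _; rewrite (splitr e) ltrD// (lt_trans _ nE).
  by split; [apply: tri ha h1|apply: tri hb h2|apply: tri hc h3].
apply: bigcupT_measurable_rat => a; apply: bigcupT_measurable_rat => b.
apply: bigcupT_measurable_rat => c; exact: bigcupT_measurable.
Qed.

Lemma integral_itvoo_gt0 (u v : R) (f : R -> \bar R) : u < v ->
  measurable_fun (`]u, v[%classic : set R) f -> (forall x : R, (u < x < v)%R -> 0 < f x)%E ->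
  (0 < \int[lebesgue_measure]_(x in `]u, v[) f x)%E.
Proof.
move=> uv mf f0; rewrite lt_neqAle integral_ge0 ?andbT; last first.
  by move=> x; rewrite /= in_itv/= => /f0/ltW.
apply/negP => /eqP/esym h.
have : ae_eq (@lebesgue_measure R) `]u, v[%classic f (cst 0%E).
  apply/ae_eq_integral_abs => //; rewrite -[RHS]h; apply: eq_integral => x.
  by rewrite inE/= in_itv/= => /f0/ltW x0; rewrite gee0_abs.
move=> [N [mN N0 sN]].
have : (lebesgue_measure (`]u, v[%classic : set R) <= lebesgue_measure N)%E.
  apply: le_measure; rewrite ?inE// => x xI; apply: sN => /= /(_ xI) fx.
  by move: xI; rewrite /= in_itv/= => /f0; rewrite fx ltxx.
by rewrite N0 lebesgue_measure_itv/= lte_fin uv -EFinD lee_fin leNgt subr_gt0 uv.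
Qed.

(** Used with [x] a polar angle or an azimuth of a point of the cap, possibly an
    end point of its range. *)
Lemma itvoo_near (a b x e : R) : a < b -> a <= x <= b -> 0 < e ->
  exists u v : R, u < v /\ forall y, u < y < v -> a < y < b /\ `|x - y| < e.
Proof.
move=> ab /andP[ax xb] e0; exists (Num.max a (x - e)), (Num.min b (x + e)); split.
  by rewrite lt_min !gt_max ab/= ltrBlDr; apply/and3P; split; lra.
move=> y; rewrite gt_max lt_min => /andP[/andP[h1 h2] /andP[h3 h4]].
by rewrite h1 h3; split=> //; rewrite ltr_norml; apply/andP; split; lra.
Qed.
End open_R3.

Lemma ler_cos_itv (R : realType) (x y : R) : 0 <= x <= pi -> 0 <= y <= pi ->
  (cos x <= cos y) = (y <= x).
Proof. by move=> xI yI; rewrite !leNgt ltr_cos ?in_itv. Qed.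

Section support.
Context (R : realType) (alpha : R).
Context (aI : 0 < alpha < pi).

Lemma capE : cap alpha = S2 `&` [set x | x.2 <= cos alpha].
Proof.
have /andP[a0 api] := aI; apply/seteqP; split => x /=.
  move=> [theta [phi [_ /andP[p1 p2] ->]]]; split; first exact: spherical_S2.
  by rewrite /= ler_cos_itv// ?p2 ?(ltW a0) ?(ltW api) ?(le_trans (ltW a0)).
move=> [xS x2]; have [theta [phi [tI /andP[p0 p1] E]]] := S2_spherical xS.
exists theta, phi; split => //; rewrite p1 andbT.
by move: x2; rewrite E/= ler_cos_itv// ?p0 ?(ltW a0) ?(ltW api).
Qed.

Lemma measurable_cap : measurable (cap alpha).
Proof.
rewrite capE; apply: measurableI; first exact: measurable_S2.
rewrite (_ : [set x | _] = (fun x : R3 R => x.2) @^-1` `]-oo, cos alpha]); last first.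
  by apply/seteqP; split => x /=; rewrite in_itv.
rewrite -[X in measurable X]setTI.
by apply: measurable_snd.
Qed.

Lemma closed_cap : closed (cap alpha).
Proof.
rewrite capE; apply: closedI.
  rewrite (_ : S2 = (fun x : R3 R => x.1.1 ^+ 2 + x.1.2 ^+ 2 + x.2 ^+ 2) @^-1` [set 1]).
    apply: closed_comp => [x _|]; last exact: closed_eq.
    have c1 : continuous_at x (fun x : R3 R => x.1.1).
      by apply: (@cvg_comp _ _ _ fst fst); exact: cvg_fst.
    have c2 : continuous_at x (fun x : R3 R => x.1.2).
      by apply: (@cvg_comp _ _ _ fst snd); [exact: cvg_fst|exact: cvg_snd].
    have c3 : continuous_at x (fun x : R3 R => x.2) by exact: cvg_snd.
    by apply: cvgD; [apply: cvgD|]; exact: cvgM.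
  by apply/seteqP; split => x /=; rewrite S2E.
rewrite (_ : [set x | _] = (fun x : R3 R => x.2) @^-1` [set z | z <= cos alpha]); last by [].
by apply: closed_comp => [x _|]; [exact: cvg_snd|exact: closed_le].
Qed.

Lemma continuous_spherical : continuous (fun p : R * R => spherical p.1 p.2).
Proof.
move=> p.
have cc (f g : R -> R) : continuous f -> continuous g ->
    continuous_at p (fun p : R * R => f p.2 * g p.1).
  move=> cf cg; apply: cvgM.
    by apply: (@cvg_comp _ _ _ snd f); [exact: cvg_snd|exact: cf].
  by apply: (@cvg_comp _ _ _ fst g); [exact: cvg_fst|exact: cg].
have h : continuous_at p (fun p : R * R => (sin p.2 * cos p.1, sin p.2 * sin p.1)).
  exact: (cvg_pair (cc _ _ (@continuous_sin R) (@continuous_cos R))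
    (cc _ _ (@continuous_sin R) (@continuous_sin R))).
have h3 : continuous_at p (fun p : R * R => cos p.2).
  by apply: (@cvg_comp _ _ _ snd cos); [exact: cvg_snd|exact: continuous_cos].
exact: (cvg_pair h h3).
Qed.

Lemma cap_core_gt0 (phi : R) : alpha < phi < pi -> 0 < cap_core alpha phi.
Proof.
move=> /andP[aphi phipi]; have /andP[a0 api] := aI.
have ca : cos phi < cos alpha.
  by rewrite ltr_cos// in_itv/= ?ltW// (lt_trans a0).
have /andP[_ c1] := cos_itvoo aI.
have da : 0 < 1 - cos phi by rewrite subr_gt0 (lt_trans ca).
rewrite /cap_core /cap_primitive divr_gt0// ltr_wpDl//.
  by rewrite mulr_ge0 ?atan_ge0 ?sqrtr_ge0// ltW.
by rewrite sqrtr_gt0 mulr_gt0 ?subr_gt0.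
Qed.

Context (kappa : R).
Context (k0 : 0 < kappa)
  (mass : kappa * (sin alpha + cos alpha * (pi - alpha)) * (2 * pi) = 1).
Local Notation leb := (@lebesgue_measure R).
Local Notation mu0 := (cap_probability aI (ltW k0) mass).

Lemma cap_probability_setC : mu0 (~` cap alpha) = 0%E.
Proof.
have /andP[a0 api] := aI.
rewrite cap_probabilityE; last by apply: measurableC; exact: measurable_cap.
apply: integral0_eq => phi; rewrite /= in_itv/= => /andP[ap ppi].
rewrite integral0_eq ?mule0// => theta; rewrite /= in_itv/= => tI.
rewrite indicE memNset//=; apply; exists theta, phi; split => //.
by rewrite (ltW ap) (ltW ppi).
Qed.

(** Since the spherical coordinates are continuous, an open set that meets the cap
    contains the image of a small rectangle of angles, on which the density is
    positive. *)
Lemma cap_probability_gt0 (U : set (R3 R)) x : open U -> cap alpha x -> U x -> (0 < mu0 U)%E.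
Proof.
move=> oU [theta [phi [tI pI xE]]] Ux; have mU := open_R3_measurable oU.
have /andP[a0 api] := aI.
have [e e0 eU] : exists2 e : R, 0 < e & forall t p, `|theta - t| < e -> `|phi - p| < e -> U (spherical t p).
  have : nbhs (theta, phi) ((fun p : R * R => spherical p.1 p.2) @^-1` U).
    by apply: continuous_spherical; apply: open_nbhs_nbhs; split => //=; rewrite -xE.
  move=> /nbhs_ballP[e /= e0 eU]; exists e => // t p h1 h2.
  by apply: (eU (t, p)).
have pi0 := @pi_gt0 R.
have [u [v [uv Huv]]] := itvoo_near api pI e0.
have [u' [v' [uv' Huv']]] := itvoo_near (mulr_gt0 (@ltr0n R 2) pi0) tI e0.
pose ind p := (\1_U (spherical p.2 p.1) : R)%:E.
have mind : measurable_fun setT (ind : R * R -> \bar R).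
  apply/measurable_EFinP.
  apply: (@measurableT_comp _ _ _ _ _ _ (\1_U : R3 R -> R)); last exact: measurable_spherical.
  exact: measurable_indic.
have mindp p : measurable_fun setT (fun t => ind (p, t)).
  exact: (measurableT_comp mind (measurable_pair1 p)).
have mG := @measurable_integral_itv R ind 0 (2 * pi) mind.
have w0 p : alpha < p < pi -> 0 < kappa * (cap_core alpha p * sin p).
  move=> /andP[p1 p2]; apply: mulr_gt0 => //; apply: mulr_gt0.
    by rewrite cap_core_gt0// p1.
  by rewrite sin_gt0_pi// p2 (lt_trans a0).
rewrite cap_probabilityE//.
have mf : measurable_fun setT (fun p => (kappa * (cap_core alpha p * sin p))%:E *
     \int[leb]_(theta in `[0%R, (2 * pi)%R]) ind (p, theta))%E.
  apply: emeasurable_funM; last by apply: mG => p; rewrite lee_fin.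
  by rewrite /cap_core /cap_primitive; mfun.
apply: (@lt_le_trans _ _ (\int[leb]_(p in `]u, v[) ((kappa * (cap_core alpha p * sin p))%:E *
     \int[leb]_(theta in `[0%R, (2 * pi)%R]) ind (p, theta)))%E).
  apply: integral_itvoo_gt0 => //; first exact: measurable_funTS.
  move=> p pI'; have [pI2 pe] := Huv _ pI'.
  apply: mule_gt0; first by rewrite lte_fin w0.
  apply: (@lt_le_trans _ _ (\int[leb]_(t in `]u', v'[) ind (p, t))%E).
    apply: integral_itvoo_gt0 => //; first exact: measurable_funTS.
    move=> t tI'; have [tI2 te] := Huv' _ tI'.
    by rewrite /ind indicE mem_set ?lte_fin//=; exact: eU.
  apply: ge0_subset_integral => //.
  - exact: (measurable_funTS (mindp p)).
  - by move=> t _; rewrite lee_fin.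
  by move=> t; rewrite /= !in_itv/= => /Huv'[/andP[h1 h2] _]; rewrite !ltW.
apply: ge0_subset_integral => //; first exact: (measurable_funTS mf).
- move=> p; rewrite /= in_itv/= => pI'; rewrite mule_ge0 ?lee_fin ?(ltW (w0 _ pI'))//.
  by apply: integral_ge0 => t _; rewrite lee_fin.
- by move=> p; rewrite /= !in_itv/= => /Huv[].
Qed.

Lemma msupport_cap_probability : msupport mu0 = cap alpha.
Proof.
apply/seteqP; split => x.
  move=> xs; apply: contrapT => xc.
  have := xs (~` cap alpha) (closed_openC closed_cap) xc.
  by rewrite cap_probability_setC ltxx.
by move=> xc U oU; exact: cap_probability_gt0.
Qed.

End support.

(** * The cap angle and the theorem *)

Section cap_angle.
Context (R : realType) (q : R).
Context (q0 : 0 < q).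

Let g (a : R) : R := (pi + q * (pi - a)) * cos a + q * sin a.

Lemma cap_angle_equationE a : cap_angle_equation q a <-> g a = pi.
Proof.
rewrite /cap_angle_equation /sec /tan /g; case: ifPn => c0; first by split=> [<-|->].
split => h.
  have -> : (pi + q * (pi - a)) * cos a + q * sin a =
    (pi + q * (pi - a) + q * (sin a / cos a)) * cos a by field.
  by rewrite -h divfK.
by rewrite -{1}h; field.
Qed.

Let dg (a : R) : is_derive a 1 g (- ((pi + q * (pi - a)) * sin a)).
Proof.
apply: is_derive_eq; rewrite /GRing.scale/=; ring.
Qed.

Let cg (a b : R) : {within `[a, b], continuous g}.
Proof.
by apply: continuous_subspaceT => x; exact: (is_derive_continuous (dg x)).
Qed.

Let g_inj a b : 0 < a -> a < b -> b < pi -> g a = g b -> False.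
Proof.
move=> a0 ab bpi gab.
have [c cI] := @Rolle R g a b ab (fun x _ => @ex_derive _ _ _ _ _ _ _ (dg x)) (@cg a b) gab.
move=> [_ e]; have [_ e'] := dg c; move: e; rewrite e' => /eqP.
move: cI; rewrite in_itv/= => /andP[ac cb].
have cpi := lt_trans cb bpi; have c0 := lt_trans a0 ac.
rewrite oppr_eq0 gt_eqF// mulr_gt0 ?sin_gt0_pi ?c0//.
by rewrite addr_gt0 ?pi_gt0// mulr_gt0// subr_gt0.
Qed.

(** The derivative of g at a is - (pi + q (pi - a)) sin a, which does not vanish
    on ]0, pi[, so Rolle's theorem excludes two solutions. *)
Lemma cap_angle_unique a b : 0 < a < pi -> 0 < b < pi ->
  cap_angle_equation q a -> cap_angle_equation q b -> a = b.
Proof.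
move=> /andP[a0 api] /andP[b0 bpi] /cap_angle_equationE ga /cap_angle_equationE gb.
have [ab|ba|//] := ltgtP a b.
  by case: (g_inj a0 ab bpi); rewrite ga.
by case: (g_inj b0 ba api); rewrite ga.
Qed.

(** Intermediate values: g takes the value pi + q pi at 0 and - pi at pi. *)
Lemma cap_angle_exists : exists2 a : R, 0 < a < pi & cap_angle_equation q a.
Proof.
have pi0 := @pi_gt0 R.
have g0 : pi < g 0 by rewrite /g cos0 sin0 mulr0 mulr1 addr0 subr0 ltrDl mulr_gt0.
have gpi : g pi < pi.
  by rewrite /g cospi sinpi subrr !mulr0 !addr0 mulrN1 gtrN.
have [|c cI gc] := @IVT R g 0 pi pi (ltW pi0) (@cg 0 pi).
  by rewrite ge_min le_max (ltW g0) (ltW gpi) orbT.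
exists c; last exact/cap_angle_equationE.
move: cI; rewrite in_itv/= => /andP[c0 c1]; rewrite !lt_neqAle c0 c1 !andbT.
apply/andP; split; apply/eqP => E.
  have e : g 0 = pi by rewrite -gc; congr g.
  by rewrite e ltxx in g0.
have e : g pi = pi by rewrite -[RHS]gc; congr g.
by rewrite e ltxx in gpi.
Qed.

(** The equation gives (pi + q (pi - a)) (1 - cos a) = q (sin a + pi - a), which is
    q = F (1 - cos a) for F = (pi + q (pi - a)) / (sin a + pi - a). *)
Lemma cap_angle_constants a : 0 < a < pi -> cap_angle_equation q a ->
  exists2 kappa : R, 0 < kappa &
    kappa * (sin a + cos a * (pi - a)) * (2 * pi) = 1 /\
    q = 2 * pi ^+ 2 * kappa * (1 - cos a).
Proof.
move=> aI /cap_angle_equationE; rewrite /g => E; have /andP[a0 api] := aI.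
have pi0 := @pi_gt0 R; have s0 : 0 < sin a by exact: sin_gt0_pi.
have D0 : 0 < sin a + pi - a by rewrite -addrA addr_gt0// subr_gt0.
have N0 : 0 < pi + q * (pi - a) by rewrite addr_gt0// mulr_gt0// subr_gt0.
pose F := (pi + q * (pi - a)) / (sin a + pi - a).
have F0 : 0 < F by rewrite divr_gt0.
have FD : F * (sin a + pi - a) = pi + q * (pi - a) by rewrite divfK// gt_eqF.
have Fq : q = F * (1 - cos a).
  apply: (mulIf (lt0r_neq0 D0)); rewrite [RHS]mulrAC FD [RHS]mulrBr mulr1.
  move: E; move: (pi : R) (cos a) (sin a) => P c s E.
  rewrite -[(P + q * (P - a)) * c](addrK (q * s)) E; ring.
have FP : F * (sin a + cos a * (pi - a)) = pi.
  have -> : F * (sin a + cos a * (pi - a)) =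
    F * (sin a + pi - a) - F * (1 - cos a) * (pi - a) by ring.
  by rewrite -Fq FD addrK.
have pin : pi != 0 :> R by exact: lt0r_neq0.
exists (F / (2 * pi ^+ 2)); first by rewrite divr_gt0// mulr_gt0// exprn_gt0.
have fld (P G c : R) : P != 0 -> G * (1 - c) = 2 * P ^+ 2 * (G / (2 * P ^+ 2)) * (1 - c).
  by move=> P0; field.
have fld' (P G x : R) : P != 0 -> G / (2 * P ^+ 2) * x * (2 * P) = G * x / P.
  by move=> P0; field.
by split; [rewrite fld'// FP divff|rewrite [LHS]Fq; exact: fld].
Qed.

End cap_angle.

Lemma msupport_eq (R : realType) (mu nu : probability (R3 R) R) :
  (forall A, measurable A -> mu A = nu A) -> msupport mu = msupport nu.
Proof.
move=> h; apply/seteqP; split => x xs U oU Ux.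
  by rewrite -h; [exact: xs|exact: open_R3_measurable].
by rewrite h; [exact: xs|exact: open_R3_measurable].
Qed.

Unset Implicit Arguments.

Theorem theorem2p7 (R : realType) (q : R) (hq : 0 < q) :
  exists alpha0 : R,
    [/\ 0 < alpha0 < pi,
        cap_angle_equation q alpha0,
        (forall alpha : R, 0 < alpha < pi ->
           cap_angle_equation q alpha -> alpha = alpha0),
        (exists mu : probability (R3 R) R,
           extremal (point_charge_field q) mu)
      & forall mu : probability (R3 R) R,
          extremal (point_charge_field q) mu ->
          msupport mu = cap alpha0 /\
          has_density_on_cap mu alpha0 (cap_density q alpha0)].
Proof.
have [a aI aE] := cap_angle_exists hq.
have [k k0 [mass qE]] := cap_angle_constants hq aI aE.
have ext := extremal_cap_probability aI k0 mass.
have uniq := extremal_eq_cap aI k0 mass.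
rewrite -qE in ext uniq.
exists a; split => //.
- by move=> b bI bE; exact: (cap_angle_unique hq bI aI bE aE).
- by eexists; exact: ext.
move=> mu muE; split.
  rewrite (msupport_eq (fun A => uniq mu A muE)).
  exact: msupport_cap_probability.
move=> A mA; rewrite (uniq mu A muE mA).
exact: (has_density_cap_probability aI k0 mass qE).
Qed.
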